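(* With probability one, the following holds: if $d_*<0$, then $\dim\Theta=-\infty$; and if $d_*\ge 0$, then $\dim\Theta\in\{-\infty,d_*\}$.
   Context: Tree. $\mathbb N=\{1,2,\ldots\}$; $\mathcal U$ is the set of finite words over $\mathbb N$, including the empty word $\varnothing$; $\langle u\rangle$ is the length (generation) of $u$; for $u\ne\varnothing$, $\pi(u)$ is $u$ with its last letter removed. Fix integers $m_j\ge 2$ ($j\ge 0$). For $j\ge 0$, $\mathcal U_j=\{u\in\mathcal U:\ u_i\le m_{j+i-1}\text{ for }1\le i\le\langle u\rangle\}$ and $\mathcal U_j^*=\mathcal U_j\setminus\{\varnothing\}$. For $u\in\mathcal U_0$, $u\,\mathcal U_{\langle u\rangle}$ (resp. $u\,\mathcal U_{\langle u\rangle}^*$) is the set of concatenations of $u$ with words of $\mathcal U_{\langle u\rangle}$ (resp. $\mathcal U_{\langle u\rangle}^*$). Compacts. Fix $d\ge 1$, reals $0<\underline\beta\le\overline\beta<1$, and for each $j\ge0$ a probability measure $\mu_j$ on $[\underline\beta,\overline\beta]^{m_j}$. $(J_u)_{u\in\mathcal U_0}$ is a random family of compact subsets of $\mathbb R^d$ with positive diameters $|J_u|$, such that: (A) for each $u\in\mathcal U_0$, the sets $J_{uk}$, $1\le k\le m_{\langle u\rangle}$, are subsets of $J_u$ with disjoint interiors; (B) there is a real $\kappa>0$ such that for each $u\in\mathcal U_0$ the Lebesgue measure of the interior of $J_u$ is at least $\kappa|J_u|^d$; (C) the ratios $L_u=|J_u|/|J_{\pi(u)}|$, $u\in\mathcal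 U_0^*$, are random variables and the vectors $(L_{uk})_{1\le k\le m_{\langle u\rangle}}$, $u\in\mathcal U_0$, are independent with respective distributions $\mu_{\langle u\rangle}$. Markov chain. For $j\ge0$ and $t\in\{0,1\}$ let $\nu_{t,j}$ be a probability measure on $\{0,1\}^{m_j}$. $(X_u)_{u\in\mathcal U_0}$ is a family of $\{0,1\}$-valued random variables, independent of $(L_u)_{u\in\mathcal U_0^*}$, such that for every $u\in\mathcal U_0$ and $A\subseteq\{0,1\}^{m_{\langle u\rangle}}$, $\mathbb P\big((X_{uk})_{1\le k\le m_{\langle u\rangle}}\in A\mid \mathcal G_u\big)=\nu_{X_u,\langle u\rangle}(A)$, where $\mathcal G_u=\sigma(X_v,\ v\in\mathcal U_0\setminus(u\,\mathcal U^*_{\langle u\rangle}))$. The set $\Theta$. Almost surely, for every sequence $\zeta=(\zeta_j)_{j\ge1}$ in $\mathbb N$ with $\zeta_1\ldots\zeta_j\in\mathcal U_0$ for all $j\ge 1$, the set $\bigcap_{j\ge1}J_{\zeta_1\ldots\zeta_j}$ is a single point, denoted $x_\zeta$. For $u\in\mathcal U_0$ let $\tau_u=\{v\in u\,\mathcal U_{\langle u\rangle}:\ X_{v_1\ldots v_j}=1\text{ for all }\langle u\rangle\le j\le\langle v\rangle\}$, $\partial\tau_u=\{\zeta\in\mathbb N^{\mathbb N}:\ \zeta_1\ldots\zeta_j\in\tau_u\text{ for all }j\ge\langle u\rangle\}$, $K_u=\{x_\zeta:\zeta\in\partial\tau_u\}$, and $\Theta=\bigcup_{u\in\mathcal U_0}K_u$.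 $\dim$ denotes Hausdorff dimension, with $\dim\emptyset=-\infty$. The number $d_*$. For $s\in\mathbb R$ and $j\ge0$, $\alpha_{s,j}=\int_{\{0,1\}^{m_j}}\int_{[\underline\beta,\overline\beta]^{m_j}}\sum_{k=1}^{m_j}\ell_k^s x_k\,\mu_j(d\ell)\,\nu_{1,j}(dx)$. Let $\underline j=\inf\{j_0\ge0:\ \alpha_{0,j}>0\ \text{for all } j\ge j_0\}$ (with $\inf\emptyset=\infty$). If $\underline j=\infty$, $d_*=-\infty$. Otherwise let $\rho(s)=\liminf_{j\to\infty}\frac1j\sum_{n=\underline j}^{j-1}\log\alpha_{s,n}$ for $s\in\mathbb R$ ($\rho$ is either identically $-\infty$ or a decreasing bijection of $\mathbb R$ onto $\mathbb R$) and $d_*=\sup\{s\in\mathbb R:\rho(s)>0\}=\inf\{s\in\mathbb R:\rho(s)<0\}\in[-\infty,\infty)$. *)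

(* Defs.v *)
From HB Require Import structures.
From mathcomp Require Export all_boot all_order all_algebra.
From mathcomp Require Export all_classical all_reals all_analysis.
From mathcomp Require Export measurable_realfun.
Export Order.TTheory GRing.Theory Num.Theory.
Export numFieldNormedType.Exports.

Set Implicit Arguments.
Unset Strict Implicit.
Unset Printing Implicit Defensive.

Global Open Scope classical_set_scope.
Global Open Scope ring_scope.

Section Tree.
Variable m : nat -> nat.

(* A word is a [seq nat] with positive letters; the letter written u_i in
   mathematics (1 <= i) is [nth 0 u i.-1]. *)
Definition words (j : nat) : set (seq nat) :=
  [set u | forall i, (i < size u)%N -> (0 < nth 0%N u i <= m (j + i))%N].

Definition words_star (j : nat) : set (seq nat) := words j `\ [::].

Definition subtree (u : seq nat) : set (seq nat) :=
  [set u ++ v | v in words (size u)].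

Definition subtree_star (u : seq nat) : set (seq nat) :=
  [set u ++ v | v in words_star (size u)].

End Tree.

Definition parent (u : seq nat) : seq nat := take (size u).-1 u.

Section Geometry.
Context {R : realType} {d : nat}.
Implicit Types U E : set 'rV[R]_d.

(* The norm carried by ['rV[R]_d] in the library is the sup norm. *)
Definition eucl_norm (x : 'rV[R]_d) : R := Num.sqrt (\sum_i x ord0 i ^+ 2).

(* The [maxe] makes the diameter of the empty set 0. *)
Definition ediam U : \bar R :=
  maxe 0%E (ereal_sup [set (eucl_norm (x - y))%:E | x in U & y in U]).

Definition diam U : R := fine (ediam U).

Definition box (a b : 'rV[R]_d) : set 'rV[R]_d :=
  [set x | forall i, a ord0 i <= x ord0 i <= b ord0 i].

Definition box_volume (a b : 'rV[R]_d) : R :=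
  \prod_i Num.max 0 (b ord0 i - a ord0 i).

(* d-dimensional Lebesgue outer measure; it is the Lebesgue measure on open
   sets, the only sets to which it is applied. *)
Definition lebesgue_vol E : \bar R :=
  ereal_inf [set (\sum_(0 <= k <oo) (box_volume (ab k).1 (ab k).2)%:E)%E |
    ab in [set ab : nat -> 'rV[R]_d * 'rV[R]_d |
             E `<=` \bigcup_k box (ab k).1 (ab k).2]].

(* |U|^s, equal to 0 for the empty set, and to 1 for nonempty U when s = 0. *)
Definition gauge (s : R) U : R := if U == set0 then 0 else diam U `^ s.

Definition hausdorff_premeasure (s delta : R) E : \bar R :=
  ereal_inf [set (\sum_(0 <= k <oo) (gauge s (V k))%:E)%E |
    V in [set V : nat -> set 'rV[R]_d |
            E `<=` \bigcup_k V k /\ forall k, (ediam (V k) <= delta%:E)%E]].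

Definition hausdorff_measure (s : R) E : \bar R :=
  ereal_sup [set hausdorff_premeasure s delta E |
    delta in [set delta : R | 0 < delta]].

Definition hausdorff_dim E : \bar R :=
  if E == set0 then -oo%E
  else ereal_inf [set s%:E | s in
         [set s : R | 0 <= s /\ hausdorff_measure s E = 0%E]].

End Geometry.

Section Probability.
Context {R : realType} {disp : measure_display} {T : measurableType disp}.
Variable P : probability T R.

(* The sigma-algebra generated by [Y i], [i] in [D]. *)
Definition sigma_of {I : Type} {disp' : measure_display}
    {V : measurableType disp'} (D : set I) (Y : I -> T -> V) : set (set T) :=
  <<s \bigcup_(i in D) preimage_set_system setT (Y i) measurable >>.

Definition independent2 (F G : set (set T)) : Prop :=
  forall A B, F A -> G B -> P (A `&` B) = (P A * P B)%E.

Definition mutually_independent {I : eqType} (D : set I)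
    (F : I -> set (set T)) : Prop :=
  forall (s : seq I) (A : I -> set T), uniq s ->
    (forall i, i \in s -> D i /\ F i (A i)) ->
    P (\bigcap_(i in [set` s]) A i) = (\prod_(i <- s) P (A i))%E.

Definition has_law {disp' : measure_display} {V : measurableType disp'}
    (Y : T -> V) (mu : probability V R) : Prop :=
  forall B, measurable B -> P (Y @^-1` B) = mu B.

(* [Z] is a version of the conditional probability of [E] given [G]. *)
Definition is_cond_prob (E : set T) (G : set (set T)) (Z : T -> \bar R) :
    Prop :=
  (forall B : set (\bar R), measurable B -> G (Z @^-1` B)) /\
  (forall F, G F -> (\int[P]_(w in F) Z w)%E = P (E `&` F)).

End Probability.

Section Model.
Context {R : realType} {d : nat} {T : Type}.
Variable m : nat -> nat.
Variable J : seq nat -> T -> set 'rV[R]_d.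
Variable X : seq nat -> T -> bool.

Definition ratio (u : seq nat) (w : T) : R :=
  diam (J u w) / diam (J (parent u) w).

(* (Y_{uk}), 1 <= k <= m_{|u|} *)
Definition children {V : Type} (Y : seq nat -> T -> V) (u : seq nat) (w : T) :
    (m (size u)).-tuple V :=
  [tuple Y (rcons u k.+1) w | k < m (size u)].

Definition tau (u : seq nat) (w : T) : set (seq nat) :=
  [set v | subtree m u v /\
           forall j, (size u <= j <= size v)%N -> X (take j v) w].

(* A sequence (zeta_j), 1 <= j, is the function sending [j.-1] to zeta_j, so
   that [mkseq zeta j] is the word zeta_1 ... zeta_j. *)
Definition boundary_tau (u : seq nat) (w : T) : set (nat -> nat) :=
  [set zeta | forall j, (size u <= j)%N -> tau u w (mkseq zeta j)].

Definition nested_limit (zeta : nat -> nat) (w : T) : set 'rV[R]_d :=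
  \bigcap_(j in [set j | (1 <= j)%N]) J (mkseq zeta j) w.

(* x_zeta is defined on the almost sure event where all the sets
   [nested_limit zeta w] are singletons; off it, the sequences for which
   it does not exist contribute no point. *)
Definition K (u : seq nat) (w : T) : set 'rV[R]_d :=
  [set x | exists2 zeta, boundary_tau u w zeta & nested_limit zeta w = [set x]].

Definition Theta (w : T) : set 'rV[R]_d := \bigcup_(u in words m 0) K u w.

End Model.

Definition cube {R : realType} (n : nat) (a b : R) : set (n.-tuple R) :=
  [set l | forall k, a <= tnth l k <= b].

Section Threshold.
Context {R : realType}.
Variables (m : nat -> nat) (blo bhi : R).
Variable mu : forall j, probability ((m j).-tuple R) R.
Variable nu : bool -> forall j, probability ((m j).-tuple bool) R.

Definition alpha (s : R) (j : nat) : \bar R :=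
  (\int[nu true j]_x \int[mu j]_(l in cube blo bhi)
     (\sum_(k < m j) tnth l k `^ s * (tnth x k)%:R)%:E)%E.

Definition alpha0_pos_from (j0 : nat) : Prop :=
  forall j, (j0 <= j)%N -> (0 < alpha 0 j)%E.

Definition is_jlow (j0 : nat) : Prop :=
  alpha0_pos_from j0 /\ forall j1, alpha0_pos_from j1 -> (j0 <= j1)%N.

Definition jlow : nat := xget 0%N is_jlow.

(* Each [alpha s n] is finite, and positive for [n >= jlow] (if [jlow] is
   not a default value), so [ln (fine _)] is a genuine logarithm here. *)
Definition rho (s : R) : \bar R :=
  limn_einf (fun j : nat =>
    (j%:R^-1 * \sum_(jlow <= n < j) ln (fine (alpha s n)))%:E).

Definition dstar : \bar R :=
  if `[< exists j0, alpha0_pos_from j0 >]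
  then ereal_sup [set s%:E | s in [set s : R | (0 < rho s)%E]]
  else -oo%E.

End Threshold.

(* Main.v *)
Require Import Defs.
From mathcomp Require Import ring lra.

(** Fix [s >= 0]. Give a child of a surviving word the weight equal to the power
    [s] of its ratio if it has state 1, and 0 otherwise. Given the past of a word
    of state 1 at level [j], the weights of its children have total mean
    [alpha s j] ([one_step]). The randomness enters only through this property;
    what follows relies on three quantities defined by recursion over the first
    [N] generations below a word: the [mass], a sum of products of weights, the
    [content], the least total weight of a cut, and the [energy] of the flow given
    by the mass.

    Above the threshold. The sum of the powers [s] of the diameters of the
    surviving pieces of generation [N] below [u] is a multiple of a mass, whose
    mean is a product of the numbers [alpha s j]. If [s] exceeds the threshold,
    these products have lower limit 0 ([small_above]); hence so have the masses
    almost surely ([heavy_negligible]), and the surviving pieces are covers of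
    arbitrarily small total gauge ([Theta_null]). For [s = 0] the mass is a number
    of survivors, which must vanish: this settles a negative threshold
    ([K_empty]).

    Below the threshold. The volume condition bounds the numbers of children
    ([branching_bounded]). The levels vary, so moments are not bounded uniformly
    from an arbitrary level; but the logarithms of the products of the numbers
    [alpha s j], less a small linear term, tend to infinity, and from the levels
    of their future minima the products grow exponentially without loss
    ([growth_below]). From these levels the second moment of the normalized mass
    and its mean energy are bounded uniformly in the depth. A cut has weight at
    least the squared mass divided by the energy, in a form that goes through
    recursions and expectations ([content_ge_mass_energy]); so the mean content is
    bounded below ([expect_content_ge]), and from infinitely many levels the
    content of a word of state 1 stays bounded away from 0 with probability
    bounded below. A zero-one argument then shows that survival implies,
    almost surely, that the content has a positive limit ([zero_one]).

    Geometry. A set of a cover is met by a bounded number of pieces of comparable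
    diameter ([hit_count]), so a cheap cover yields a cheap family of words. If the
    content of [u] is bounded below, such a family is not a cut, and some surviving
    path avoids it ([uncut_path]); its limit point is a point of [K u] that the
    cover misses. Hence no measure of order below the threshold vanishes
    ([frostman_lower]). Letting the exponents run through the rational numbers
    gives the theorem ([dichotomy]). *)

Set Implicit Arguments.
Unset Strict Implicit.
Unset Printing Implicit Defensive.

(** * From events to integrals *)

Section pullback.
Context {R : realType} {d d' : measure_display} {T : measurableType d} {T' : measurableType d'}.
Variable P : {measure set T -> \bar R}.
Import HBNNSimple.
Local Open Scope ereal_scope.

(** Approximating [g] from below by simple functions, monotone convergence on
    both sides leaves the case of indicators. This is how product formulas for
    events become product formulas for expectations. *)
Lemma integral_pullback_ext (phi : T -> T') (h1 h2 : T -> R) :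
  measurable_fun setT phi ->
  measurable_fun setT h1 -> measurable_fun setT h2 ->
  (forall w, 0 <= h1 w)%R -> (forall w, 0 <= h2 w)%R ->
  (forall F, measurable F ->
     \int[P]_w (\1_F (phi w) * h1 w)%:E = \int[P]_w (\1_F (phi w) * h2 w)%:E) ->
  forall g : T' -> R, measurable_fun setT g -> (forall x, 0 <= g x)%R ->
  \int[P]_w (g (phi w) * h1 w)%:E = \int[P]_w (g (phi w) * h2 w)%:E.
Proof.
move=> mphi mh1 mh2 h10 h20 h12 g mg g0.
have mEg : measurable_fun setT (EFin \o g) by exact/measurable_EFinP.
pose f := nnsfun_approx measurableT mEg.
have fcvg x : EFin \o f^~ x @ \oo --> (g x)%:E.
  by apply: cvg_nnsfun_approx => // y _; rewrite lee_fin.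
have lim_h (h : T -> R) : measurable_fun setT h -> (forall w, 0 <= h w)%R ->
    \int[P]_w (g (phi w) * h w)%:E =
    limn (fun n => \int[P]_w (f n (phi w) * h w)%:E).
  move=> mh h0.
  transitivity (\int[P]_w limn (fun n => (f n (phi w) * h w)%:E)).
    apply: eq_integral => w _; apply/esym/cvg_lim => //.
    rewrite EFinM; under eq_fun do rewrite EFinM.
    by apply: cvgeZr => //; exact: fcvg.
  apply: monotone_convergence => //.
  - move=> n; apply/measurable_EFinP; apply: measurable_funM => //.
    by apply: (measurableT_comp _ mphi); exact: measurable_funP.
  - by move=> n w _; rewrite lee_fin mulr_ge0.
  - move=> w _ a b ab; rewrite lee_fin ler_wpM2r //.
    exact/lefP/nd_nnsfun_approx.
rewrite !lim_h //; congr (limn _); apply: funext => n.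
have expand (h : T -> R) : measurable_fun setT h -> (forall w, 0 <= h w)%R ->
    \int[P]_w (f n (phi w) * h w)%:E =
    \sum_(r \in range (f n)) r%:E * \int[P]_w (\1_(f n @^-1` [set r]) (phi w) * h w)%:E.
  move=> mh h0.
  transitivity (\int[P]_w \sum_(r \in range (f n))
      (r * (\1_(f n @^-1` [set r]) (phi w) * h w))%:E).
    apply: eq_integral => w _; rewrite [in LHS]fimfunE.
    rewrite fsbig_finite//= mulr_suml fsbig_finite//= -sumEFin.
    by apply: eq_bigr => r _; rewrite mulrA.
  rewrite ge0_integral_fsum //; last 2 first.
  - move=> r; apply/measurable_EFinP; apply: measurable_funM => //.
    apply: measurable_funM => //.
    apply: (measurableT_comp _ mphi).
    by apply: measurable_indic; rewrite -[X in measurable X]setTI; exact: measurable_funP.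
  - move=> r w _; rewrite lee_fin mulrA mulr_ge0//.
    exact: nnfun_muleindic_ge0.
  apply: eq_fsbigr => r /[!inE] -[x _ <-].
  under eq_integral do rewrite EFinM.
  rewrite ge0_integralZl_EFin //.
  - by move=> w _; rewrite lee_fin mulr_ge0.
  - apply/measurable_EFinP.
    apply: measurable_funM => //.
    apply: (measurableT_comp _ mphi).
    by apply: measurable_indic; rewrite -[X in measurable X]setTI; exact: measurable_funP.
rewrite !expand //; apply: eq_fsbigr => r _; congr (_ * _); apply: h12.
by rewrite -[X in measurable X]setTI; exact: measurable_funP.
Qed.

End pullback.

(** * The past of a word and one step of the branching *)

Section words.
Variable m : nat -> nat.

Lemma words_rcons u k : words m 0 u -> (k < m (size u))%N ->
  words m 0 (rcons u k.+1).
Proof.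
move=> wu km i; rewrite size_rcons ltnS leq_eqVlt => /orP[/eqP->|iu].
  by rewrite nth_rcons ltnn eqxx add0n.
by rewrite nth_rcons iu; exact: wu.
Qed.

Lemma words_rcons_inv u a : words m 0 (rcons u a) ->
  words m 0 u /\ exists2 k, (k < m (size u))%N & a = k.+1.
Proof.
move=> wu; split.
  move=> i iu; have := wu i; rewrite size_rcons nth_rcons iu; apply.
  by rewrite ltnW.
have := wu (size u); rewrite size_rcons nth_rcons ltnn eqxx ltnSn => /(_ isT).
by case: a {wu} => // k /andP[_ km]; exists k.
Qed.

Lemma words_cat_inv u v : words m 0 (u ++ v) -> words m 0 u /\ words m (size u) v.
Proof.
move=> wu; split=> i hi.
  by have := wu i; rewrite size_cat nth_cat hi; apply; rewrite ltn_addr.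
have := wu (size u + i)%N; rewrite size_cat nth_cat ltn_add2l hi.
by rewrite [(size u + i < _)%N]ltnNge leq_addr /= addKn add0n; apply.
Qed.

Lemma words_cat u v : words m 0 u -> words m (size u) v -> words m 0 (u ++ v).
Proof.
move=> wu wv i; rewrite size_cat nth_cat; case: (ltnP i (size u)) => [iu _|iu hi].
  exact: wu.
have := wv (i - size u)%N; rewrite ltn_subLR // subnKC // add0n; exact.
Qed.

(** The strict descendants of [v], as an order relation on words: the form in
    which all the inclusions between pasts are checked. *)
Lemma subtree_starP v x : words m 0 x ->
  subtree_star m v x <-> prefix v x /\ x <> v.
Proof.
move=> wx; split=> [[y [wy ny] <-]|[/prefixP[y xE] xv]].
  split; first exact: prefix_prefix.
  by move=> /(congr1 (drop (size v))); rewrite drop_size_cat // drop_size.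
exists y; last by [].
split; first by move: wx; rewrite xE => /words_cat_inv[].
by move=> y0; apply: xv; rewrite xE y0 cats0.
Qed.

End words.

Section tree_sigma.
Context {R : realType} {disp : measure_display} {T : measurableType disp}.
Variable P : probability T R.
Variable m : nat -> nat.
Variable mu : forall j, probability ((m j).-tuple R) R.
Variable nu : bool -> forall j, probability ((m j).-tuple bool) R.
Variable L : seq nat -> T -> R.
Variable X : seq nat -> T -> bool.
Hypothesis hLmeas : forall u, words_star m 0 u -> measurable_fun setT (L u).
Hypothesis hLlaw : forall u, words m 0 u ->
       has_law P (children m L u) (mu (size u)).
Hypothesis hLindep : mutually_independent P (words m 0) (fun u =>
       preimage_set_system setT (children m L u) measurable).
Hypothesis hXmeas : forall u, words m 0 u -> measurable_fun setT (X u).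
Hypothesis hXL : independent2 P (sigma_of (words m 0) X)
                          (sigma_of (words_star m 0) L).
Hypothesis hXmarkov : forall u (A : set ((m (size u)).-tuple bool)), words m 0 u ->
       is_cond_prob P (children m X u @^-1` A)
         (sigma_of (words m 0 `\` subtree_star m u) X)
         (fun w => nu (X u w) (size u) A).

(** What is known about a set [D] of words: their states and ratios. The root
    has a state but no ratio. *)
Definition gen (D : set (seq nat)) : set (set T) :=
  [set A | exists2 x, D x /\ words m 0 x &
    (exists B, A = X x @^-1` B) \/
    (x <> [::] /\ exists2 B, measurable B & A = L x @^-1` B)].

(** The words outside the strict descendants of [v]; [v] itself is among them.
    The past of [v] is the sigma-algebra generated by [gen (avoid v)]. *)
Definition avoid v := words m 0 `\` subtree_star m v.

Lemma words_star_rcons u k : words m 0 u -> (k < m (size u))%N ->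
  words_star m 0 (rcons u k.+1).
Proof.
move=> wu km; split; first exact: words_rcons.
by move=> /(congr1 size); rewrite size_rcons.
Qed.

Lemma words_starE x : words_star m 0 x ->
  exists y k, [/\ words m 0 y, (k < m (size y))%N & x = rcons y k.+1].
Proof.
case; case: (lastP x) => [_ []|y a] // /words_rcons_inv[wy [k km ->]] _.
by exists y, k.
Qed.

Lemma gen_measurable D : gen D `<=` measurable.
Proof.
move=> A [x [_ wx]] [[B ->]|[x0 [B mB ->]]].
  by rewrite -[X in measurable X]setTI; apply: hXmeas.
by rewrite -[X in measurable X]setTI; apply: hLmeas.
Qed.

Lemma measurable_to_gen D :
  @measurable_fun _ _ T (g_sigma_algebraType (gen D)) setT id.
Proof.
move=> _ A mA; rewrite setTI preimage_id.
by apply: (smallest_sub _ (@gen_measurable D)) mA; exact: sigma_algebra_measurable.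
Qed.

Lemma mgen_X D x : D x -> words m 0 x ->
  @measurable_fun _ _ (g_sigma_algebraType (gen D)) _ setT (X x).
Proof.
move=> Dx wx _ B _; rewrite setTI; apply: sub_sigma_algebra.
by exists x => //; left; exists B.
Qed.

Lemma mgen_L D x : D x -> words m 0 x -> x <> [::] ->
  @measurable_fun _ _ (g_sigma_algebraType (gen D)) _ setT (L x).
Proof.
move=> Dx wx x0 _ B mB; rewrite setTI; apply: sub_sigma_algebra.
by exists x => //; right; split => //; exists B.
Qed.

Lemma measurable_childrenX u : words m 0 u ->
  measurable_fun setT (children m X u).
Proof.
move=> wu; apply/measurable_fun_tnthP => k.
rewrite (_ : _ \o _ = X (rcons u k.+1)); last by apply/funext => w /=; rewrite tnth_mktuple.
exact/hXmeas/words_rcons.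
Qed.

Lemma measurable_childrenL u : words m 0 u ->
  measurable_fun setT (children m L u).
Proof.
move=> wu; apply/measurable_fun_tnthP => k.
rewrite (_ : _ \o _ = L (rcons u k.+1)); last by apply/funext => w /=; rewrite tnth_mktuple.
exact/hLmeas/words_star_rcons.
Qed.

Lemma sigma_childrenX u A : words m 0 u -> measurable A ->
  sigma_of (words m 0) X (children m X u @^-1` A).
Proof.
move=> wu mA.
suff: @measurable_fun _ _ (g_sigma_algebraType
  (\bigcup_(i in words m 0) preimage_set_system setT (X i) measurable)) _ setT
  (children m X u) by move=> /(_ measurableT _ mA); rewrite setTI.
apply/measurable_fun_tnthP => k.
rewrite (_ : _ \o _ = X (rcons u k.+1)); last by apply/funext => w /=; rewrite tnth_mktuple.
move=> _ B mB; apply: sub_sigma_algebra; exists (rcons u k.+1) => //.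
  exact: words_rcons.
by exists B.
Qed.

Lemma sigma_childrenL u A : words m 0 u -> measurable A ->
  sigma_of (words_star m 0) L (children m L u @^-1` A).
Proof.
move=> wu mA.
suff: @measurable_fun _ _ (g_sigma_algebraType
  (\bigcup_(i in words_star m 0) preimage_set_system setT (L i) measurable)) _ setT
  (children m L u) by move=> /(_ measurableT _ mA); rewrite setTI.
apply/measurable_fun_tnthP => k.
rewrite (_ : _ \o _ = L (rcons u k.+1)); last by apply/funext => w /=; rewrite tnth_mktuple.
move=> _ B mB; apply: sub_sigma_algebra; exists (rcons u k.+1) => //.
  exact: words_star_rcons.
by exists B.
Qed.

(** A pi-system of ratio events that do not concern the children of [v]. Its
    members are intersections over finitely many distinct words, since this is
    the form in which mutual independence is available. *)
Definition cylL v : set (set T) := [set F | exists s (A : seq nat -> set T),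
  [/\ uniq s,
      (forall i, i \in s -> [/\ words m 0 i, i <> v &
         preimage_set_system setT (children m L i) measurable (A i)]) &
      F = \bigcap_(i in [set` s]) A i]].

Lemma cylL_setI v : setI_closed (cylL v).
Proof.
move=> _ _ [s [A [us hA ->]]] [t [B [ut hB ->]]].
pose ext (r : seq nat -> bool) (C : seq nat -> set T) i := if r i then C i else setT.
exists (undup (s ++ t)), (fun i => ext (mem s) A i `&` ext (mem t) B i); split.
- exact: undup_uniq.
- move=> i; rewrite mem_undup mem_cat => /orP ist.
  have [wi iv] : words m 0 i /\ i <> v by case: ist => [/hA[]|/hB[]].
  split => //.
  have : preimage_set_system setT (children m L i) measurable (ext (mem s) A i).
    rewrite /ext; case: ifPn => [/hA[]//|_].
    by exists setT => //; rewrite setTI.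
  move=> [A' mA' <-].
  have : preimage_set_system setT (children m L i) measurable (ext (mem t) B i).
    rewrite /ext; case: ifPn => [/hB[]//|_].
    by exists setT => //; rewrite setTI.
  move=> [B' mB' <-]; exists (A' `&` B'); first exact: measurableI.
  by rewrite !setTI.
- apply/seteqP; split => w.
    move=> [hs ht] i /= _; split; rewrite /ext; case: ifPn => // ii.
      exact: hs. exact: ht.
  move=> h; split=> i /= ii; have := h i; rewrite /= mem_undup mem_cat ii ?orbT => /(_ isT)[];
    rewrite /ext /= ii //.
Qed.

Lemma cylL_sigma v F : cylL v F -> sigma_of (words_star m 0) L F.
Proof.
move=> [s [A [us hA ->]]].
rewrite bigcap_seq.
have GTI := @bigsetI_measurable _ (g_sigma_algebraType
  (\bigcup_(i in words_star m 0) preimage_set_system setT (L i) measurable)).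
rewrite big_seq; apply: GTI => i /hA[wi _ [B mB <-]].
by rewrite setTI; exact: sigma_childrenL.
Qed.

Lemma cylL_indep v F B : words m 0 v -> cylL v F -> measurable B ->
  P (F `&` children m L v @^-1` B) = (P F * mu (size v) B)%E.
Proof.
move=> wv [s [A [us hA ->]]] mB.
have vs : v \notin s by apply/negP => /hA[].
pose A' i := if i == v then children m L v @^-1` B else A i.
have hs : forall i, i \in s -> A' i = A i.
  by move=> i is_; rewrite /A'; case: eqP => // iv; rewrite -iv is_ in vs.
rewrite (@hLindep s A us); last by move=> i /hA[].
have := @hLindep (v :: s) A'; rewrite /= vs us => /(_ isT) H.
transitivity (P (\bigcap_(i in [set` v :: s]) A' i)).
  congr (P _); apply/seteqP; split => w.
    move=> [h1 h2] i /=; rewrite inE => /orP[/eqP->|ii].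
      by rewrite /A' eqxx.
    by rewrite hs //; exact: h1.
  move=> h; split.
    by move=> i /= ii; rewrite -hs //; apply: h; rewrite /= inE ii orbT.
  by have := h v; rewrite /= inE eqxx /A' eqxx; apply.
rewrite H; last first.
  move=> i; rewrite inE => /orP[/eqP->|ii].
    by split=> //; rewrite /A' eqxx; exists B => //; rewrite setTI.
  by rewrite hs //; case: (hA i ii).
rewrite big_cons muleC; congr (_ * _)%E; last by rewrite /A' eqxx; exact: hLlaw.
by rewrite !big_seq; apply: eq_bigr => i ii; rewrite hs.
Qed.

Definition Xset v : set T := X v @^-1` [set true].

Lemma measurable_Xset v : words m 0 v -> measurable (Xset v).
Proof. by move=> wv; rewrite -[X in measurable X]setTI; exact: hXmeas. Qed.

Lemma sigma_avoid_words v :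
  sigma_of (avoid v) X `<=` sigma_of (words m 0) X.
Proof.
apply: sub_sigma_algebra2 => A [i [wi _] h].
by exists i.
Qed.

Lemma avoid_self v : words m 0 v -> avoid v v.
Proof. by move=> wv; split=> // /(@subtree_starP m v v wv)[]. Qed.

(** The conditional law of the children depends on the state of [v] alone, so
    it is constant on the event that this state is 1. *)
Lemma markov_event v F1 A : words m 0 v -> sigma_of (avoid v) X F1 ->
  P (F1 `&` Xset v `&` children m X v @^-1` A) =
  (nu true (size v) A * P (F1 `&` Xset v))%E.
Proof.
move=> wv hF.
have [_ /(_ (F1 `&` Xset v)) H] := @hXmarkov v A wv.
have hFX : sigma_of (avoid v) X (F1 `&` Xset v).
  apply: (@measurableI _ (g_sigma_algebraType
    (\bigcup_(i in avoid v) preimage_set_system setT (X i) measurable))) => //.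
  apply: sub_sigma_algebra; exists v; first exact: avoid_self.
  by exists [set true] => //; rewrite setTI.
have mFX : measurable (F1 `&` Xset v).
  apply: smallest_sub hFX; first exact: sigma_algebra_measurable.
  by move=> B [i [wi _] [C mC <-]]; exact: hXmeas.
rewrite setIC -(H hFX).
rewrite (@eq_integral _ _ _ P (F1 `&` Xset v) (cst (nu true (size v) A))).
  by rewrite integral_cst.
by move=> w /[!inE] -[_ /= ->].
Qed.

Definition cyl v : set (set T) := [set F1 `&` F2 | F1 in sigma_of (avoid v) X & F2 in cylL v].

Lemma cylL_setT v : cylL v setT.
Proof.
exists [::], (fun=> setT); split => //.
by apply/seteqP; split.
Qed.

(** As functions of [F], both sides are finite measures. They agree on the
    intersections of a state event with a ratio cylinder, where the independence
    of states and ratios separates the factors and the Markov property and the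
    independence of the ratio vectors deal with one factor each; these
    intersections form a pi-system that generates the past of [v]. *)
Lemma step_event v F A B : words m 0 v -> <<s gen (avoid v) >> F ->
  measurable A -> measurable B ->
  P (F `&` (Xset v `&` children m X v @^-1` A `&` children m L v @^-1` B)) =
  (nu true (size v) A * mu (size v) B * P (F `&` Xset v))%E.
Proof.
move=> wv hF mA mB.
set E1 := (_ `&` _ `&` _ in LHS).
have mE1 : measurable E1.
  apply: measurableI; last first.
    by rewrite -[X in measurable X]setTI; exact: measurable_childrenL.
  apply: measurableI; first exact: measurable_Xset.
  by rewrite -[X in measurable X]setTI; exact: measurable_childrenX.
have mE0 := @measurable_Xset v wv.
have fnu : nu true (size v) A \is a fin_num by exact: fin_num_measure.
have fmu : mu (size v) B \is a fin_num by exact: fin_num_measure.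
pose a : {nonneg R} := NngNum (mulr_ge0 (fine_ge0 (measure_ge0 (nu true (size v)) A))
                               (fine_ge0 (measure_ge0 (mu (size v)) B))).
have aE : (nu true (size v) A * mu (size v) B)%E = a%:num%:E.
  by rewrite /= EFinM !fineK.
rewrite aE.
pose m1 : {measure set T -> \bar R} := mrestr P mE1.
pose m2 : {measure set T -> \bar R} := mscale a (mrestr P mE0).
suff : m1 F = m2 F by [].
have hsub : sigma_of (avoid v) X `<=` measurable.
  apply: smallest_sub; first exact: sigma_algebra_measurable.
  by move=> C [i [wi _] [D mD <-]]; exact: hXmeas.
have hsubL : cylL v `<=` measurable.
  move=> F2 /cylL_sigma; apply: smallest_sub; first exact: sigma_algebra_measurable.
  by move=> C [i wi [D mD <-]]; exact: hLmeas.
have sXT : sigma_of (avoid v) X setT.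
  exact: (@measurableT _ (g_sigma_algebraType
    (\bigcup_(i in avoid v) preimage_set_system setT (X i) measurable))).
apply: (@g_sigma_algebra_measure_unique _ _ _ (cyl v) _ (fun=> setT)).
- by move=> _ [F1 /hsub mF1 [F2 /hsubL mF2 <-]]; exact: measurableI.
- by move=> _; exists setT => //; exists setT; [exact: cylL_setT|rewrite setTI].
- by rewrite bigcup_const//; exists 0%N.
- move=> _ _ [F1 h1 [F2 h2 <-]] [G1 h3 [G2 h4 <-]].
  exists (F1 `&` G1).
    apply: (@measurableI _ (g_sigma_algebraType
    (\bigcup_(i in avoid v) preimage_set_system setT (X i) measurable))) => //.
  exists (F2 `&` G2); first exact: cylL_setI.
  by rewrite setIACA.
- move=> _ [F1 h1 [F2 h2 <-]].
  rewrite /m1 /m2 /= /mscale /= /mrestr /= -[X in (X * _)%E]aE.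
  have sX1 : sigma_of (words m 0) X (F1 `&` Xset v).
    apply: sigma_avoid_words; apply: (@measurableI _ (g_sigma_algebraType
      (\bigcup_(i in avoid v) preimage_set_system setT (X i) measurable))) => //.
    apply: sub_sigma_algebra; exists v; first exact: avoid_self.
    by exists [set true] => //; rewrite setTI.
  have -> : F1 `&` F2 `&` E1 = (F1 `&` Xset v `&` children m X v @^-1` A) `&`
      (F2 `&` children m L v @^-1` B).
    rewrite /E1; apply/seteqP; split => w; rewrite /setI/=; tauto.
  rewrite hXL; last 2 first.
  + apply: (@measurableI _ (g_sigma_algebraType
      (\bigcup_(i in words m 0) preimage_set_system setT (X i) measurable))) => //.
    exact: sigma_childrenX.
  + apply: (@measurableI _ (g_sigma_algebraType
      (\bigcup_(i in words_star m 0) preimage_set_system setT (L i) measurable))).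
      exact: cylL_sigma h2.
    exact: sigma_childrenL.
  rewrite markov_event // cylL_indep //.
  rewrite (setIAC F1 F2) (@hXL (F1 `&` Xset v) F2 sX1 (@cylL_sigma v F2 h2)).
  by rewrite [(P F2 * _)%E]muleC muleACA.
- by move=> k; rewrite /m1 /= /mrestr setTI; exact: le_lt_trans (probability_le1 P mE1) (ltry _).
- apply: (smallest_sub _ _ hF); first exact: smallest_sigma_algebra.
  move=> C [x [[wx nx] _] [[D ->]|[x0 [D mD ->]]]]; apply: sub_sigma_algebra.
    exists (X x @^-1` D); last by exists setT; [exact: cylL_setT|rewrite setIT].
    apply: sub_sigma_algebra; exists x; first by [].
    by exists D => //; rewrite setTI.
  have [y [k [wy km xE]]] := @words_starE x (conj wx x0).
  exists setT => //; exists (L x @^-1` D); last by rewrite setTI.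
  exists [:: y], (fun=> L x @^-1` D); split => //.
    move=> i; rewrite inE => /eqP->; split => //.
      move=> yv; apply: nx; apply/(@subtree_starP m v x wx); rewrite xE -yv.
      by rewrite prefix_rcons; split => // /(congr1 size)/eqP; rewrite size_rcons eqn_leq ltnn.
    exists ((fun l => tnth l (Ordinal km)) @^-1` D).
      by rewrite -[X in measurable X]setTI; exact: measurable_tnth.
    by rewrite setTI xE; apply/seteqP; split => w /=; rewrite tnth_mktuple.
  by apply/seteqP; split => w /=; [move=> h _ _|apply; rewrite /= inE].
Qed.

Lemma nth_children (V : Type) (Y : seq nat -> T -> V) v w k y0 :
  (k < m (size v))%N -> nth y0 (children m Y v w) k = Y (rcons v k.+1) w.
Proof.
by move=> km; rewrite -[k in LHS]/(nat_of_ord (Ordinal km)) -tnth_nth tnth_mktuple.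
Qed.

Lemma indic_preimage (U V : Type) (h : U -> V) (F : set V) w :
  \1_F (h w) = \1_(h @^-1` F) w :> R.
Proof. by rewrite !indicE. Qed.

Lemma measurable_state v : words m 0 v ->
  measurable_fun setT (fun w => (X v w)%:R : R).
Proof.
move=> wv.
rewrite (_ : (fun w => _) = \1_(Xset v)); first exact/measurable_indic/measurable_Xset.
apply/funext => w; rewrite indicE /Xset; congr (_%:R).
by case: (boolP (X v w)) => h; [rewrite mem_set|rewrite memNset//=; exact/negP].
Qed.

(** The branching property: given the past of [v] and that [v] has state 1, the
    state and the ratio of a child are drawn independently of each other. The
    formula for events is extended to functions first in the ratio of the child,
    then in the factor [g] known from the past. *)
Lemma one_step v k (f : R -> R) (g : T -> R) : words m 0 v -> (k < m (size v))%N ->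
  measurable_fun setT f -> (forall r, 0 <= f r) ->
  (forall w, f (L (rcons v k.+1) w) <= 1) ->
  @measurable_fun _ _ (g_sigma_algebraType (gen (avoid v))) _ setT g ->
  (forall w, 0 <= g w) ->
  (\int[P]_w (g w * ((X v w)%:R * (X (rcons v k.+1) w)%:R * f (L (rcons v k.+1) w)))%:E =
   nu true (size v) [set x | nth false x k] * \int[P]_w (f (L (rcons v k.+1) w))%:E
    * \int[P]_w (g w * (X v w)%:R)%:E)%E.
Proof.
move=> wv km mf f0 f1 mg g0.
set vk := rcons v k.+1.
have wvk : words m 0 vk by exact: words_rcons.
have mXv := @measurable_state v wv; have mXk := @measurable_state vk wvk.
have mL : measurable_fun setT (L vk) by apply/hLmeas/words_star_rcons.
have mfL : measurable_fun setT (f \o L vk) by exact: measurableT_comp.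
set A := [set x : (m (size v)).-tuple bool | nth false x k].
have mA : measurable A.
  rewrite (_ : A = (fun x => tnth x (Ordinal km)) @^-1` [set true]).
    by rewrite -[X in measurable X]setTI; apply: measurable_tnth => //; exact: measurable_set1.
  by apply/seteqP; split => x /=; rewrite (tnth_nth false).
set nuA := nu true (size v) A.
have fnu : nuA \is a fin_num by exact: fin_num_measure.
have nu0 : 0 <= fine nuA by exact/fine_ge0/measure_ge0.
have H1 (F : set T) : <<s gen (avoid v) >> F ->
    (\int[P]_w (\1_F w * ((X v w)%:R * (X vk w)%:R * f (L vk w)))%:E =
     nuA * \int[P]_w (f (L vk w))%:E * P (F `&` Xset v))%E.
  move=> mF.
  have mFT : measurable (F : set T).
    by rewrite -[X in measurable X]setTI; exact: (@measurable_to_gen (avoid v) measurableT F).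
  have fF : P (F `&` Xset v) \is a fin_num.
    by apply: fin_num_measure; apply: measurableI => //; exact: measurable_Xset.
  pose c := fine nuA * fine (P (F `&` Xset v)).
  have c0 : 0 <= c by rewrite mulr_ge0// fine_ge0.
  have := @integral_pullback_ext _ _ _ T _ P (L vk)
    (fun w => \1_F w * ((X v w)%:R * (X vk w)%:R)) (fun=> c) mL _ _ _ _ _ f mf f0.
  rewrite (eq_integral (fun w => (\1_F w * ((X v w)%:R * (X vk w)%:R * f (L vk w)))%:E)); last first.
    by move=> w _; congr (_%:E); rewrite mulrC -!mulrA; do 2 congr (_ * _); rewrite mulrC.
  move=> ->.
  - under eq_integral do rewrite mulrC EFinM.
    rewrite ge0_integralZl_EFin //; last 2 first.
      by move=> w _; rewrite lee_fin.
      exact/measurable_EFinP.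
    by rewrite /c EFinM !fineK // muleAC.
  - by apply: measurable_funM; [exact: measurable_indic|exact: measurable_funM].
  - exact: measurable_cst.
  - by move=> w; rewrite !mulr_ge0.
  - by [].
  - move=> B mB; pose Bk : set ((m (size v)).-tuple R) := [set l | B (nth 0 l k)].
    rewrite (_ : (fun w => _) = (fun w => (\1_(F `&` (Xset v `&` children m X v @^-1` A `&`
      children m L v @^-1` Bk)) w)%:E)); last first.
      apply/funext => w; congr (_%:E).
      rewrite !indicI /= !indicE.
      rewrite (_ : (w \in Xset v) = X v w); last first.
        by apply/idP/idP; [rewrite inE|move=> h; rewrite inE /Xset/=].
      rewrite (_ : (w \in children m X v @^-1` A) = X vk w); last first.
        have e : (children m X v @^-1` A) w = X vk w.
          by rewrite /preimage /A /mkset nth_children.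
        by apply/idP/idP; [rewrite inE e|move=> h; rewrite inE e].
      rewrite (_ : (w \in children m L v @^-1` _) = (L vk w \in B)); last first.
        have e : (children m L v @^-1` Bk) w = B (L vk w).
          by rewrite /preimage /Bk /mkset nth_children.
        by apply/idP/idP; [rewrite !inE e|rewrite !inE => h; rewrite e].
      by rewrite mulrC -!mulrA.
    have mB' : measurable Bk.
      rewrite (_ : Bk = (fun x => tnth x (Ordinal km)) @^-1` B).
        by rewrite -[X in measurable X]setTI; exact: measurable_tnth.
      by apply/seteqP; split => x /=; rewrite (tnth_nth 0).
    rewrite integral_indic ?setIT //; last first.
      apply: measurableI => //; apply: measurableI; last first.
        by rewrite -[X in measurable X]setTI; exact: measurable_childrenL.
      apply: measurableI; first exact: measurable_Xset.
      by rewrite -[X in measurable X]setTI; exact: measurable_childrenX.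
    rewrite [LHS](_ : _ = nuA * mu (size v) Bk * P (F `&` Xset v))%E; last exact: (@step_event v F A _ wv mF mA mB').
    under eq_integral do rewrite mulrC EFinM.
    rewrite ge0_integralZl_EFin //; last first.
      by apply/measurable_EFinP; apply: (measurableT_comp _ mL).
    rewrite (_ : (fun w => _) = (fun w => (\1_(L vk @^-1` B) w)%:E)); last first.
      by apply/funext => w; rewrite indic_preimage.
    rewrite integral_indic ?setIT //; last by rewrite -[X in measurable X]setTI; exact: mL.
    rewrite /c EFinM !fineK // muleAC -hLlaw //; congr (_ * P _)%E.
    by rewrite /preimage /Bk /mkset; under eq_fun do rewrite nth_children //.
set EL := (\int[P]_w (f (L vk w))%:E)%E in H1 *.
have fEL : EL \is a fin_num.
  rewrite ge0_fin_numE; last by apply: integral_ge0 => w _; rewrite lee_fin.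
  apply: (@le_lt_trans _ _ (\int[P]_w cst 1 w)%E); last first.
    by rewrite integral_cst// mul1e (le_lt_trans (probability_le1 _ _))// ltry.
  apply: ge0_le_integral => //; first by move=> w _; rewrite lee_fin.
  - exact/measurable_EFinP.
  - by move=> w _; rewrite lee_fin; exact: f1.
pose c := fine nuA * fine EL.
have EL0 : (0 <= EL)%E by apply: integral_ge0 => w _; rewrite lee_fin.
have c0 : 0 <= c by rewrite mulr_ge0// fine_ge0.
have := @integral_pullback_ext _ _ _ T (g_sigma_algebraType (gen (avoid v))) P id
    (fun w => (X v w)%:R * (X vk w)%:R * f (L vk w)) (fun w => c * (X v w)%:R)
    (@measurable_to_gen _) _ _ _ _ _ g mg g0.
move=> ->.
- have mgT : measurable_fun setT g by exact: (measurableT_comp mg (@measurable_to_gen (avoid v))).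
  under eq_integral do rewrite mulrCA EFinM.
  rewrite ge0_integralZl_EFin //; last 2 first.
    by move=> w _; rewrite lee_fin mulr_ge0.
    by apply/measurable_EFinP; exact: measurable_funM.
  by rewrite /c EFinM !fineK.
- by apply: measurable_funM => //; exact: measurable_funM.
- by apply: measurable_funM; [exact: measurable_cst|].
- by move=> w; rewrite !mulr_ge0.
- by move=> w; rewrite mulr_ge0.
- move=> F mF; rewrite H1 //.
  have mFT : measurable (F : set T).
    by rewrite -[X in measurable X]setTI; exact: (@measurable_to_gen (avoid v) measurableT F).
  under eq_integral do rewrite mulrCA EFinM.
  rewrite ge0_integralZl_EFin //; last first.
    apply/measurable_EFinP; apply: measurable_funM => //.
  rewrite (_ : (fun w => _) = (fun w => (\1_(F `&` Xset v) w)%:E)); last first.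
    apply/funext => w; congr (_%:E); rewrite indicI /= !indicE.
    rewrite (_ : (w \in Xset v) = X v w) //.
    by apply/idP/idP; [rewrite inE|move=> h; rewrite inE /Xset/=].
  rewrite integral_indic ?setIT //; last by apply: measurableI => //; exact: measurable_Xset.
  by rewrite /c EFinM !fineK.
Qed.
End tree_sigma.

(** * Expectations of nonnegative functions *)

Section expectation.
Context {R : realType} {disp : measure_display} {T : measurableType disp}.
Variable P : {measure set T -> \bar R}.
Implicit Types f g : T -> R.

Definition expect f : \bar R := (\int[P]_w (f w)%:E)%E.

Lemma expect_ge0 f : (forall w, 0 <= f w) -> (0 <= expect f)%E.
Proof. by move=> f0; apply: integral_ge0 => w _; rewrite lee_fin. Qed.

Lemma expect_le f g : measurable_fun setT f -> measurable_fun setT g ->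
  (forall w, 0 <= f w <= g w) -> (expect f <= expect g)%E.
Proof.
move=> mf mg fg; apply: ge0_le_integral => //.
- by move=> w _; rewrite lee_fin; case/andP: (fg w).
- exact/measurable_EFinP.
- exact/measurable_EFinP.
- by move=> w _; rewrite lee_fin; case/andP: (fg w).
Qed.

Lemma expect_Zl k f : measurable_fun setT f -> (forall w, 0 <= f w) -> 0 <= k ->
  expect (fun w => k * f w)%R = (k%:E * expect f)%E.
Proof.
move=> mf f0 k0; rewrite /expect; under eq_integral do rewrite EFinM.
by rewrite ge0_integralZl_EFin //; [move=> w _; rewrite lee_fin|exact/measurable_EFinP].
Qed.

Lemma expect_D f g : measurable_fun setT f -> measurable_fun setT g ->
  (forall w, 0 <= f w) -> (forall w, 0 <= g w) ->
  expect (fun w => f w + g w) = (expect f + expect g)%E.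
Proof.
move=> mf mg f0 g0; rewrite /expect; under eq_integral do rewrite EFinD.
rewrite ge0_integralD //.
- by move=> w _; rewrite lee_fin.
- exact/measurable_EFinP.
- by move=> w _; rewrite lee_fin.
- exact/measurable_EFinP.
Qed.

Lemma expect_sum n (f : 'I_n -> T -> R) : (forall k, measurable_fun setT (f k)) ->
  (forall k w, 0 <= f k w) ->
  expect (fun w => \sum_(k < n) f k w) = (\sum_(k < n) expect (f k))%E.
Proof.
move=> mf f0; rewrite /expect; under eq_integral do rewrite -sumEFin.
rewrite ge0_integral_sum //.
- by move=> k; exact/measurable_EFinP.
- by move=> k w _; rewrite lee_fin.
Qed.

Lemma eq_expect f g : f =1 g -> expect f = expect g.
Proof. by move=> fg; apply: eq_integral => w _; rewrite fg. Qed.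

End expectation.

Lemma exists_natSinv_le (R : realType) (c : R) : 0 < c -> exists j : nat, j.+1%:R^-1 <= c.
Proof.
move=> c0; exists (Num.truncn c^-1).
rewrite -[leRHS]invrK lef_pV2 ?posrE ?invr_gt0 ?ltr0Sn //.
by rewrite ltW // real_truncnS_gt // num_real.
Qed.

(** * Pasts of neighbouring words *)

Section words_order.
Variable m : nat -> nat.

Lemma prefix_rcons_inv (v x : seq nat) a : prefix (rcons v a) x -> prefix v x /\ x <> v.
Proof.
move=> /prefixP[y ->]; rewrite cat_rcons prefix_prefix; split => //.
by move=> /(congr1 size)/eqP; rewrite size_cat -[X in _ == X]addn0 eqn_add2l.
Qed.

Lemma prefix_rcons_inj (v x : seq nat) a b :
  prefix (rcons v a) x -> prefix (rcons v b) x -> a = b.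
Proof.
move=> /prefixP[y ->] /prefixP[z]; rewrite !cat_rcons => /eqP.
by rewrite eqseq_cat // eqxx /= eqseq_cons => /andP[/eqP].
Qed.

Lemma avoidP v x : words m 0 x -> avoid m v x <-> ~ (prefix v x /\ x <> v).
Proof.
move=> wx; split; first by move=> [_ h] h'; apply: h; apply/(@subtree_starP m v x wx).
by move=> h; split => // /(@subtree_starP m v x wx).
Qed.

Lemma avoid_parent v a : avoid m v `<=` avoid m (rcons v a).
Proof.
move=> x vx; have wx : words m 0 x by case: vx.
apply/(@avoidP _ x wx) => -[/prefix_rcons_inv h _].
by move/(@avoidP _ x wx) : vx; apply.
Qed.

Lemma avoid_sibling v a b : words m 0 (rcons v b) -> avoid m (rcons v a) (rcons v b).
Proof.
move=> wb; apply/(@avoidP _ _ wb) => -[/prefixP[y yE]].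
have y0 : y = [::].
  apply/nilP; rewrite /nilp; move/(congr1 size): yE.
  by rewrite size_cat !size_rcons => /eqP; rewrite -[X in X == _]addn0 eqn_add2l eq_sym.
by rewrite yE y0 cats0.
Qed.

Lemma avoid_child v a : words m 0 v -> avoid m (rcons v a) v.
Proof.
by move=> wv; apply/(@avoidP _ _ wv) => -[/prefix_rcons_inv[_]].
Qed.

(** The subtree of one child belongs to the past of any other child; in second
    moments this allows the masses of two siblings to be averaged one after the
    other. *)
Lemma avoid_subtree_sibling v a b : a <> b ->
  words m 0 `&` subtree_star m (rcons v b) `<=` avoid m (rcons v a).
Proof.
move=> ab x [wx /(@subtree_starP m _ x wx)[bx _]].
apply/(@avoidP _ x wx) => -[ax _]; apply: ab; exact: prefix_rcons_inj ax bx.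
Qed.

Lemma subtree_star_rcons v a x : words m 0 x ->
  subtree_star m (rcons v a) x -> subtree_star m v x.
Proof.
move=> wx /(@subtree_starP m _ x wx)[/prefix_rcons_inv h _].
exact/(@subtree_starP m _ x wx).
Qed.

Lemma subtree_star_child v a : words m 0 (rcons v a) -> subtree_star m v (rcons v a).
Proof.
move=> wx; apply/(@subtree_starP m _ _ wx); split; first by rewrite prefix_rcons.
by move=> /(congr1 size)/eqP; rewrite size_rcons eqn_leq ltnn.
Qed.

End words_order.

(** * Mass, energy and content of the tree *)

Section recursion.
Context {R : realType} {disp : measure_display} {T : measurableType disp}.
Variable P : probability T R.
Variable m : nat -> nat.
Variable L : seq nat -> T -> R.
Variable X : seq nat -> T -> bool.
Hypothesis hLmeas : forall u, words_star m 0 u -> measurable_fun setT (L u).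
Hypothesis hXmeas : forall u, words m 0 u -> measurable_fun setT (X u).
Hypothesis hL01 : forall u w, words_star m 0 u -> 0 < L u w <= 1.
Variables (s : R) (al a : nat -> R).
Hypothesis s0 : 0 <= s.
Hypothesis al0 : forall j, 0 <= al j.
Hypothesis a0 : forall j, 0 <= a j.

Definition adapted D (f : T -> R) :=
  @measurable_fun _ _ (g_sigma_algebraType (gen m L X D)) _ setT f.

Local Notation ch v k := (rcons v k.+1).

Definition weight v k w : R := (X (ch v k) w)%:R * L (ch v k) w `^ s.

(** All that is used of the randomness in this part: [kap v k] is the mean of
    the weight of a child given the past of [v], and these means add up to [al]
    at the level of [v]. *)
Variable kap : seq nat -> nat -> R.
Hypothesis kap0 : forall v k, 0 <= kap v k.
Hypothesis kap_sum : forall v, words m 0 v ->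
  \sum_(k < m (size v)) kap v k = al (size v).
Hypothesis step : forall v k g, words m 0 v -> (k < m (size v))%N ->
  adapted (avoid m v) g -> (forall w, 0 <= g w) ->
  expect P (fun w => g w * ((X v w)%:R * weight v k w)) =
  ((kap v k)%:E * expect P (fun w => g w * (X v w)%:R)%R)%E.

(** With [a = 1] this is the sum of the products of weights along the surviving
    paths of length [N]; with [a j] inverse to the mean weight at level [j] it is
    the normalized mass, whose mean given that [v] has state 1 is constant. *)
Fixpoint mass N v w : R := if N is N'.+1 then
  a (size v) * \sum_(k < m (size v)) weight v k w * mass N' (ch v k) w else 1.

(** Let a path carry the flow given by [mass], and let the capacity of a
    descendant be the product of the weights down to it. Unfolding the recursion
    gives the sum, over all descendants up to depth [N], of the squared flow
    divided by the capacity. *)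
Fixpoint energy N v w : R := if N is N'.+1 then
  mass N v w ^+ 2 + a (size v) ^+ 2 * \sum_(k < m (size v)) weight v k w * energy N' (ch v k) w
  else 1.

(** The least total capacity of a cut of the tree truncated at depth [N]: either
    cut at [v], at price 1, or cut below each child. Up to the factor given by
    the diameter of [v], it is a Hausdorff content of dimension [s]. *)
Fixpoint content N v w : R := if N is N'.+1 then
  Num.min 1 (\sum_(k < m (size v)) weight v k w * content N' (ch v k) w)
  else 1.

Lemma weight_ge0 v k w : 0 <= weight v k w.
Proof. by rewrite /weight mulr_ge0 ?powR_ge0. Qed.

Lemma mass_ge0 N v w : 0 <= mass N v w.
Proof.
elim: N v => [//|N IH] v /=; rewrite mulr_ge0 // sumr_ge0 // => k _.
by rewrite mulr_ge0 ?weight_ge0.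
Qed.

Lemma energy_ge0 N v w : 0 <= energy N v w.
Proof.
elim: N v => [//|N IH] v /=; rewrite addr_ge0 ?sqr_ge0 // mulr_ge0 ?sqr_ge0 //.
by rewrite sumr_ge0 // => k _; rewrite mulr_ge0 ?weight_ge0.
Qed.

Lemma content_ge0 N v w : 0 <= content N v w.
Proof.
elim: N v => [//|N IH] v /=; rewrite le_min ler01 sumr_ge0 // => k _.
by rewrite mulr_ge0 ?weight_ge0.
Qed.

Lemma content_le1 N v w : content N v w <= 1.
Proof. by case: N => [|N] /=; rewrite ?lexx // ge_min lexx. Qed.

Lemma content_decr N v w : content N.+1 v w <= content N v w.
Proof.
elim: N v => [|N IH] v; first exact: content_le1.
rewrite [leLHS]/= [leRHS]/= le_min ge_min lexx /= ge_min; apply/orP; right.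
by apply: ler_sum => k _; rewrite ler_wpM2l ?weight_ge0 //; exact: IH.
Qed.

(** A cut has capacity at least the square of the flow divided by its energy.
    The form with a free [lam] is linear in the three quantities, hence goes
    through expectations, and it is stable under the recursion: at the children
    it is used with [lam * a (size v)]. *)
Lemma content_ge_mass_energy N v w lam : 0 <= lam ->
  2 * lam * mass N v w <= content N v w + lam ^+ 2 * energy N v w.
Proof.
elim: N v lam => [|N IH] v lam lam0.
  have := sqr_ge0 (1 - lam); rewrite /=; lra.
rewrite [content _ _ _]/=; rewrite minElt; case: ifP => _.
  rewrite (@le_trans _ _ (1 + lam ^+ 2 * mass N.+1 v w ^+ 2)) //.
    by have := sqr_ge0 (1 - lam * mass N.+1 v w); lra.
  rewrite lerD2l ler_wpM2l ?sqr_ge0 //= lerDl mulr_ge0 ?sqr_ge0 //.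
  by rewrite sumr_ge0 // => k _; rewrite mulr_ge0 ?weight_ge0 ?energy_ge0.
rewrite (@le_trans _ _ (\sum_(k < m (size v)) weight v k w * content N (ch v k) w +
   lam ^+ 2 * (a (size v) ^+ 2 * \sum_(k < m (size v)) weight v k w * energy N (ch v k) w))) //.
  rewrite [mass _ _ _]/= !mulr_sumr -big_split /=; apply: ler_sum => k _.
  have := IH (ch v k) (lam * a (size v)) (mulr_ge0 lam0 (a0 _)).
  move=> /(ler_wpM2l (weight_ge0 v k w)); lra.
by rewrite lerD2l ler_wpM2l ?sqr_ge0 //= lerDr sqr_ge0.
Qed.

Lemma adapted_mono D D' f : (forall x, words m 0 x -> D x -> D' x) ->
  adapted D f -> adapted D' f.
Proof.
move=> DD' mf _ B mB; have := mf measurableT B mB.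
apply: sub_sigma_algebra2 => A [x [Dx wx] h].
by exists x => //; split => //; exact: DD'.
Qed.

Lemma adaptedT D f : adapted D f -> measurable_fun setT f.
Proof. by move=> mf; exact: (measurableT_comp mf (@measurable_to_gen _ _ T m L X hLmeas hXmeas D)). Qed.
Arguments adaptedT {D f}.

Lemma adapted_cst D c : adapted D (fun=> c).
Proof. exact: measurable_cst. Qed.

Lemma adaptedM D f g : adapted D f -> adapted D g -> adapted D (fun w => f w * g w).
Proof. exact: measurable_funM. Qed.

Lemma adaptedD D f g : adapted D f -> adapted D g -> adapted D (fun w => f w + g w).
Proof. exact: measurable_funD. Qed.

Lemma adapted_min D f g : adapted D f -> adapted D g -> adapted D (fun w => Num.min (f w) (g w)).
Proof. exact: measurable_minr. Qed.

Lemma adapted_sum D n (f : 'I_n -> T -> R) : (forall k, adapted D (f k)) ->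
  adapted D (fun w => \sum_(k < n) f k w).
Proof. by move=> mf; apply: measurable_sum. Qed.

Lemma adapted_X D x : D x -> words m 0 x -> adapted D (fun w => (X x w)%:R).
Proof.
move=> Dx wx; have mX := @mgen_X _ _ _ m L X D x Dx wx.
rewrite /adapted (_ : (fun w => _) = \1_(X x @^-1` [set true])).
  by apply: measurable_indic; rewrite -[X in measurable X]setTI; exact: mX.
apply/funext => w; rewrite indicE; congr (nat_of_bool _)%:R.
by apply/idP/idP; rewrite inE.
Qed.

Lemma adapted_L D x : D x -> words_star m 0 x -> adapted D (fun w => L x w `^ s).
Proof.
move=> Dx [wx x0].
rewrite /adapted; apply: (@measurableT_comp _ _ _ _ _ _ (fun r : R => r `^ s)); last exact: mgen_L.
exact: measurable_powR.
Qed.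

Lemma adapted_weight D v k : words m 0 v -> (k < m (size v))%N -> D (ch v k) ->
  adapted D (weight v k).
Proof.
move=> wv km Dvk; have [wvk nvk] := words_star_rcons wv km.
by apply: adaptedM; [exact: adapted_X|exact: adapted_L].
Qed.

Section rec_adapted.
Variables (D : set (seq nat)) (F : nat -> seq nat -> T -> R).

Let below v := forall x, words m 0 x -> subtree_star m v x -> D x.

Lemma below_child v k : words m 0 v -> (k < m (size v))%N -> below v ->
  D (ch v k) /\ below (ch v k).
Proof.
move=> wv km bv; have [wvk _] := words_star_rcons wv km; split.
  by apply: bv => //; exact: subtree_star_child.
by move=> x wx /subtree_star_rcons h; apply: bv => //; exact: h.
Qed.
Arguments below_child {v k}.

Lemma adapted_sum_children N v :
  (forall v, words m 0 v -> below v -> adapted D (F N v)) ->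
  words m 0 v -> below v ->
  adapted D (fun w => \sum_(k < m (size v)) weight v k w * F N (ch v k) w).
Proof.
move=> IH wv bv; apply: adapted_sum => k.
have [Dk bk] := below_child wv (ltn_ord k) bv.
apply: adaptedM; first exact: adapted_weight.
by apply: IH => //; apply: words_rcons.
Qed.
End rec_adapted.

Lemma adapted_mass D N v : words m 0 v ->
  (forall x, words m 0 x -> subtree_star m v x -> D x) -> adapted D (mass N v).
Proof.
elim: N v => [|N IH] v wv bv; first exact: adapted_cst.
by apply: adaptedM; [exact: adapted_cst|exact: adapted_sum_children].
Qed.

Lemma adapted_energy D N v : words m 0 v ->
  (forall x, words m 0 x -> subtree_star m v x -> D x) -> adapted D (energy N v).
Proof.
elim: N v => [|N IH] v wv bv; first exact: adapted_cst.
apply: adaptedD; last first.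
  by apply: adaptedM; [exact: adapted_cst|exact: adapted_sum_children].
by under eq_fun do rewrite expr2; apply: adaptedM; exact: adapted_mass.
Qed.

Lemma adapted_content D N v : words m 0 v ->
  (forall x, words m 0 x -> subtree_star m v x -> D x) -> adapted D (content N v).
Proof.
elim: N v => [|N IH] v wv bv; first exact: adapted_cst.
by apply: adapted_min; [exact: adapted_cst|exact: adapted_sum_children].
Qed.

Lemma measurable_weight v k : words m 0 v -> (k < m (size v))%N ->
  measurable_fun setT (weight v k).
Proof. by move=> wv km; apply: (@adaptedT setT); exact: adapted_weight. Qed.

Lemma measurable_mass N v : words m 0 v -> measurable_fun setT (mass N v).
Proof. by move=> wv; apply: (@adaptedT setT); exact: adapted_mass. Qed.

Lemma measurable_energy N v : words m 0 v -> measurable_fun setT (energy N v).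
Proof. by move=> wv; apply: (@adaptedT setT); exact: adapted_energy. Qed.

Lemma measurable_content N v : words m 0 v -> measurable_fun setT (content N v).
Proof. by move=> wv; apply: (@adaptedT setT); exact: adapted_content. Qed.

Lemma measurable_Xr v : words m 0 v -> measurable_fun setT (fun w => (X v w)%:R : R).
Proof. by move=> wv; apply: (@adaptedT setT); exact: adapted_X. Qed.
Arguments measurable_Xr {v}.

Local Notation EX := (expect P).

Lemma weightE v k w : weight v k w = L (ch v k) w `^ s * (X (ch v k) w)%:R.
Proof. by rewrite mulrC. Qed.

(** What is known before the strict descendants of a child are revealed. It
    serves as the new test function when an expectation is computed by induction
    on the depth. *)
Lemma adapted_at_child v k g : words m 0 v -> (k < m (size v))%N ->
  adapted (avoid m v) g ->
  adapted (avoid m (ch v k)) (fun w => g w * (X v w)%:R * L (ch v k) w `^ s).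
Proof.
move=> wv km ag; have wvk := words_star_rcons wv km.
apply: adaptedM; last first.
  by apply: adapted_L => //; apply: avoid_sibling; case: wvk.
apply: adaptedM; first by apply: adapted_mono ag => x _; exact: avoid_parent.
by apply: adapted_X => //; exact: avoid_child.
Qed.
Arguments adapted_at_child {v k g}.

(** Each level [j] contributes the factor [a j * al j]: by induction the masses
    of the children are averaged first, then their weights by [step]. *)
Lemma expect_mass N v g : words m 0 v -> adapted (avoid m v) g -> (forall w, 0 <= g w) ->
  EX (fun w => g w * (X v w)%:R * mass N v w) =
  ((\prod_(size v <= j < size v + N) (a j * al j))%:E *
    EX (fun w => g w * (X v w)%:R)%R)%E.
Proof.
elim: N v g => [|N IH] v g wv ag g0.
  by rewrite addn0 big_geq // mul1e; apply: eq_expect => w; rewrite mulr1.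
have mg := adaptedT ag; have mX := measurable_Xr wv.
rewrite (@eq_expect _ _ _ _ _ (fun w => \sum_(k < m (size v)) a (size v) *
  (g w * (X v w)%:R * L (ch v k) w `^ s * (X (ch v k) w)%:R * mass N (ch v k) w))); last first.
  move=> w; rewrite /= mulrCA !mulr_sumr; apply: eq_bigr => k _.
  by rewrite weightE !mulrA.
have ms (k : 'I_(m (size v))) : measurable_fun setT (fun w =>
   (g w * (X v w)%:R * L (ch v k) w `^ s * (X (ch v k) w)%:R * mass N (ch v k) w)).
  have [wvk nvk] := words_star_rcons wv (ltn_ord k).
  apply: measurable_funM; last exact: measurable_mass.
  apply: measurable_funM; last exact: measurable_Xr.
  exact: (adaptedT (adapted_at_child wv (ltn_ord k) ag)).
have s0' (k : 'I_(m (size v))) w : 0 <=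
   (g w * (X v w)%:R * L (ch v k) w `^ s * (X (ch v k) w)%:R * mass N (ch v k) w).
  by rewrite !mulr_ge0 ?powR_ge0 ?mass_ge0.
rewrite expect_sum; last 2 first.
  - by move=> k; apply: measurable_funM => //; exact: measurable_cst.
  - by move=> k w; rewrite mulr_ge0.
transitivity (\sum_(k < m (size v)) (a (size v) *
  \prod_((size v).+1 <= j < (size v).+1 + N) (a j * al j))%:E *
   ((kap v k)%:E * EX (fun w => g w * (X v w)%:R)%R))%E.
  apply: eq_bigr => k _; rewrite (@expect_Zl _ _ _ P) // IH; first last.
  - by move=> w; rewrite !mulr_ge0 ?powR_ge0.
  - exact: adapted_at_child.
  - exact: words_rcons.
  rewrite size_rcons (@eq_expect _ _ _ _ _ (fun w => g w * ((X v w)%:R * weight v k w))); last first.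
    by move=> w; rewrite weightE !mulrA.
  by rewrite step // EFinM -!muleA.
rewrite -ge0_sume_distrr; last by move=> k _; rewrite mule_ge0 ?lee_fin ?expect_ge0// => w; rewrite mulr_ge0.
rewrite -ge0_sume_distrl; last by move=> k _; rewrite lee_fin.
rewrite sumEFin kap_sum // muleA -EFinM; congr (_%:E * _)%E.
rewrite [in RHS]big_ltn ?ltnS ?addnS ?leq_addr //; ring.
Qed.

Lemma sum_step v g : words m 0 v -> adapted (avoid m v) g -> (forall w, 0 <= g w) ->
  (\sum_(k < m (size v)) EX (fun w => g w * (X v w)%:R * weight v k w)%R =
  (al (size v))%:E * EX (fun w => g w * (X v w)%:R)%R)%E.
Proof.
move=> wv ag g0.
rewrite -(@kap_sum v wv) -sumEFin ge0_sume_distrl; last by move=> k _; rewrite lee_fin.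
apply: eq_bigr => k _; rewrite -step //.
by apply: eq_expect => w; rewrite mulrA.
Qed.

Lemma weight_le1 v k w : words m 0 v -> (k < m (size v))%N -> weight v k w <= 1.
Proof.
move=> wv km; rewrite /weight; case: (X _ w); rewrite ?mul0r ?mul1r //.
have /andP[L0 L1] := @hL01 _ w (words_star_rcons wv km).
by rewrite -[leRHS](powRr0 (L (ch v k) w)) ger_powR // L0.
Qed.

Lemma L_powR_le1 v k w : words m 0 v -> (k < m (size v))%N -> L (ch v k) w `^ s <= 1.
Proof.
move=> wv km; have /andP[L0 L1] := @hL01 _ w (words_star_rcons wv km).
by rewrite -[leRHS](powRr0 (L (ch v k) w)) ger_powR // L0.
Qed.

(** * Second moments from a level with uniform growth *)

Section moments.
Variables (n0 M : nat).
Hypothesis aal : forall j, (n0 <= j)%N -> a j * al j = 1.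
Hypothesis mM : forall j, (m j <= M)%N.

Lemma expect_mass1 N v g : (n0 <= size v)%N -> words m 0 v -> adapted (avoid m v) g ->
  (forall w, 0 <= g w) ->
  EX (fun w => g w * (X v w)%:R * mass N v w) = EX (fun w => g w * (X v w)%:R).
Proof.
move=> nv wv ag g0; rewrite expect_mass // big_nat_cond big1 ?mul1e //.
by move=> j /andP[/andP[vj _] _]; apply: aal; exact: leq_trans vj.
Qed.

Fixpoint square_bound N n : R := if N is N'.+1 then a n * (square_bound N' n.+1 + M%:R) else 1.

Fixpoint energy_bound N n : R := if N is N'.+1 then square_bound N n + a n * energy_bound N' n.+1 else 1.

Lemma square_bound_ge0 N n : 0 <= square_bound N n.
Proof. by elim: N n => //= N IH n; rewrite mulr_ge0 // addr_ge0. Qed.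

Lemma energy_bound_ge0 N n : 0 <= energy_bound N n.
Proof.
by elim: N n => //= N IH n; rewrite addr_ge0 // mulr_ge0 // addr_ge0 // square_bound_ge0.
Qed.

(** The square of a sum over the children is a double sum. A diagonal term is
    bounded by the induction hypothesis, as weights are at most 1. In an
    off-diagonal term the subtrees of the two siblings lie in the past of each
    other, so both masses are replaced by their mean 1; there are at most [M] such
    terms for each child. *)
Lemma expect_mass_sq N v g : (n0 <= size v)%N -> words m 0 v -> adapted (avoid m v) g ->
  (forall w, 0 <= g w) ->
  (EX (fun w => g w * (X v w)%:R * mass N v w ^+ 2)%R <=
   (square_bound N (size v))%:E * EX (fun w => g w * (X v w)%:R)%R)%E.
Proof.
elim: N v g => [|N IH] v g nv wv ag g0.
  by rewrite mul1e /= (@eq_expect _ _ _ _ _ (fun w => g w * (X v w)%:R)) // => w; rewrite expr1n mulr1.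
have mg := adaptedT ag; have mX := measurable_Xr wv.
pose h w := g w * (X v w)%:R.
have h0 w : 0 <= h w by rewrite mulr_ge0.
have mh : measurable_fun setT h by exact: measurable_funM.
pose G (k l : 'I_(m (size v))) w := h w * (weight v k w * mass N (ch v k) w) * (weight v l w * mass N (ch v l) w).
have mwW (k : 'I_(m (size v))) : measurable_fun setT (fun w => weight v k w * mass N (ch v k) w).
  by apply: measurable_funM; [exact: measurable_weight|apply/measurable_mass/words_rcons].
have mG k l : measurable_fun setT (G k l) by do 2 (apply: measurable_funM => //).
have wW0 k w : 0 <= weight v k w * mass N (ch v k) w by rewrite mulr_ge0 ?weight_ge0 ?mass_ge0.
have G0 k l w : 0 <= G k l w by rewrite /G mulr_ge0 // mulr_ge0.
rewrite (@eq_expect _ _ _ _ _ (fun w => a (size v) ^+ 2 *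
   \sum_(k < m (size v)) \sum_(l < m (size v)) G k l w)); last first.
  move=> w; rewrite /= exprMn mulrCA; congr (_ * _).
  rewrite expr2 mulr_suml mulr_sumr; apply: eq_bigr => k _.
  by rewrite !mulr_sumr; apply: eq_bigr => l _; rewrite /G /h !mulrA.
rewrite expect_Zl; first last.
- exact: sqr_ge0.
- by move=> w; rewrite sumr_ge0 // => k _; rewrite sumr_ge0.
- by apply: measurable_sum => k; apply: measurable_sum.
rewrite expect_sum; first last.
- by move=> k w; rewrite sumr_ge0.
- by move=> k; apply: measurable_sum.
pose e (k : 'I_(m (size v))) := EX (fun w => h w * weight v k w).
have e0 k : (0 <= e k)%E by apply: expect_ge0 => w; rewrite mulr_ge0 ?weight_ge0.
have GE (k l : 'I_(m (size v))) : (EX (G k l) <= ((l == k)%:R * square_bound N (size v).+1 + 1)%:E * e k)%E.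
  have wk := words_star_rcons wv (ltn_ord k); have wl := words_star_rcons wv (ltn_ord l).
  have akl := adapted_at_child wv (ltn_ord k) ag.
  have al_ := adapted_at_child wv (ltn_ord l) ag.
  have eE : e k = EX (fun w => g w * (X v w)%:R * L (ch v k) w `^ s * (X (ch v k) w)%:R).
    by apply: eq_expect => w; rewrite weightE /h !mulrA.
  case: (eqVneq l k) => [->|lk].
    apply: (@le_trans _ _ (EX (fun w => g w * (X v w)%:R * L (ch v k) w `^ s * (X (ch v k) w)%:R
      * mass N (ch v k) w ^+ 2))).
      apply: expect_le.
      - exact: mG.
      - apply: measurable_funM; last first.
          by apply: measurable_funX; apply/measurable_mass/words_rcons.
        apply: measurable_funM; last by apply/measurable_Xr/words_rcons.
        exact: adaptedT akl.
      - move=> w; rewrite G0 /=.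
        rewrite (_ : G k k w = h w * mass N (ch v k) w ^+ 2 * weight v k w * weight v k w); last first.
          by rewrite /G; ring.
        rewrite [leRHS](_ : _ = h w * mass N (ch v k) w ^+ 2 * weight v k w); last first.
          by rewrite /h weightE; ring.
        by rewrite ler_piMr ?weight_le1 // mulr_ge0 ?weight_ge0 // mulr_ge0 ?sqr_ge0.
    apply: (le_trans (IH (ch v k) _ _ _ akl _)).
    - by rewrite size_rcons ltnW // ltnS.
    - by case: wk.
    - by move=> w; rewrite !mulr_ge0 ?powR_ge0.
    by rewrite size_rcons mul1r -eE; apply: lee_wpmul2r => //; rewrite lee_fin lerDl.
  rewrite mul0r add0r mul1e.
  rewrite (@eq_expect _ _ _ _ _ (fun w => (g w * (X v w)%:R * L (ch v k) w `^ s *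
     (weight v l w * mass N (ch v l) w)) * (X (ch v k) w)%:R * mass N (ch v k) w)); last first.
    by move=> w; rewrite /G /h (weightE v k); ring.
  have ab : avoid m (ch v k) (ch v l) by apply: avoid_sibling; case: wl.
  have nkl : k.+1 <> l.+1 by move=> [/ord_inj kl]; rewrite kl eqxx in lk.
  rewrite expect_mass1; first last.
  - by move=> w; rewrite mulr_ge0 // !mulr_ge0 ?powR_ge0.
  - apply: adaptedM => //; apply: adaptedM; first exact: adapted_weight.
    apply: adapted_mass; first by case: wl.
    move=> x wx sx; apply: (@avoid_subtree_sibling m v k.+1 l.+1) => //.
  - by case: wk.
  - by rewrite size_rcons ltnW // ltnS.
  rewrite (@eq_expect _ _ _ _ _ (fun w => (g w * (X v w)%:R * L (ch v l) w `^ s * weight v k w)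
     * (X (ch v l) w)%:R * mass N (ch v l) w)); last first.
    by move=> w; rewrite (weightE v k) (weightE v l); ring.
  have ab' : avoid m (ch v l) (ch v k) by apply: avoid_sibling; case: wk.
  have al' : adapted (avoid m (ch v l)) (fun w => g w * (X v w)%:R * L (ch v l) w `^ s * weight v k w).
    by apply: adaptedM => //; exact: adapted_weight.
  rewrite expect_mass1; first last.
  - by move=> w; rewrite !mulr_ge0 ?powR_ge0.
  - exact: al'.
  - by case: wl.
  - by rewrite size_rcons ltnW // ltnS.
  apply: expect_le.
  - apply: measurable_funM; last by apply/measurable_Xr/words_rcons.
    exact: adaptedT al'.
  - by apply: measurable_funM => //; exact: measurable_weight.
  - move=> w; rewrite !mulr_ge0 ?powR_ge0 ?weight_ge0 //=.
    rewrite [leLHS](_ : _ = h w * weight v k w * weight v l w); last by rewrite /h (weightE v l); ring.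
    by rewrite ler_piMr ?weight_le1 // mulr_ge0 ?weight_ge0.
apply: (@le_trans _ _ ((a (size v) ^+ 2)%:E * \sum_(k < m (size v)) ((square_bound N (size v).+1 + M%:R)%:E * e k))%E).
  apply: lee_wpmul2l; first by rewrite lee_fin sqr_ge0.
  apply: lee_sum => k _; rewrite expect_sum //.
  apply: (le_trans (lee_sum _ (fun l _ => GE k l))).
  rewrite -ge0_sume_distrl; last by move=> l _; rewrite lee_fin addr_ge0 // mulr_ge0 // square_bound_ge0.
  rewrite sumEFin; apply: lee_wpmul2r => //.
  rewrite lee_fin big_split /= sumr_const card_ord lerD ?ler_nat //.
  by rewrite (bigD1 k) //= eqxx mul1r big1 ?addr0 // => l /negbTE ->; rewrite mul0r.
rewrite -ge0_sume_distrr; last by move=> k _; exact: e0.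
rewrite sum_step // !muleA -!EFinM.
rewrite (_ : _ * _ * _ = (a (size v) * al (size v)) * (a (size v) * (square_bound N (size v).+1 + M%:R))); last by ring.
by rewrite aal // mul1r.
Qed.

Lemma expect_energy N v g : (n0 <= size v)%N -> words m 0 v -> adapted (avoid m v) g ->
  (forall w, 0 <= g w) ->
  (EX (fun w => g w * (X v w)%:R * energy N v w)%R <=
   (energy_bound N (size v))%:E * EX (fun w => g w * (X v w)%:R)%R)%E.
Proof.
elim: N v g => [|N IH] v g nv wv ag g0.
  by rewrite mul1e /= (@eq_expect _ _ _ _ _ (fun w => g w * (X v w)%:R)) // => w; rewrite mulr1.
have mg := adaptedT ag; have mX := measurable_Xr wv.
pose h w := g w * (X v w)%:R.
have h0 w : 0 <= h w by rewrite mulr_ge0.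
have mh : measurable_fun setT h by exact: measurable_funM.
pose G (k : 'I_(m (size v))) w := h w * L (ch v k) w `^ s * (X (ch v k) w)%:R * energy N (ch v k) w.
have mhL (k : 'I_(m (size v))) : measurable_fun setT (fun w => h w * L (ch v k) w `^ s).
  exact: adaptedT (adapted_at_child wv (ltn_ord k) ag).
have mG k : measurable_fun setT (G k).
  apply: measurable_funM; last by apply/measurable_energy/words_rcons.
  by apply: measurable_funM => //; apply/measurable_Xr/words_rcons.
have G0 k w : 0 <= G k w by rewrite mulr_ge0 ?energy_ge0 // mulr_ge0 // mulr_ge0 ?powR_ge0.
rewrite (@eq_expect _ _ _ _ _ (fun w => h w * mass N.+1 v w ^+ 2 +
   a (size v) ^+ 2 * \sum_(k < m (size v)) G k w)); last first.
  move=> w; rewrite [energy _ _ _]/= mulrDr; congr (_ + _); rewrite mulrCA; congr (_ * _).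
  by rewrite !mulr_sumr; apply: eq_bigr => k _; rewrite /G weightE /h; ring.
rewrite expect_D; first last.
- by move=> w; rewrite mulr_ge0 ?sqr_ge0 // sumr_ge0.
- by move=> w; rewrite mulr_ge0 ?sqr_ge0.
- apply: measurable_funM; [exact: measurable_cst|exact: measurable_sum].
- by apply: measurable_funM => //; apply: measurable_funX; exact: measurable_mass.
rewrite [energy_bound _ _]/= EFinD ge0_muleDl; last 2 first.
- by rewrite lee_fin (square_bound_ge0 N.+1).
- by rewrite lee_fin mulr_ge0 ?energy_bound_ge0.
apply: leeD; first exact: expect_mass_sq.
rewrite expect_Zl; first last.
- exact: sqr_ge0.
- by move=> w; rewrite sumr_ge0.
- exact: measurable_sum.
rewrite expect_sum //.
pose e (k : 'I_(m (size v))) := EX (fun w => h w * weight v k w).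
have e0 k : (0 <= e k)%E by apply: expect_ge0 => w; rewrite mulr_ge0 ?weight_ge0.
apply: (@le_trans _ _ ((a (size v) ^+ 2)%:E * \sum_(k < m (size v)) ((energy_bound N (size v).+1)%:E * e k))%E).
  apply: lee_wpmul2l; first by rewrite lee_fin sqr_ge0.
  apply: lee_sum => k _.
  apply: (le_trans (IH (ch v k) _ _ _ (adapted_at_child wv (ltn_ord k) ag) _)).
  - by rewrite size_rcons ltnW // ltnS.
  - exact: words_rcons.
  - by move=> w; rewrite !mulr_ge0 ?powR_ge0.
  rewrite size_rcons (_ : EX _ = e k) //.
  by apply: eq_expect => w; rewrite weightE /h !mulrA.
rewrite -ge0_sume_distrr; last by move=> k _; exact: e0.
rewrite sum_step // !muleA -!EFinM.
rewrite (_ : _ * _ * _ = (a (size v) * al (size v)) * (a (size v) * energy_bound N (size v).+1)); last by ring.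
by rewrite aal // mul1r.
Qed.

Section good_level.
Variables (q : R) (PP : nat -> R).
Hypothesis q01 : 0 < q < 1.
Hypothesis PPn : PP n0 = 1.
Hypothesis PPS : forall k, (n0 <= k)%N -> PP k.+1 = PP k * al k.
Hypothesis PPq : forall k, (n0 <= k)%N -> 1 <= PP k * q ^+ (k - n0).

Let D := 1 + M%:R / (1 - q).
Definition uniform_bound := D / (1 - q).

Let q1 : 0 < 1 - q. Proof. by rewrite subr_gt0; case/andP: q01. Qed.
Let qp : 0 < q. Proof. by case/andP: q01. Qed.
Let D1 : 1 <= D. Proof. by rewrite lerDl divr_ge0 // ltW. Qed.

Lemma uniform_bound_ge1 : 1 <= uniform_bound.
Proof.
rewrite /uniform_bound ler_pdivlMr // mul1r (le_trans _ D1) // lerBlDl lerDr ltW //.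
Qed.

(** The products of mean weights from [n0] on dominate the powers of [1 / q], so
    the backward recursion of [square_bound] is controlled by a multiple of
    [PP k * q ^+ (k - n0)]. This factor equals 1 at [k = n0], where the bound
    becomes uniform in [N]. *)
Lemma square_bound_good N k : (n0 <= k)%N -> square_bound N k <= PP k * q ^+ (k - n0) * D.
Proof.
elim: N k => [|N IH] k nk /=; first by rewrite mulr_ege1 // PPq.
have akk : a k * al k = 1 by exact: aal.
have := IH k.+1 (leqW nk); rewrite PPS // subSn // exprS => h.
have := @PPq k.+1 (leqW nk); rewrite PPS // subSn // exprS => h2.
set Z := PP k * q ^+ (k - n0) in h h2 *.
have hD : q * D + q * M%:R <= D.
  rewrite /D; have : 0 <= M%:R :> R by []. 
  move: q1 qp; move: (M%:R) => x y z x0.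
  rewrite -subr_ge0 (_ : _ - _ = (1 - q) + x * (1 - q)); last by field; rewrite gt_eqF.
  by rewrite addr_ge0 // ?mulr_ge0 // ltW.
have Z0 : 0 <= Z by rewrite (le_trans ler01) // PPq.
apply: (@le_trans _ _ (a k * (PP k * al k * (q * q ^+ (k - n0)) * (D + M%:R)))).
  rewrite ler_wpM2l // (mulrDr _ D) lerD //.
  by rewrite ler_peMl.
rewrite (_ : a k * _ = (a k * al k) * (Z * (q * D + q * M%:R))); last by rewrite /Z; ring.
by rewrite akk mul1r ler_wpM2l.
Qed.

Lemma energy_bound_good N k : (n0 <= k)%N -> energy_bound N k <= PP k * q ^+ (k - n0) * uniform_bound.
Proof.
elim: N k => [|N IH] k nk /=; first by rewrite mulr_ege1 ?uniform_bound_ge1 // PPq.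
have akk : a k * al k = 1 by exact: aal.
have := IH k.+1 (leqW nk); rewrite PPS // subSn // exprS => h.
have hA := @square_bound_good N.+1 k nk; rewrite [square_bound _ _]/= in hA.
set Z := PP k * q ^+ (k - n0) in h hA *.
have hD : D + q * uniform_bound = uniform_bound by rewrite /uniform_bound; field; rewrite gt_eqF.
rewrite -hD (mulrDr Z) lerD //.
apply: (@le_trans _ _ (a k * (PP k * al k * (q * q ^+ (k - n0)) * uniform_bound))).
  by rewrite ler_wpM2l.
rewrite (_ : a k * _ = (a k * al k) * (Z * (q * uniform_bound))); last by rewrite /Z; ring.
by rewrite akk mul1r.
Qed.

(** The inequality between mass, content and energy is integrated, with the value
    of [lam] that makes the energy term half as large as the mass term. *)
Lemma expect_content_ge N v g : size v = n0 -> words m 0 v -> adapted (avoid m v) g ->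
  (forall w, 0 <= g w <= 1) ->
  (uniform_bound^-1%:E * EX (fun w => g w * (X v w)%:R)%R <=
   EX (fun w => g w * (X v w)%:R * content N v w)%R)%E.
Proof.
move=> nv wv ag g01.
have g0 w : 0 <= g w by case/andP: (g01 w).
have mg := adaptedT ag; have mX := measurable_Xr wv.
pose h w := g w * (X v w)%:R.
have h0 w : 0 <= h w by rewrite mulr_ge0.
have mh : measurable_fun setT h by exact: measurable_funM.
have Dp : 0 < uniform_bound := lt_le_trans ltr01 uniform_bound_ge1.
pose l := uniform_bound^-1.
have l0 : 0 <= l by rewrite invr_ge0 ltW.
rewrite -/h.
have mW := @measurable_mass N v wv; have mE := @measurable_energy N v wv; have mC := @measurable_content N v wv.
have : (EX (fun w => 2 * l * (h w * mass N v w))%R <=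
   EX (fun w => h w * content N v w + l ^+ 2 * (h w * energy N v w))%R)%E.
  apply: expect_le.
  - by apply: measurable_funM; [exact: measurable_cst|exact: measurable_funM].
  - apply: measurable_funD; first exact: measurable_funM.
    by apply: measurable_funM; [exact: measurable_cst|exact: measurable_funM].
  - move=> w; rewrite !mulr_ge0 ?mass_ge0 //=.
    have := ler_wpM2l (h0 w) (@content_ge_mass_energy N v w l l0); lra.
rewrite expect_Zl ?mulr_ge0 //; last 2 first.
- exact: measurable_funM.
- by move=> w; rewrite mulr_ge0 ?mass_ge0.
rewrite expect_D; first last.
- by move=> w; rewrite mulr_ge0 ?sqr_ge0 // mulr_ge0 ?energy_ge0.
- by move=> w; rewrite mulr_ge0 ?content_ge0.
- by apply: measurable_funM; [exact: measurable_cst|exact: measurable_funM].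
- exact: measurable_funM.
rewrite expect_Zl ?sqr_ge0 //; last 2 first.
- exact: measurable_funM.
- by move=> w; rewrite mulr_ge0 ?energy_ge0.
rewrite expect_mass1 ?nv //.
have hE : (EX (fun w => h w * energy N v w)%R <= uniform_bound%:E * EX h)%E.
  apply: (le_trans (@expect_energy N v g _ wv ag g0)); first by rewrite nv.
  apply: lee_wpmul2r; first exact: expect_ge0.
  rewrite lee_fin nv (le_trans (@energy_bound_good N n0 (leqnn _))) //.
  by rewrite PPn subnn expr0 !mul1r.
have hfin : EX h \is a fin_num.
  rewrite ge0_fin_numE; last exact: expect_ge0.
  apply: (@le_lt_trans _ _ (EX (fun=> 1))).
    apply: expect_le => //.
    move=> w; rewrite h0 /h /=; case/andP: (g01 w) => _ g1.
    by case: (X v w); rewrite ?mulr1 ?mulr0.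
  rewrite /expect integral_cst // mul1e.
  exact: le_lt_trans (probability_le1 P measurableT) (ltry _).
move=> H.
have {}H : ((2 * l)%:E * EX h <= EX (fun w => (h w * content N v w)%R) + l%:E * EX h)%E.
  apply: (le_trans H); rewrite leeD2l //.
  apply: (@le_trans _ _ ((l ^+ 2)%:E * (uniform_bound%:E * EX h))%E).
    by apply: lee_wpmul2l; rewrite // lee_fin sqr_ge0.
  rewrite muleA -EFinM (_ : l ^+ 2 * uniform_bound = l) // expr2 -mulrA mulVf ?mulr1 //.
  by rewrite gt_eqF.
rewrite -(@leeD2rE _ (l%:E * EX h)); last by rewrite fin_numM.
apply: le_trans H; rewrite -ge0_muleDl ?lee_fin //.
by rewrite -EFinD -/l (_ : l + l = 2 * l) //; ring.
Qed.

End good_level.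
End moments.

(** * Survival forces positive content *)

Section zero_one.
Variable b : R.
Hypothesis b01 : 0 < b <= 1.

Definition good_level n := forall v N g, size v = n -> words m 0 v ->
  adapted (avoid m v) g -> (forall w, 0 <= g w <= 1) ->
  (b%:E * EX (fun w => g w * (X v w)%:R)%R <=
   EX (fun w => g w * (X v w)%:R * content N v w)%R)%E.

Definition level n : set (seq nat) := [set x | (size x <= n)%N].

Definition event D := <<s gen m L X D >>.

Fixpoint alive N v : set T := if N is N'.+1 then
  Xset X v `&` \big[setU/set0]_(k < m (size v)) alive N' (ch v k) else Xset X v.

(** The content decreases with the depth, so this says that its limit is
    positive; the bounds are taken of the form [i.+1%:R^-1] to make it a
    countable union. *)
Definition charged v : set T := [set w | exists i : nat, forall N, i.+1%:R^-1 <= content N v w].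

Lemma event_measurable D F : event D F -> measurable F.
Proof.
move=> eF; have := @measurable_to_gen _ _ T m L X hLmeas hXmeas D measurableT F eF.
by rewrite setTI.
Qed.

Lemma event_mono D D' F : (forall x, words m 0 x -> D x -> D' x) -> event D F -> event D' F.
Proof.
move=> DD'; apply: sub_sigma_algebra2 => A [x [Dx wx] h].
by exists x => //; split => //; exact: DD'.
Qed.

Lemma event_I D F G : event D F -> event D G -> event D (F `&` G).
Proof. exact: (@measurableI _ (g_sigma_algebraType (gen m L X D))). Qed.

Lemma event_D D F G : event D F -> event D G -> event D (F `\` G).
Proof. exact: (@measurableD _ (g_sigma_algebraType (gen m L X D))). Qed.

Lemma event_Xset D v : D v -> words m 0 v -> event D (Xset X v).
Proof.
by move=> Dv wv; apply: sub_sigma_algebra; exists v => //; left; exists [set true].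
Qed.

Lemma event_alive N v n : words m 0 v -> (size v + N <= n)%N -> event (level n) (alive N v).
Proof.
elim: N v => [|N IH] v wv vn /=.
  by apply: event_Xset => //; rewrite addn0 in vn.
apply: event_I; first by apply: event_Xset => //; apply: leq_trans vn; exact: leq_addr.
apply: (@bigsetU_measurable _ (g_sigma_algebraType (gen m L X (level n)))) => k _.
by apply: IH; [exact: words_rcons|rewrite size_rcons addSnnS].
Qed.

Lemma adapted_content_level N v n : words m 0 v -> (size v + N <= n)%N ->
  adapted (level n) (content N v).
Proof.
elim: N v => [|N IH] v wv vn; first exact: adapted_cst.
apply: adapted_min; first exact: adapted_cst.
apply: adapted_sum => k; have [wk _] := words_star_rcons wv (ltn_ord k).
have vn' : (size (ch v k) + N <= n)%N by rewrite size_rcons addSnnS.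
apply: adaptedM; last exact: IH.
by apply: adapted_weight => //; apply: leq_trans vn'; exact: leq_addr.
Qed.

Lemma measurable_charged v : words m 0 v -> measurable (charged v).
Proof.
move=> wv; rewrite (_ : charged v = \bigcup_i \bigcap_N [set w | i.+1%:R^-1 <= content N v w]).
  apply: bigcupT_measurable => i; apply: bigcapT_measurable => N.
  have := @measurable_content N v wv measurableT `[i.+1%:R^-1, +oo[%classic (measurable_itv _).
  by rewrite setTI set_itvcy.
apply/seteqP; split => w; first by move=> [i h]; exists i => // N _; exact: h.
by move=> [i _ h]; exists i => N; exact: h.
Qed.

(** Cutting below [v] requires cutting the surviving child, at a price multiplied
    by its positive weight. *)
Lemma charged_child v k w : words m 0 v -> (k < m (size v))%N ->
  Xset X (ch v k) w -> charged (ch v k) w -> charged v w.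
Proof.
move=> wv km; rewrite /Xset /= => Xk [i hi].
have /andP[L0 L1] := @hL01 _ w (words_star_rcons wv km).
pose c := L (ch v k) w `^ s * i.+1%:R^-1.
have c0 : 0 < c by rewrite mulr_gt0 ?powR_gt0 ?invr_gt0.
have c1 : c <= 1.
  by rewrite mulr_ile1 ?powR_ge0 ?invr_ge0 // ?L_powR_le1 // invf_le1 // ler1n.
have [j hj] : exists j : nat, j.+1%:R^-1 <= c.
  exact: exists_natSinv_le.
exists j => -[|N] /=; first by rewrite invf_le1 // ler1n.
apply: (le_trans hj); rewrite le_min c1 /= (bigD1 (Ordinal km)) //=.
rewrite -[leLHS]addr0; apply: lerD; last by rewrite sumr_ge0 // => l _; rewrite mulr_ge0 ?weight_ge0 ?content_ge0.
by rewrite weightE Xk mulr1 ler_wpM2l ?powR_ge0.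
Qed.

(** Since the content is at most 1, a mean at least [b] on [F] forces it to
    exceed [b / 2] on a proportion [b / 2] of [F]. The events so obtained decrease
    with the depth, which gives the limit. *)
Lemma charged_good n v F : good_level n -> size v = n -> words m 0 v ->
  event (avoid m v) F -> F `<=` Xset X v ->
  ((b / 2)%:E * P F <= P (F `&` charged v))%E.
Proof.
move=> gn vn wv eF FX; have mF := @event_measurable _ F eF.
have b0 : 0 < b by case/andP: b01.
pose C N := F `&` [set w | b / 2 <= content N v w].
have mC N : measurable (C N).
  apply: measurableI => //.
  have := @measurable_content N v wv measurableT `[b/2, +oo[%classic (measurable_itv _).
  by rewrite setTI set_itvcy.
have hC N : ((b / 2)%:E * P F <= P (C N))%E.
  have af : adapted (avoid m v) (\1_F : T -> R) by exact: measurable_indic.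
  have g01 w : 0 <= (\1_F w : R) <= 1 by rewrite indicE ler0n lern1 leq_b1.
  have := gn v N \1_F vn wv af g01.
  have FXE w : \1_F w * (X v w)%:R = \1_F w :> R.
    rewrite indicE; case: (boolP (w \in F)) => [|_]; last by rewrite mul0r.
    by rewrite inE => /FX; rewrite /Xset /= => ->; rewrite mulr1.
  rewrite (@eq_expect _ _ _ _ _ \1_F) // (_ : EX \1_F = P F); last first.
    by rewrite /expect integral_indic // setIT.
  have fF : P F \is a fin_num by exact: fin_num_measure.
  have : (EX (fun w => \1_F w * (X v w)%:R * content N v w)%R <=
    P (C N) + (b / 2)%:E * P F)%E.
    rewrite -(setIT (C N)) -(integral_indic P _ (mC N)) // -[X in (_ * P X)%E]setIT -(integral_indic P _ mF) //.
    rewrite -[X in (_ + _ * X)%E]/(EX \1_F) -[X in (X + _)%E]/(EX \1_(C N)).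
    rewrite -expect_Zl; [|exact: measurable_indic|by []|by rewrite divr_ge0 // ltW].
    rewrite -expect_D; [|exact: measurable_indic| |by []|by move=> w; rewrite mulr_ge0 // divr_ge0 // ltW]; last first.
      by apply: measurable_funM; [exact: measurable_cst|exact: measurable_indic].
    apply: expect_le.
    - apply: measurable_funM; last exact: measurable_content.
      by apply: measurable_funM; [exact: measurable_indic|exact: measurable_Xr].
    - apply: measurable_funD; first exact: measurable_indic.
      by apply: measurable_funM; [exact: measurable_cst|exact: measurable_indic].
    - move=> w; rewrite FXE mulr_ge0 ?content_ge0 //=.
      rewrite !indicE; case: (boolP (w \in F)) => wF; last by rewrite mul0r mulr0 addr0.
      rewrite mul1r mulr1 /C in_setI wF /=.
      case: (lerP (b/2) (content N v w)) => h.
        by rewrite mem_set // ler_wpDr ?divr_ge0 ?content_le1 // ltW.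
      rewrite memNset; first by rewrite add0r ltW.
        by move=> /= /(lt_le_trans h); rewrite ltxx.
  move=> h1 h2; rewrite -(@leeD2rE _ ((b/2)%:E * P F)); last by rewrite fin_numM.
  apply: le_trans (le_trans h2 h1).
  by rewrite -ge0_muleDl ?lee_fin ?divr_ge0 ?ler0n // ?(ltW b0) // -EFinD -splitr.
have ndC : nonincreasing_seq C.
  apply/nonincreasing_seqP => N; apply/subsetPset => w [Fw h]; split => //=.
  by apply: le_trans h _; exact: content_decr.
have mIC : measurable (\bigcap_N C N) by exact: bigcapT_measurable.
have : (P \o C) N @[N --> \oo] --> P (\bigcap_N C N).
  apply: nonincreasing_cvg_mu => //.
  by apply: le_lt_trans (probability_le1 P (mC 0%N)) (ltry _).
move=> cv; apply: (@le_trans _ _ (P (\bigcap_N C N))).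
  rewrite -(cvg_lim _ cv) //; apply: lime_ge; first by apply/cvg_ex; eexists; exact: cv.
  by apply: nearW => N; exact: hC.
apply: le_measure; rewrite ?inE //; first by apply: measurableI => //; exact: measurable_charged.
move=> w Cw; split; first by case: (Cw 0%N I).
have [j hj] : exists j : nat, j.+1%:R^-1 <= b / 2.
  by apply: exists_natSinv_le; rewrite divr_gt0.
by exists j => N; apply: (le_trans hj); case: (Cw N I).
Qed.

(** A lower bound for the proportion of [G], valid inside each member of a finite
    cover, is valid for the whole because [F] may be cut into disjoint pieces
    along the cover. *)
Lemma cover_bound (c : R) (Q : set (set T)) (G : set T) (I : Type) (r : seq I) (E : I -> set T) :
  (forall F, Q F -> measurable F) -> measurable G ->
  (forall F F', Q F -> Q F' -> Q (F `&` F')) -> (forall F F', Q F -> Q F' -> Q (F `\` F')) ->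
  (forall i, Q (E i)) ->
  (forall i F, Q F -> F `<=` E i -> (c%:E * P F <= P (F `&` G))%E) ->
  0 <= c ->
  forall F, Q F -> F `<=` \big[setU/set0]_(i <- r) E i ->
  (c%:E * P F <= P (F `&` G))%E.
Proof.
move=> Qm mG QI QD QE h c0; elim: r => [|i r IH] F QF FE.
  by move: FE; rewrite big_nil subset0 => ->; rewrite set0I measure0 mule0.
have [mF mE] := (Qm _ QF, Qm _ (QE i)).
have e (A : set T) : measurable A -> P ((F `&` E i `|` (F `\` E i)) `&` A) =
    (P (F `&` E i `&` A) + P ((F `\` E i) `&` A))%E.
  have mFE := measurableI _ _ mF mE; have mDE := measurableD mF mE.
  move=> mA; rewrite setIUl measureU //; [exact: measurableI|exact: measurableI|].
  by apply/seteqP; split => w // [[[_ ?] _] [[_ ?] _]].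
have := e setT measurableT; have := e G mG; rewrite !setIT setUIDK => -> ->.
rewrite ge0_muleDr; [|by rewrite measure_ge0..].
apply: leeD; first by apply: h; [exact: QI|exact: subIsetr].
apply: IH; first exact: QD.
by move=> w [Fw nE]; have := FE w Fw; rewrite big_cons => -[].
Qed.

(** On [F] some word of level [n] below [v] survives. Splitting [F] according to
    such a word, [charged_good] applies to each piece, and a charge is passed on
    to the ancestors. *)
Lemma alive_charged n N v F : good_level n -> (size v + N = n)%N -> words m 0 v ->
  event (level n) F -> F `<=` alive N v ->
  ((b / 2)%:E * P F <= P (F `&` charged v))%E.
Proof.
move=> gn; elim: N v F => [|N IH] v F vn wv eF FL.
  rewrite addn0 in vn; apply: (@charged_good n) => //.
  apply: event_mono eF => x wx; rewrite /level /= -vn => xv.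
  apply/(@avoidP m v x wx) => -[/prefixP[y xE] nx].
  apply: nx; rewrite xE; case: y xE => [|y0 y] xE; first by rewrite cats0.
  by move: xv; rewrite xE size_cat /= addnS ltnNge leq_addr.
have b0 : 0 <= b / 2 by case/andP: b01 => b0 _; rewrite divr_ge0 // ltW.
apply: (@cover_bound (b / 2) (event (level n)) (charged v) _ _
    (fun k : 'I_(m (size v)) => alive N (ch v k))).
- exact: event_measurable.
- exact: measurable_charged.
- exact: event_I.
- exact: event_D.
- by move=> k; apply: event_alive; [exact: words_rcons|rewrite size_rcons addSnnS vn].
- move=> k F' eF' F'L.
  have mF' := @event_measurable _ F' eF'.
  apply: (le_trans (IH (ch v k) F' _ _ eF' F'L)).
  + by rewrite size_rcons addSnnS.
  + exact: words_rcons.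
  + apply: le_measure; rewrite ?inE.
    * by apply: measurableI => //; apply: measurable_charged; exact: words_rcons.
    * by apply: measurableI => //; exact: measurable_charged.
    * move=> w [F'w cw]; split => //.
      apply: (@charged_child v k) => //.
      by have := F'L w F'w; case: (N) => [|N'] //= -[].
- exact: b0.
- exact: eF.
- by move=> w /FL [_ h]; exact: h.
Qed.

Hypothesis many_good : forall n0, exists2 n, (n0 <= n)%N & good_level n.

Lemma measurable_alive N v : words m 0 v -> measurable (alive N v).
Proof. by move=> wv; apply: (@event_measurable (level (size v + N))); exact: event_alive. Qed.

(** A zero-one law in the manner of Levy. Let [B] be the event that [v] survives
    without being charged. On [B] the content falls below any [i.+1%:R^-1], an
    event that is decided at a finite level together with survival up to that
    level; by [alive_charged] the charged outcomes make up a proportion at least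
    [b / 2] of it. But charged outcomes with content below [i.+1%:R^-1] become
    impossible as [i] grows, which leaves no room for [B]. *)
Lemma zero_one v : words m 0 v ->
  P ((\bigcap_N alive N v) `\` charged v) = 0%E.
Proof.
move=> wv; set S := \bigcap_N _; set G := charged v.
have b0 : 0 < b / 2 by case/andP: b01 => b0 _; rewrite divr_gt0.
have mG : measurable G by exact: measurable_charged.
have mS : measurable S by apply: bigcapT_measurable => N; exact: measurable_alive.
pose B := S `\` G.
have mB : measurable B by exact: measurableD.
pose E i N : set T := [set w | content N v w < i.+1%:R^-1].
have eE i N : event (level (size v + N)) (E i N).
  have := @adapted_content_level N v _ wv (leqnn _) measurableT `]-oo, i.+1%:R^-1[%classic (measurable_itv _).
  by rewrite setTI set_itvNyo.
have mE i N : measurable (E i N) by exact: event_measurable (eE i N).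
have ndE i : nondecreasing_seq (E i).
  apply/nondecreasing_seqP => N; apply/subsetPset => w; apply: le_lt_trans.
  exact: content_decr.
pose EE i := \bigcup_N E i N.
have mEE i : measurable (EE i) by exact: bigcupT_measurable.
have step1 i : ((b / 2)%:E * P B <= P (EE i `&` G))%E.
  have BE : B = \bigcup_N (B `&` E i N).
    apply/seteqP; split => [w Bw|w [N _ []]//].
    have [Sw nG] := Bw.
    have [N hN] : exists N, E i N w.
      apply: contrapT => /forallNP h; apply: nG; exists i => N.
      by have := h N; rewrite /E /= => /negP; rewrite -leNgt.
    by exists N.
  (* Any level [N0] is dominated by a good level [n], on which [B] is compared
     with an event of level [n]. *)
  have step0 N0 : ((b / 2)%:E * P (B `&` E i N0) <= P (EE i `&` G))%E.
    have [n hn gn] := many_good (size v + N0).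
    pose N := (n - size v)%N.
    have vN : (size v + N)%N = n by rewrite subnKC // (leq_trans (leq_addr _ _) hn).
    have N0N : (N0 <= N)%N by rewrite leq_subRL // (leq_trans (leq_addr _ _) hn).
    have eLE : event (level n) (alive N v `&` E i N).
      apply: event_I; last by rewrite -vN; exact: eE.
      by apply: event_alive => //; rewrite vN.
    have mLE := @event_measurable _ _ eLE.
    apply: (@le_trans _ _ ((b / 2)%:E * P (alive N v `&` E i N))%E).
      apply: lee_wpmul2l; first by rewrite lee_fin ltW.
      apply: le_measure; rewrite ?inE //; first exact: measurableI.
      move=> w [[Sw _] Ew]; split; first exact: Sw.
      by have /subsetPset := ndE i _ _ N0N; apply.
    apply: (le_trans (@alive_charged n N v _ gn vN wv eLE (@subIsetl _ _ _))).
    apply: le_measure; rewrite ?inE; [exact: measurableI|exact: measurableI|].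
    by move=> w [[_ Ew] Gw]; split => //; exists N.
  have cvgB : (P \o (fun N => B `&` E i N)) N @[N --> \oo] --> P B.
    rewrite [in X in _ --> X]BE; apply: nondecreasing_cvg_mu.
    - by move=> N; exact: measurableI.
    - by rewrite -BE.
    - by move=> N N' NN'; apply/subsetPset; apply: setIS; apply/subsetPset; exact: ndE.
  have cvgB2 : ((b / 2)%:E * (P \o (fun N => B `&` E i N)) N)%E @[N --> \oo] --> ((b / 2)%:E * P B)%E.
    by apply: cvgeZl.
  rewrite -(cvg_lim _ cvgB2) //; apply: lime_le; first by apply/cvg_ex; eexists; exact: cvgB2.
  by apply: nearW => N; exact: step0.
have mEG i : measurable (EE i `&` G) by exact: measurableI.
have cvgG : (P \o (fun i => EE i `&` G)) i @[i --> \oo] --> P (\bigcap_i (EE i `&` G)).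
  apply: nonincreasing_cvg_mu => //.
  - by apply: le_lt_trans (probability_le1 P (mEG 0%N)) (ltry _).
  - exact: bigcapT_measurable.
  - apply/nonincreasing_seqP => i; apply/subsetPset => w [[N _ EN] Gw]; split => //.
    exists N => //; apply: lt_le_trans EN _.
    by rewrite lef_pV2 ?posrE ?ltr0Sn // ler_nat.
have G0 : \bigcap_i (EE i `&` G) = set0.
  apply/seteqP; split => w // h; have [_ [i hi]] := h 0%N I.
  have [[N _ EN] _] := h i I.
  by have := lt_le_trans EN (hi N); rewrite ltxx.
have : ((b / 2)%:E * P B <= 0)%E.
  rewrite G0 measure0 in cvgG.
  rewrite -[leRHS](cvg_lim _ cvgG) //; apply: lime_ge; first by apply/cvg_ex; eexists; exact: cvgG.
  by apply: nearW => i; exact: step1.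
rewrite pmule_rle0 ?lte_fin // => PB.
by apply/eqP; rewrite eq_le PB measure_ge0.
Qed.

End zero_one.

(** * Vanishing mass *)

Section vanishing.

Definition heavy v : set T := [set w | X v w /\ exists i : nat, forall N, i.+1%:R^-1 <= mass N v w].

(** On this event the mass stays above a fixed positive number, while its
    expectation is arbitrarily small at suitable depths. *)
Lemma heavy_negligible v : words m 0 v ->
  (forall eta : R, 0 < eta -> exists N, \prod_(size v <= j < size v + N) (a j * al j) < eta) ->
  P.-negligible (heavy v).
Proof.
move=> wv small.
pose C i : set T := Xset X v `&` \bigcap_N [set w | i.+1%:R^-1 <= mass N v w].
have -> : heavy v = \bigcup_i C i.
  apply/seteqP; split => w.
    by move=> [Xv [i h]]; exists i => //; split => // N _; exact: h.
  by move=> [i _ [Xv h]]; split => //; exists i => N; exact: h.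
apply: negligible_bigcup => i.
have mC : measurable (C i).
  apply: measurableI.
    by rewrite -[X in measurable X]setTI; exact: hXmeas.
  apply: bigcapT_measurable => N.
  have := @measurable_mass N v wv measurableT `[i.+1%:R^-1, +oo[%classic (measurable_itv _).
  by rewrite setTI set_itvcy.
suff PC : P (C i) = 0%E by apply/negligibleP.
apply/eqP; rewrite eq_le measure_ge0 andbT.
have pf : P (C i) \is a fin_num by exact: fin_num_measure.
rewrite -(fineK pf) lee_fin leNgt; apply/negP => p0.
have i0 : 0 < (i.+1%:R^-1 : R) by rewrite invr_gt0 ltr0Sn.
have [N hN] := small _ (mulr_gt0 i0 p0).
have := @expect_mass N v (fun=> 1) wv (@adapted_cst _ 1) (fun _ => ler01).
set pr := \prod_(_ <= j < _) _ in hN *.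
have pr0 : 0 <= pr by rewrite prodr_ge0 // => j _; rewrite mulr_ge0.
set e1 := EX _; set e2 := EX _ => e12.
have e2le : (e2 <= 1)%E.
  apply: (@le_trans _ _ (EX (fun=> 1))).
    apply: expect_le.
    - by apply: measurable_funM; [exact: measurable_cst|exact: measurable_Xr].
    - exact: measurable_cst.
    - by move=> w; rewrite mul1r; case: (X v w); rewrite ?ler01 ?lexx.
  by rewrite /expect integral_cst // mul1e; exact: probability_le1.
have e1ge : ((i.+1%:R^-1 * fine (P (C i)))%:E <= e1)%E.
  rewrite EFinM fineK // -(setIT (C i)) -(integral_indic P _ mC) //.
  rewrite -/(EX \1_(C i)) -expect_Zl ?(ltW i0) //.
  apply: expect_le.
  - by apply: measurable_funM; [exact: measurable_cst|exact: measurable_indic].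
  - apply: measurable_funM; last exact: measurable_mass.
    by apply: measurable_funM; [exact: measurable_cst|exact: measurable_Xr].
  - move=> w; rewrite mulr_ge0 ?(ltW i0) //= mul1r indicE.
    case: (boolP (w \in C i)) => [|_]; last by rewrite mulr0 mulr_ge0 ?mass_ge0.
    by rewrite inE => -[Xv h]; rewrite Xv mul1r mulr1; exact: h.
have : (e1 <= pr%:E)%E by rewrite e12 -[leRHS]mule1; apply: lee_wpmul2l; rewrite ?lee_fin.
move=> /(le_trans e1ge); rewrite lee_fin => /(lt_le_trans hN).
by rewrite ltxx.
Qed.

End vanishing.
End recursion.

(** * The threshold exponent *)

Section moments_of_law.
Context {R : realType}.
Variables (m : nat -> nat) (blo bhi : R).
Hypothesis hblo : 0 < blo.
Hypothesis hbhi : bhi < 1.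
Variable mu : forall j, probability ((m j).-tuple R) R.
Hypothesis hmu : forall j, mu j (cube blo bhi) = 1%E.
Variable nu : bool -> forall j, probability ((m j).-tuple bool) R.
Implicit Types s t : R.

Lemma measurable_cube n (a b : R) : measurable (@cube R n a b).
Proof.
rewrite (_ : cube a b = \bigcap_(k in [set: 'I_n]) ((fun l => tnth l k) @^-1` `[a, b])).
  apply: fin_bigcap_measurable => // k _.
  by rewrite -[X in measurable X]setTI; apply: measurable_tnth => //; exact: measurable_itv.
apply/seteqP; split => l h k; first by move=> _; rewrite /preimage /= in_itv; exact: h.
by have := h k I; rewrite /preimage /= in_itv.
Qed.

Definition emom s j (k : 'I_(m j)) : \bar R :=
  (\int[mu j]_(l in cube blo bhi) (tnth l k `^ s)%:E)%E.

Definition mom s j (k : 'I_(m j)) : R := fine (emom s k).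

(** The probability that the child of index [k] of a word of level [j] has state
    1, when the word has. *)
Definition coef j (k : nat) : R := fine (nu true j [set x | nth false x k]).

Definition ralpha s j : R := \sum_(k < m j) coef j k * mom s k.

Lemma measurable_tnth_powR j (k : 'I_(m j)) s D : 
  measurable_fun D (fun l : (m j).-tuple R => tnth l k `^ s).
Proof.
apply: measurable_funTS.
apply: (@measurableT_comp _ _ _ _ _ _ (fun r : R => r `^ s)); first exact: measurable_powR.
exact: measurable_tnth.
Qed.

Lemma cube_bounds j (k : 'I_(m j)) l : cube blo bhi l ->
  [/\ 0 < tnth l k, blo <= tnth l k & tnth l k <= bhi].
Proof. by move=> /(_ k)/andP[h1 h2]; split => //; exact: lt_le_trans h1. Qed.

Lemma emom_ge0 s j (k : 'I_(m j)) : (0 <= emom s k)%E.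
Proof. by apply: integral_ge0 => l _; rewrite lee_fin powR_ge0. Qed.

Lemma emom_scale s t j (k : 'I_(m j)) (c : R) : 0 <= c ->
  (forall x, blo <= x <= bhi -> c * x `^ s <= x `^ t) ->
  (c%:E * emom s k <= emom t k)%E.
Proof.
move=> c0 h; rewrite /emom -ge0_integralZl_EFin //; first last.
- by apply/measurable_EFinP; exact: measurable_tnth_powR.
- by move=> l _; rewrite lee_fin powR_ge0.
- exact: measurable_cube.
apply: ge0_le_integral => //.
- exact: measurable_cube.
- by move=> l _; rewrite lee_fin mulr_ge0 ?powR_ge0.
- by apply/measurable_EFinP; apply: measurable_funM; [exact: measurable_cst|exact: measurable_tnth_powR].
- by apply/measurable_EFinP; exact: measurable_tnth_powR.
- by move=> l /cube_bounds -/(_ k)[_ h1 h2]; rewrite lee_fin h // h1.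
Qed.

Lemma powR_ratio_lo s t x : s <= t -> blo <= x <= bhi -> blo `^ (t - s) * x `^ s <= x `^ t.
Proof.
move=> st /andP[x1 x2]; have x0 : 0 < x := lt_le_trans hblo x1.
rewrite -[in leRHS](subrK s t) [x `^ (t - s + s)]powRD; last by apply/implyP => _; rewrite gt_eqF.
rewrite ler_wpM2r ?powR_ge0 // ge0_ler_powR ?subr_ge0 ?nnegrE // ltW //.
Qed.

Lemma powR_ratio_hi s t x : s <= t -> blo <= x <= bhi -> x `^ t <= bhi `^ (t - s) * x `^ s.
Proof.
move=> st /andP[x1 x2]; have x0 : 0 < x := lt_le_trans hblo x1.
rewrite -[in leLHS](subrK s t) [x `^ (t - s + s)]powRD; last by apply/implyP => _; rewrite gt_eqF.
rewrite ler_wpM2r ?powR_ge0 // ge0_ler_powR ?subr_ge0 ?nnegrE // ltW //.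
exact: lt_le_trans x0 _.
Qed.

Lemma emom0 j (k : 'I_(m j)) : emom 0 k = 1%E.
Proof.
rewrite /emom (eq_integral (cst 1%E)); last by move=> l _; rewrite powRr0.
by rewrite integral_cst; [rewrite mul1e; exact: hmu|exact: measurable_cube].
Qed.

Lemma emom_fin s j (k : 'I_(m j)) : emom s k \is a fin_num.
Proof.
rewrite ge0_fin_numE ?emom_ge0 //.
case: (leP 0 s) => s0.
  have : ((1:R)%:E * emom s k <= emom 0 k)%E.
    apply: emom_scale => // x /andP[x1 x2]; have x0 : 0 < x := lt_le_trans hblo x1.
    rewrite mul1r powRr0 -[leRHS](powRr0 x) ger_powR // x0.
    exact: le_trans x2 (ltW hbhi).
  by rewrite mul1e emom0 => /le_lt_trans; apply; rewrite ltry.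
have bp : 0 < blo `^ (- s) by rewrite powR_gt0.
have : ((blo `^ (- s))%:E * emom s k <= emom 0 k)%E.
  apply: emom_scale; first exact: ltW.
  by move=> x; have := @powR_ratio_lo s 0 x (ltW s0); rewrite sub0r.
rewrite emom0 -(lee_pdivlMl _ _ bp) => /le_lt_trans; apply; by rewrite mule1 ltry.
Qed.

Lemma mom_ge0 s j (k : 'I_(m j)) : 0 <= mom s k.
Proof. exact/fine_ge0/emom_ge0. Qed.

Lemma coef_ge0 j k : 0 <= coef j k.
Proof. exact/fine_ge0/measure_ge0. Qed.

Lemma ralpha_ge0 s j : 0 <= ralpha s j.
Proof. by apply: sumr_ge0 => k _; rewrite mulr_ge0 ?coef_ge0 ?mom_ge0. Qed.

Lemma mom_lo s t j (k : 'I_(m j)) : s <= t -> blo `^ (t - s) * mom s k <= mom t k.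
Proof.
move=> st; rewrite -lee_fin EFinM !fineK ?emom_fin //.
by apply: emom_scale; [exact: powR_ge0|move=> x; exact: powR_ratio_lo].
Qed.

Lemma mom_hi s t j (k : 'I_(m j)) : blo <= bhi -> s <= t -> mom t k <= bhi `^ (t - s) * mom s k.
Proof.
move=> bb st; have b0 : 0 < bhi `^ (t - s) by rewrite powR_gt0 // (lt_le_trans hblo).
rewrite -ler_pdivrMl // -lee_fin EFinM !fineK ?emom_fin //.
apply: emom_scale; first by rewrite invr_ge0 ltW.
by move=> x hx; rewrite ler_pdivrMl //; exact: powR_ratio_hi.
Qed.

(** Raising the exponent from [s] to [t] multiplies each term by a factor between
    [blo `^ (t - s)] and [bhi `^ (t - s)]. Hence positivity does not depend on the
    exponent, and logarithms decrease at least linearly in it. *)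
Lemma ralpha_lo s t j : s <= t -> blo `^ (t - s) * ralpha s j <= ralpha t j.
Proof.
move=> st; rewrite /ralpha mulr_sumr; apply: ler_sum => k _.
by rewrite mulrCA ler_wpM2l ?coef_ge0 // mom_lo.
Qed.

Lemma ralpha_hi s t j : blo <= bhi -> s <= t -> ralpha t j <= bhi `^ (t - s) * ralpha s j.
Proof.
move=> bb st; rewrite /ralpha mulr_sumr; apply: ler_sum => k _.
by rewrite mulrCA ler_wpM2l ?coef_ge0 // mom_hi.
Qed.

Lemma ralpha_gt0 s t j : blo <= bhi -> 0 < ralpha s j -> 0 < ralpha t j.
Proof.
move=> bb s0; case: (leP s t) => st.
  by apply: (lt_le_trans _ (@ralpha_lo s t j st)); rewrite mulr_gt0 ?powR_gt0.
have b0 : 0 < bhi `^ (s - t) by rewrite powR_gt0 // (lt_le_trans hblo).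
by have := lt_le_trans s0 (@ralpha_hi t s j bb (ltW st)); rewrite pmulr_rgt0.
Qed.

(** The product law of states and ratios separates the two factors of each
    term of [alpha]. *)
Lemma alphaE s j : alpha blo bhi mu nu s j = (ralpha s j)%:E.
Proof.
rewrite /alpha.
have inner (x : (m j).-tuple bool) :
  (\int[mu j]_(l in cube blo bhi) (\sum_(k < m j) tnth l k `^ s * (tnth x k)%:R)%:E =
   \sum_(k < m j) (mom s k * (tnth x k)%:R)%:E)%E.
  under eq_integral do rewrite -sumEFin.
  rewrite ge0_integral_sum; first last.
  - by move=> k l _; rewrite lee_fin mulr_ge0 ?powR_ge0.
  - by move=> k; apply/measurable_EFinP; apply: measurable_funM; [exact: measurable_tnth_powR|exact: measurable_cst].
  - exact: measurable_cube.
  apply: eq_bigr => k _.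
  under eq_integral do rewrite mulrC EFinM.
  rewrite ge0_integralZl_EFin //; first last.
  - by apply/measurable_EFinP; exact: measurable_tnth_powR.
  - by move=> l _; rewrite lee_fin powR_ge0.
  - exact: measurable_cube.
  by rewrite mulrC EFinM /mom fineK ?emom_fin.
rewrite (eq_integral _ _ (fun x _ => inner x)).
have mA (k : 'I_(m j)) : measurable [set x : (m j).-tuple bool | nth false x k].
  rewrite (_ : [set x | _] = (fun x => tnth x k) @^-1` [set true]).
    by rewrite -[X in measurable X]setTI; apply: measurable_tnth => //; exact: measurable_set1.
  by apply/seteqP; split => x /=; rewrite (tnth_nth false).
have indE (k : 'I_(m j)) (x : (m j).-tuple bool) : (tnth x k)%:R = \1_[set x : (m j).-tuple bool | nth false x k] x :> R.
  by rewrite indicE (tnth_nth false); congr (nat_of_bool _)%:R; apply/idP/idP; rewrite inE.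
rewrite ge0_integral_sum //; first last.
- by move=> k x _; rewrite lee_fin mulr_ge0 ?mom_ge0.
- move=> k; apply/measurable_EFinP; apply: measurable_funM; first exact: measurable_cst.
  by under eq_fun do rewrite indE; exact: measurable_indic.
rewrite -sumEFin; apply: eq_bigr => k _.
under eq_integral do rewrite EFinM indE.
rewrite ge0_integralZl_EFin ?mom_ge0 //; last by apply/measurable_EFinP; exact: measurable_indic.
rewrite integral_indic ?setIT //.
have fA : nu true j [set x | nth false x k] \is a fin_num by apply: fin_num_measure; exact: mA.
by rewrite EFinM muleC; congr (_ * _)%E; rewrite /coef fineK.
Qed.

Lemma limn_einf_gt (u : (\bar R)^nat) (c : \bar R) : (c < limn_einf u)%E ->
  exists J, forall j, (J <= j)%N -> (c < u j)%E.
Proof.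
rewrite limn_einf_lim (cvg_lim _ (@cvg_einfs_sup _ u)) //.
move=> /ereal_sup_gt[_ [J _ <-] h]; exists J => j Jj.
by apply: (lt_le_trans h); apply: ereal_inf_lbound; exists j.
Qed.

Lemma limn_einf_le (u : (\bar R)^nat) (c d : \bar R) : (limn_einf u <= c)%E -> (c < d)%E ->
  forall J, exists2 j, (J <= j)%N & (u j < d)%E.
Proof.
rewrite limn_einf_lim (cvg_lim _ (@cvg_einfs_sup _ u)) // => h cd J.
have : (einfs u J < d)%E.
  by apply: le_lt_trans cd; apply: le_trans h; apply: ereal_sup_ubound; exists J.
by move=> /ereal_inf_lt[_ [j Jj <-] hj]; exists j.
Qed.

(** A sequence that tends to infinity attains its minimum over each tail; a
    minimizer is a value never undercut later. *)
Lemma argmin_tail (t : nat -> R) : (forall A : R, exists K, forall k, (K <= k)%N -> A <= t k) ->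
  forall n0, exists2 n, (n0 <= n)%N & forall k, (n <= k)%N -> t n <= t k.
Proof.
move=> tinf n0.
have fin K : exists2 n, (n0 <= n)%N & forall k, (n0 <= k <= n0 + K)%N -> t n <= t k.
  elim: K => [|K [n n0n hn]].
    by exists n0 => // k; rewrite addn0 -eqn_leq => /eqP ->.
  case: (leP (t n) (t (n0 + K.+1)%N)) => h.
    exists n => // k /andP[k1]; rewrite leq_eqVlt => /orP[/eqP->//|].
    by rewrite addnS ltnS => k2; apply: hn; rewrite k1.
  exists (n0 + K.+1)%N; first exact: leq_addr.
  move=> k /andP[k1]; rewrite leq_eqVlt => /orP[/eqP->//|].
  move=> k2; apply: (le_trans (ltW h)); apply: hn.
  by rewrite k1 -ltnS -addnS.
have [K hK] := tinf (t n0).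
have [n n0n hn] := fin K.
exists n => // k nk.
case: (leqP k (n0 + K)) => hk; first by apply: hn; rewrite hk (leq_trans n0n).
apply: (@le_trans _ _ (t n0)); first by apply: hn; rewrite leqnn leq_addr.
by apply: hK; apply: leq_trans (ltnW hk); exact: leq_addl.
Qed.

Hypothesis hbeta : blo <= bhi.

Local Notation dstar := (dstar blo bhi mu nu).
Local Notation rho := (rho blo bhi mu nu).
Local Notation jl := (jlow blo bhi mu nu).

Definition lnsum s j : R := \sum_(jl <= n < j) ln (ralpha s n).

Lemma rhoE s : rho s = limn_einf (fun j : nat => (j%:R^-1 * lnsum s j)%:E).
Proof.
rewrite /Defs.rho; congr limn_einf; apply/funext => j; congr (_ * _)%:E.
by apply: eq_bigr => n _; rewrite alphaE.
Qed.

Lemma jlowP : (exists j0, alpha0_pos_from blo bhi mu nu j0) ->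
  forall s j, (jl <= j)%N -> 0 < ralpha s j.
Proof.
move=> ex s j hj.
have [j0 hj0] : exists j0, is_jlow blo bhi mu nu j0.
  have ex' : exists j0, `[< alpha0_pos_from blo bhi mu nu j0 >].
    by case: ex => j0 h; exists j0; exact/asboolP.
  exists (ex_minn ex'); case: ex_minnP => n /asboolP hn hmin.
  by split => // j1 h1; apply: hmin; exact/asboolP.
have [h _] := @xgetPex _ 0%N _ (ex_intro _ j0 hj0).
have := h j hj; rewrite alphaE lte_fin; exact: ralpha_gt0.
Qed.

Lemma ln_ralpha_hi s t j : 0 < ralpha s j -> s <= t -> ln (ralpha t j) <= (t - s) * ln bhi + ln (ralpha s j).
Proof.
move=> sp st; have bp : 0 < bhi := lt_le_trans hblo hbeta.
have tp : 0 < ralpha t j := @ralpha_gt0 s t j hbeta sp.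
have bp' : 0 < bhi `^ (t - s) by rewrite powR_gt0.
have -> : (t - s) * ln bhi + ln (ralpha s j) = ln (bhi `^ (t - s) * ralpha s j).
  by rewrite (lnM bp' sp) ln_powR.
have m0 : 0 < bhi `^ (t - s) * ralpha s j by exact: mulr_gt0.
rewrite (ler_ln tp m0); exact: ralpha_hi.
Qed.

Lemma prod_ralpha_exp s p k : (exists j0, alpha0_pos_from blo bhi mu nu j0) ->
  (jl <= p)%N -> (p <= k)%N ->
  \prod_(p <= j < k) ralpha s j = expR (lnsum s k - lnsum s p).
Proof.
move=> ex jp pk; rewrite /lnsum (big_cat_nat jp pk) /= addrAC subrr add0r.
rewrite expR_sum big_nat_cond [RHS]big_nat_cond; apply: eq_bigr => j /andP[/andP[pj _] _].
by rewrite lnK // posrE; apply: jlowP => //; exact: leq_trans pj.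
Qed.

Definition small s := forall n (eta : R), 0 < eta ->
  exists N, \prod_(n <= j < n + N) ralpha s j < eta.

(** If [alpha 0 j] vanishes for arbitrarily large [j], so do the products.
    Otherwise some [s1 < s] has [rho s1 <= 0]: infinitely often [lnsum s1 j] is at
    most a small multiple of [j], and replacing [s1] by [s] lowers each summand by
    a fixed amount. *)
Lemma small_above s : (dstar < s%:E)%E -> small s.
Proof.
rewrite /Defs.dstar; case: asboolP => [ex|nex _]; last first.
  move=> n eta eta0.
  have [j nj aj] : exists2 j, (n <= j)%N & ralpha s j = 0.
    apply: contrapT => h; apply: nex; exists n => j nj.
    rewrite alphaE lte_fin; apply: (@ralpha_gt0 s) => //.
    by rewrite lt_neqAle ralpha_ge0 andbT eq_sym; apply/eqP => a0; apply: h; exists j.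
  exists (j.+1 - n)%N; rewrite subnKC ?(leqW nj) // big_nat_recr //= aj mulr0 //.
move=> hs n eta eta0.
have [s1 hs1 s1s] : exists2 s1 : R, (s1 < s)%R & (rho s1 <= 0)%E.
  have [s1 h1 h2] : exists2 s1 : R, (ereal_sup [set s%:E | s in [set s | (0 < rho s)%E]] < s1%:E)%E & s1 < s.
    move: hs; case: (ereal_sup _) => [r||] //.
      rewrite lte_fin => rs; exists ((r + s) / 2).
        by rewrite lte_fin midf_lt.
      by rewrite midf_lt.
    by move=> _; exists (s - 1); [rewrite ltNyr|rewrite gtrBl].
  exists s1 => //; rewrite leNgt; apply/negP => h.
  have : (s1%:E <= ereal_sup [set s%:E | s in [set s | (0 < rho s)%E]])%E.
    by apply: ereal_sup_ubound; exists s1.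
  by move=> /(lt_le_trans h1); rewrite ltxx.
pose lam := - ((s - s1) * ln bhi).
have bp : 0 < bhi := lt_le_trans hblo hbeta.
have lam0 : 0 < lam by rewrite /lam -mulrN mulr_gt0 ?subr_gt0 // oppr_gt0 ln_lt0 // bp.
pose p := maxn n jl.
have np : (n <= p)%N by exact: leq_maxl.
have jp : (jl <= p)%N by exact: leq_maxr.
pose C := \prod_(n <= j < p) ralpha s j.
have C0 : 0 <= C by apply: prodr_ge0 => j _; exact: ralpha_ge0.
(* Along infinitely many [k], [lnsum s k] is at most
   [lam * jl - lam / 2 * k]. *)
pose B := lam * jl%:R - lnsum s p.
pose J := maxn p.+1 (Num.truncn ((C * expR B / eta) / (lam / 2))).+1.
have lam2 : (0 < (lam / 2)%:E)%E by rewrite lte_fin divr_gt0.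
have s1s' := s1s; rewrite rhoE in s1s'.
have [k Jk hk] := @limn_einf_le _ _ _ s1s' lam2 J.
have pk : (p < k)%N by apply: leq_trans Jk; exact: leq_maxl.
have k0 : 0 < k%:R :> R by rewrite ltr0n (leq_trans _ pk).
exists (k - n)%N; rewrite subnKC; last exact: leq_trans np (ltnW pk).
rewrite (big_cat_nat np (ltnW pk)) /= -/C prod_ralpha_exp // ?(ltnW pk) //.
move: hk; rewrite lte_fin mulrC ltr_pdivrMr // => hk.
have Sk : lnsum s k <= lam * jl%:R - lam * k%:R + lnsum s1 k.
  rewrite /lnsum.
  have -> : lam * jl%:R - lam * k%:R = \sum_(jl <= i < k) (s - s1) * ln bhi.
    rewrite sumr_const_nat -[RHS]mulr_natr natrB; last exact: leq_trans jp (ltnW pk).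
    by rewrite /lam; ring.
  rewrite -big_split /= [leLHS]big_nat [leRHS]big_nat; apply: ler_sum => i /andP[ji _].
  by apply: ln_ralpha_hi; [exact: jlowP|exact: ltW].
have le1 : lnsum s k - lnsum s p <= B - lam / 2 * k%:R.
  have e2 : lam * k%:R = lam / 2 * k%:R + lam / 2 * k%:R by field.
  rewrite /B; move: Sk hk; rewrite e2.
  move: (lnsum s k) (lnsum s1 k) (lnsum s p) (lam * jl%:R) (lam / 2 * k%:R) => x1 x2 x3 x4 x5.
  by move=> h1 h2; lra.
apply: (@le_lt_trans _ _ (C * expR (B - lam / 2 * k%:R))).
  by rewrite ler_wpM2l // ler_expR.
rewrite expRD mulrA expRN ltr_pdivrMr ?expR_gt0 // (mulrC eta) -ltr_pdivrMr //.
have h1 : 1 + lam / 2 * k%:R <= expR (lam / 2 * k%:R) by exact: expR_ge1Dx.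
apply: (lt_le_trans _ h1).
have : C * expR B / eta / (lam / 2) < k%:R.
  apply: (@lt_le_trans _ _ (Num.truncn ((C * expR B / eta) / (lam / 2))).+1%:R).
    by rewrite real_truncnS_gt // num_real.
  by rewrite ler_nat (leq_trans _ Jk) // leq_maxr.
rewrite ltr_pdivrMr ?divr_gt0 // => h; apply: (lt_trans h).
by rewrite [k%:R * _]mulrC ltrDr.
Qed.

(** Some [s1 > s] has [rho s1 > c > 0], so [lnsum s k - c / 2 * k] tends to
    infinity. From a level where this sequence is at its future minimum, the
    products grow at least exponentially, without any loss of constants: this
    uniformity at infinitely many levels replaces regularity of the environment. *)
Lemma growth_below s : (s%:E < dstar)%E ->
  exists2 c : R, 0 < c & forall n0, exists2 n, (n0 <= n)%N &
   (forall k, (n <= k)%N -> 0 < ralpha s k) /\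
   (forall k, (n <= k)%N -> expR (c * (k - n)%:R) <= \prod_(n <= j < k) ralpha s j).
Proof.
rewrite /Defs.dstar; case: asboolP => [ex|//].
move=> /ereal_sup_gt[_ [s1 /= rs1 <-]]; rewrite lte_fin => ss1.
have [c c0 hc] : exists2 c : R, 0 < c & (c%:E < rho s1)%E.
  move: rs1; case: (rho s1) => [r||] //.
    by rewrite lte_fin => r0; exists (r / 2); rewrite ?lte_fin ?divr_gt0 // gtr_pMr // invf_lt1 // ltr1n.
  by move=> _; exists 1; rewrite ?ltry.
move: hc; rewrite rhoE => /limn_einf_gt[J hJ].
have mono k : lnsum s1 k <= lnsum s k.
  rewrite /lnsum [leLHS]big_nat [leRHS]big_nat; apply: ler_sum => i /andP[ji _].
  apply: (le_trans (@ln_ralpha_hi s s1 i _ (ltW ss1))); first exact: jlowP.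
  by rewrite gerDr mulr_ge0_le0 ?subr_ge0 ?(ltW ss1) // ln_le0 // ltW.
have lb k : (J <= k)%N -> (0 < k)%N -> c * k%:R <= lnsum s k.
  move=> Jk k0; apply: le_trans (mono k).
  have := hJ k Jk; rewrite lte_fin mulrC ltr_pdivlMr ?ltr0n //; exact: ltW.
exists (c / 2); first by rewrite divr_gt0.
move=> n0.
have [|n hn nmin] := @argmin_tail (fun k => lnsum s k - c / 2 * k%:R) _ (maxn n0 jl).
  move=> A; exists (maxn (maxn J 1) (Num.truncn (A / (c / 2))).+1) => k.
  rewrite !geq_max => /andP[/andP[Jk k0] tk].
  apply: (@le_trans _ _ (c / 2 * k%:R)).
    rewrite mulrC -ler_pdivrMr ?divr_gt0 // ltW // (lt_le_trans (real_truncnS_gt (num_real _))) //.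
    by rewrite ler_nat.
  have := lb k Jk k0.
  have -> : c * k%:R = c / 2 * k%:R + c / 2 * k%:R by field.
  by move: (lnsum s k) (c / 2 * k%:R) => x1 x2; lra.
have [n0n jn] : (n0 <= n)%N /\ (jl <= n)%N by move: hn; rewrite geq_max => /andP[].
exists n => //; split => k nk; first by apply: jlowP => //; exact: leq_trans nk.
rewrite prod_ralpha_exp // ler_expR natrB //.
have := nmin k nk; rewrite mulrBr.
by move: (lnsum s n) (lnsum s k) (c / 2 * n%:R) (c / 2 * k%:R) => x1 x2 x3 x4; lra.
Qed.

End moments_of_law.

(** * Series over countable types *)

Section series.
Context {R : realType}.
Local Open Scope ereal_scope.

Lemma nneseries_pickle (I : countType) (f : I -> \bar R) : (forall i, 0 <= f i) ->
  \sum_(0 <= k <oo) oapp f 0 (pickle_inv k) = \esum_(i in [set: I]) f i.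
Proof.
move=> f0; rewrite nneseries_esumT; last by move=> k; case: pickle_inv.
have -> : \esum_(k in [set: nat]) oapp f 0 (pickle_inv k) =
    \esum_(k in pickle @` [set: I]) oapp f 0 (pickle_inv k).
  rewrite [RHS]esum_mkcond; apply: eq_esum => k _.
  case: ifPn => //; case e : (pickle_inv k) => [i|] //= /negP[].
  by rewrite inE /=; exists i => //; have := @pickle_invK I k; rewrite e.
rewrite esum_image; last by move=> x y _ _; exact: (pcan_inj pickleK).
by apply: eq_esum => i _; rewrite pickleK_inv.
Qed.

Lemma nneseries_nth (A : Type) (x0 : A) (l : seq A) (f : A -> \bar R) : f x0 = 0 ->
  (forall x, 0 <= f x) ->
  \sum_(0 <= k <oo) f (nth x0 l k) = \sum_(x <- l) f x.
Proof.
move=> fx0 f0; rewrite (nneseries_split 0 (size l)) //.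
rewrite add0n eseries0 ?adde0; last by move=> k sk _; rewrite nth_default.
by rewrite [RHS](big_nth x0).
Qed.

Lemma nneseries_pair (f : nat -> nat -> \bar R) : (forall i j, 0 <= f i j) ->
  \sum_(0 <= k <oo) oapp (fun p : nat * nat => f p.1 p.2) 0 (pickle_inv k) =
  \sum_(0 <= i <oo) \sum_(0 <= j <oo) f i j.
Proof.
move=> f0; rewrite nneseries_pickle //.
rewrite nneseries_esumT; last by move=> i; apply: nneseries_ge0.
under [RHS]eq_esum do rewrite nneseries_esumT //.
rewrite esum_esum //; congr esum.
by apply/seteqP; split.
Qed.

Lemma nneseries_le_bound (f : nat -> \bar R) (c : \bar R) : (forall k, 0 <= f k) ->
  (forall n, \sum_(0 <= k < n) f k <= c) -> \sum_(0 <= k <oo) f k <= c.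
Proof.
move=> f0 h; apply: lime_le; first exact: is_cvg_nneseries.
by apply: nearW.
Qed.

End series.

(** * Packing disjoint open sets in a cube *)

Section grid.
Context {R : realType} {d : nat}.
Hypothesis hd : (0 < d)%N.
Variables (x0 : 'rV[R]_d) (rho : R).
Hypothesis rho0 : 0 < rho.

(** Dyadic grids of the cube of centre [x0] and half-side [rho]; cubes of the
    [n]-th grid are indexed by their integer coordinates. *)
Definition side n : R := 2 * rho / (2 ^ n)%:R.
Definition corner n (z : 'I_d -> nat) : 'rV[R]_d :=
  \row_k (x0 ord0 k - rho + (z k)%:R * side n).
Definition qbox n (z : 'I_d -> nat) : set 'rV[R]_d :=
  box (corner n z) (corner n (fun k => (z k).+1)).
Definition gridI n := {ffun 'I_d -> 'I_(2 ^ n)}.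
Definition idx n (z : gridI n) : 'I_d -> nat := fun k => z k.
Arguments idx {n} z _ : simpl never.

Lemma side_gt0 n : 0 < side n.
Proof. by rewrite divr_gt0 ?mulr_gt0 // ltr0n expn_gt0. Qed.

Lemma sideS n : side n = 2 * side n.+1.
Proof.
rewrite /side expnS natrM; field.
by rewrite pnatr_eq0 -lt0n expn_gt0.
Qed.

Lemma qbox_volume n z : box_volume (corner n z) (corner n (fun k => (z k).+1)) = side n ^+ d.
Proof.
rewrite /box_volume (eq_bigr (fun=> side n)); first by rewrite prodr_const card_ord.
move=> k _; rewrite !mxE -natr1 (_ : _ - _ = side n); last by ring.
by apply/max_idPr; exact/ltW/side_gt0.
Qed.

Lemma qbox_corner n z : qbox n z (corner n z).
Proof.
move=> k; rewrite lexx /= !mxE lerD2l ler_wpM2r ?ler_nat //.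
exact/ltW/side_gt0.
Qed.

Definition inside (U : set 'rV[R]_d) n := [pred z : gridI n | `[< qbox n (idx z) `<=` U >]].

Lemma half_lt n (i : 'I_(2 ^ n.+1)) : (i./2 < 2 ^ n)%N.
Proof. by rewrite ltn_half_double -mul2n -expnS. Qed.

Definition par n (z : gridI n.+1) : gridI n := [ffun k => Ordinal (@half_lt n (z k))].
Arguments par {n} z.

Lemma qbox_par n (z : gridI n.+1) : qbox n.+1 (idx z) `<=` qbox n (idx (par z)).
Proof.
move=> x hx k; have := hx k; rewrite !mxE /idx ffunE /= (sideS n).
have s0 := side_gt0 n.+1.
have e : (z k)%:R = (odd (z k))%:R + 2 * (((z k)./2)%:R) :> R.
  by rewrite -[in LHS](odd_double_half (z k)) natrD -mul2n natrM.
have odd01 : 0 <= ((odd (z k))%:R : R) <= 1 by case: (odd _); rewrite ?lexx ler01.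
have [odd0 odd1] := andP odd01.
move=> /andP[h1 h2]; apply/andP; split.
  apply: le_trans h1; rewrite lerD2l mulrA ler_wpM2r ?(ltW s0) // e; lra.
apply: (le_trans h2); rewrite lerD2l mulrA ler_wpM2r ?(ltW s0) // -!natr1 e; lra.
Qed.

(** The maximal dyadic cubes contained in [U]: those whose parent is not
    contained in [U]. *)
Definition fresh (U : set 'rV[R]_d) n : pred (gridI n) :=
  match n return pred (gridI n) with
  | 0 => inside U 0
  | n'.+1 => fun z => inside U n'.+1 z && ~~ inside U n' (par z)
  end.
Arguments fresh U n z : clear implicits.

Lemma child_lt n (i : 'I_(2 ^ n)) (c : bool) : (c + i.*2 < 2 ^ n.+1)%N.
Proof.
rewrite expnS mul2n; apply: (@leq_trans (i.+1).*2); last by rewrite leq_double.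
by rewrite doubleS; case: c; rewrite ?add1n ?add0n.
Qed.

Definition child n (p : gridI n * {ffun 'I_d -> bool}) : gridI n.+1 :=
  [ffun k => Ordinal (@child_lt n (p.1 k) (p.2 k))].
Arguments child {n} p.

Lemma par_child n p : par (@child n p) = p.1.
Proof. by apply/ffunP => k; apply/val_inj; rewrite !ffunE /= half_bit_double. Qed.
Arguments par_child {n} p.

Lemma child_inj n : injective (@child n).
Proof.
move=> p q pq; have e1 : p.1 = q.1 by rewrite -(par_child p) pq par_child.
have e2 : p.2 = q.2.
  apply/ffunP => k; move/ffunP/(_ k)/(congr1 val) : pq; rewrite !ffunE /= => /(congr1 odd).
  by rewrite !oddD !odd_double !addbF; case: (p.2 k); case: (q.2 k).
by case: p q e1 e2 {pq} => [? ?] [? ?] /= -> ->.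
Qed.

(** Each cube of generation [n] inside [U] accounts for [2 ^ d] cubes of the next
    generation whose parent is inside [U]. *)
Lemma card_fresh U n : (#|fresh U n.+1| + #|inside U n| * 2 ^ d <= #|inside U n.+1|)%N.
Proof.
pose old : pred (gridI n.+1) := [pred z | inside U n.+1 z & inside U n (par z)].
have -> : #|inside U n.+1| = (#|fresh U n.+1| + #|old|)%N.
  rewrite -(cardID old (inside U n.+1)) addnC; congr (_ + _)%N; apply: eq_card => z;
    rewrite !inE /= /in_mem /=; case: asboolP => //=; by case: asboolP.
rewrite leq_add2l.
have -> : (#|inside U n| * 2 ^ d)%N = #|[predX inside U n & predT : pred {ffun 'I_d -> bool}]|.
  by rewrite cardX; congr (_ * _)%N; rewrite cardT -cardE card_ffun card_bool card_ord.
rewrite -(fintype.card_image (@child_inj n)); apply/subset_leq_card/fintype.subsetP => z.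
move=> /fintype.imageP[p]; rewrite !inE /= andbT => /asboolP hp ->.
apply/andP; split; apply/asboolP; last by rewrite par_child.
by move=> x /qbox_par; rewrite par_child; exact: hp.
Qed.

Definition gvol U n : R := #|inside U n|%:R * side n ^+ d.

Lemma gvolS U n : gvol U n + #|fresh U n.+1|%:R * side n.+1 ^+ d <= gvol U n.+1.
Proof.
rewrite /gvol (sideS n) exprMn mulrA -mulrDl ler_wpM2r ?exprn_ge0 ?(ltW (side_gt0 _)) //.
rewrite -natrX -natrM -natrD ler_nat addnC; exact: card_fresh.
Qed.

Lemma gvol_mono U n n' : (n <= n')%N -> gvol U n <= gvol U n'.
Proof.
elim: n' => [|n' IH]; first by rewrite leqn0 => /eqP ->.
rewrite leq_eqVlt => /orP[/eqP->//|]; rewrite ltnS => /IH /le_trans; apply.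
apply: le_trans (gvolS U n'); rewrite lerDl mulr_ge0 // exprn_ge0 //.
exact/ltW/side_gt0.
Qed.

Lemma sum_fresh U n : \sum_(0 <= i < n.+1) #|fresh U i|%:R * side i ^+ d <= gvol U n.
Proof.
elim: n => [|n IH]; first by rewrite big_nat1.
rewrite big_nat_recr //=; apply: le_trans (gvolS U n); by rewrite lerD2r.
Qed.

Lemma fresh_cover U n (z : gridI n) : inside U n z ->
  exists i (y : gridI i), fresh U i y /\ qbox n (idx z) `<=` qbox i (idx y).
Proof.
elim: n z => [|n IH] z hz; first by exists 0%N, z; split => //; exact: subset_refl.
case: (boolP (inside U n (par z))) => hp; last by exists n.+1, z; split => //; apply/andP.
have [i [y [fy sy]]] := IH _ hp.
exists i, y; split => //; apply: subset_trans sy; exact: qbox_par.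
Qed.

Lemma grid_point n (x : 'rV[R]_d) : box (\row_k (x0 ord0 k - rho)) (\row_k (x0 ord0 k + rho)) x ->
  exists z : gridI n, qbox n (idx z) x.
Proof.
move=> hx; have s0 := side_gt0 n.
have two0 : (0 < 2 ^ n)%N by rewrite expn_gt0.
pose t k := (x ord0 k - (x0 ord0 k - rho)) / side n.
have t0 k : 0 <= t k.
  by rewrite divr_ge0 ?(ltW s0) // subr_ge0; have := hx k; rewrite !mxE => /andP[].
have t1 k : t k <= (2 ^ n)%:R.
  rewrite /t ler_pdivrMr // /side mulrC divfK ?pnatr_eq0 -?lt0n //.
  by have := hx k; rewrite !mxE => /andP[_ h]; lra.
pose i k := minn (Num.truncn (t k)) (2 ^ n).-1.
have il k : (i k < 2 ^ n)%N by rewrite /i -[ltnRHS](prednK two0) ltnS geq_minr.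
exists [ffun k => Ordinal (il k)] => k; rewrite !mxE /idx ffunE /=.
have xE : x ord0 k = x0 ord0 k - rho + t k * side n by rewrite /t divfK ?gt_eqF //; ring.
have [h1 h2] : (Num.truncn (t k))%:R <= t k /\ t k < (Num.truncn (t k)).+1%:R.
  by apply/andP; exact: truncn_itv.
rewrite xE; apply/andP; split; rewrite lerD2l ler_wpM2r ?(ltW s0) //.
  have hi : (i k)%:R <= (Num.truncn (t k))%:R :> R by rewrite ler_nat geq_minl.
  exact: le_trans hi h1.
rewrite /i; case: (leqP (Num.truncn (t k)) (2 ^ n).-1) => h; first exact: ltW.
by rewrite prednK.
Qed.

Lemma open_grid U (x : 'rV[R]_d) : open U -> U x ->
  box (\row_k (x0 ord0 k - rho)) (\row_k (x0 ord0 k + rho)) x ->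
  exists n (z : gridI n), inside U n z /\ qbox n (idx z) x.
Proof.
move=> oU Ux bx.
have /nbhs_ballP[e /= e0 he] : nbhs x U by exact: open_nbhs_nbhs.
pose n := (Num.truncn (2 * rho / e)).+1.
have sn : side n < e.
  rewrite /side ltr_pdivrMr ?ltr0n ?expn_gt0 // (mulrC e) -ltr_pdivrMr //.
  have hn : n%:R <= (2 ^ n)%:R :> R by rewrite ler_nat; exact/ltnW/ltn_expl.
  by apply: (lt_le_trans _ hn); rewrite real_truncnS_gt // num_real.
have [z hz] := @grid_point n x bx.
exists n, z; split => //; apply/asboolP => y hy; apply: he; split => // i k.
rewrite (ord1 i) /ball /= ltr_norml.
have := hz k; have := hy k; rewrite !mxE -natr1 => /andP[h1 h2] /andP[h3 h4].
by apply/andP; split; lra.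
Qed.

(** The maximal dyadic cubes in an open set cover it, and by telescoping their
    total volume is the limit of the volumes of its inner grid approximations. *)
Lemma vol_le_gvol U (c : R) : open U ->
  U `<=` box (\row_k (x0 ord0 k - rho)) (\row_k (x0 ord0 k + rho)) ->
  (forall n, gvol U n <= c) -> (lebesgue_vol U <= c%:E)%E.
Proof.
move=> oU Ub hc.
pose l n : seq ('rV[R]_d * 'rV[R]_d) :=
  [seq (corner n (idx z), corner n (fun k => (idx z k).+1)) | z <- enum (fresh U n)].
pose tr : 'rV[R]_d * 'rV[R]_d := (0, 0).
pose ab k := oapp (fun p : nat * nat => nth tr (l p.1) p.2) tr (pickle_inv k).
have vtr : box_volume tr.1 tr.2 = 0 :> R.
  by rewrite /box_volume (bigD1 (Ordinal hd)) //= !mxE subrr maxxx mul0r.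
have vol0 (p : 'rV[R]_d * 'rV[R]_d) : 0 <= box_volume p.1 p.2.
  by apply: prodr_ge0 => k _; rewrite le_max lexx.
apply: ge_ereal_inf; exists (\sum_(0 <= k <oo) (box_volume (ab k).1 (ab k).2)%:E)%E.
  exists ab => // x Ux.
  have [n [z [hz hx]]] := @open_grid U x oU Ux (Ub x Ux).
  have [i [y [fy sy]]] := @fresh_cover U n z hz.
  pose b := (corner i (idx y), corner i (fun k => (idx y k).+1)).
  have bl : b \in l i by apply/mapP; exists y => //; rewrite mem_enum.
  exists (pickle (i, index b (l i))) => //.
  by rewrite /ab pickleK_inv /= nth_index //; exact: sy.
rewrite (eq_eseriesr (g := fun k => oapp (fun p : nat * nat => (box_volume (nth tr (l p.1) p.2).1 (nth tr (l p.1) p.2).2)%:E) 0%E (pickle_inv k))); last first.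
  by move=> k _; rewrite /ab; case: (pickle_inv k) => //=; rewrite vtr.
rewrite (@nneseries_pair _ (fun i j => (box_volume (nth tr (l i) j).1 (nth tr (l i) j).2)%:E)); last first.
  by move=> i j; rewrite lee_fin.
rewrite (eq_eseriesr (g := fun i => (#|fresh U i|%:R * side i ^+ d)%:E)); last first.
  move=> i _; rewrite (@nneseries_nth _ _ tr (l i) (fun b => (box_volume b.1 b.2)%:E)); last 2 first.
    by rewrite vtr.
    by move=> p; rewrite lee_fin.
  rewrite big_map sumEFin (eq_bigr (fun=> side i ^+ d)); last by move=> z _; exact: qbox_volume.
  by rewrite big_const_seq count_predT iter_addr_0 -cardE mulr_natl.
apply: nneseries_le_bound => [i|n].
  by rewrite lee_fin mulr_ge0 // exprn_ge0 // ltW // side_gt0.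
rewrite sumEFin lee_fin; case: n => [|n]; last by apply: le_trans (hc n); exact: sum_fresh.
rewrite big_geq //; apply: le_trans (hc 0%N).
by rewrite /gvol mulr_ge0 // exprn_ge0 // ltW // side_gt0.
Qed.

(** One grid is chosen so fine that the cubes contained in each set fill more
    than half of the prescribed outer volume. By disjointness these cubes are
    distinct, so there are at most [(2 ^ n) ^ d] of them. *)
Lemma packing (I : eqType) (U : I -> set 'rV[R]_d) (r : seq I) (eta : R) : uniq r -> 0 < eta ->
  (forall i, i \in r -> open (U i)) ->
  (forall i, i \in r -> U i `<=` box (\row_k (x0 ord0 k - rho)) (\row_k (x0 ord0 k + rho))) ->
  (forall i j, i \in r -> j \in r -> i != j -> U i `&` U j = set0) ->
  (forall i, i \in r -> (eta%:E <= lebesgue_vol (U i))%E) ->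
  (size r)%:R * eta <= 2 * (2 * rho) ^+ d.
Proof.
move=> ur eta0 oU bU disj vU.
have hn i : i \in r -> exists n, eta / 2 < gvol (U i) n.
  move=> ir; apply: contrapT => /forallNP h.
  have : (lebesgue_vol (U i) <= (eta / 2)%:E)%E.
    apply: vol_le_gvol; [exact: oU|exact: bU|].
    by move=> n; rewrite leNgt; apply/negP; exact: h.
  move=> /(le_trans (vU i ir)); rewrite lee_fin; lra.
have [n hnn] : exists n, forall i, i \in r -> eta / 2 <= gvol (U i) n.
  elim: r hn {ur oU bU disj vU} => [|i r IH] hn; first by exists 0%N.
  have [|n1 h1] := IH; first by move=> j jr; apply: hn; rewrite inE jr orbT.
  have [n2 h2] := hn i (mem_head _ _).
  exists (maxn n1 n2) => j; rewrite inE => /orP[/eqP->|jr].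
    by apply: (le_trans (ltW h2)); apply: gvol_mono; exact: leq_maxr.
  by apply: (le_trans (h1 j jr)); apply: gvol_mono; exact: leq_maxl.
have : (\sum_(i <- r) #|inside (U i) n| <= #|gridI n|)%N.
  rewrite -sum1_card.
  under eq_bigr do rewrite -sum1_card big_mkcond /=.
  rewrite exchange_big /=; apply: leq_sum => z _.
  rewrite -big_mkcond /= sum1_count -size_filter.
  have : uniq [seq i <- r | z \in inside (U i) n] by rewrite filter_uniq.
  have : forall i, i \in [seq i <- r | z \in inside (U i) n] -> i \in r /\ qbox n (idx z) `<=` U i.
    by move=> i; rewrite mem_filter => /andP[/asboolP h1 h2].
  case: [seq i <- r | _] => [//|i [//|j s]] h /=; rewrite inE negb_or => /andP[/andP[ij _] _].
  have [ir hi] := h i (mem_head _ _).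
  have [jr hj] : j \in r /\ qbox n (idx z) `<=` U j by apply: h; rewrite !inE eqxx orbT.
  have := disj i j ir jr ij; move/seteqP => [/(_ (corner n (idx z))) + _].
  by case; split; [apply: hi|apply: hj]; exact: qbox_corner.
rewrite card_ffun !card_ord => hcard.
have : \sum_(i <- r) (eta / 2) <= (2 * rho) ^+ d.
  apply: (@le_trans _ _ (\sum_(i <- r) gvol (U i) n)).
    by rewrite big_seq [leRHS]big_seq; apply: ler_sum => i ir; exact: hnn.
  rewrite /gvol -mulr_suml -natr_sum.
  apply: (@le_trans _ _ (((2 ^ n) ^ d)%:R * side n ^+ d)).
    by rewrite ler_wpM2r ?ler_nat // exprn_ge0 // ltW // side_gt0.
  rewrite natrX -exprMn /side mulrC divfK // pnatr_eq0 -lt0n expn_gt0 //.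
rewrite big_const_seq count_predT iter_addr_0 -mulr_natl; lra.
Qed.

End grid.

(** * Diameters *)

Section euclid.
Context {R : realType} {d : nat}.
Implicit Types (x y : 'rV[R]_d) (U V : set 'rV[R]_d).

Lemma coord_le_eucl x k : `|x ord0 k| <= eucl_norm x.
Proof.
rewrite /eucl_norm -sqrtr_sqr ler_wsqrtr // (bigD1 k) //= lerDl.
by apply: sumr_ge0 => i _; exact: sqr_ge0.
Qed.

Lemma ediam_ge0 U : (0 <= ediam U)%E.
Proof. by rewrite /ediam le_max lexx. Qed.

Lemma diam_ge0 U : 0 <= diam U.
Proof. exact/fine_ge0/ediam_ge0. Qed.

Lemma ediam_ub U x y : U x -> U y -> ((eucl_norm (x - y))%:E <= ediam U)%E.
Proof.
move=> Ux Uy; rewrite /ediam le_max; apply/orP; right.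
by apply: ereal_sup_ubound; exists x => //; exists y.
Qed.

Lemma ediamS U V : U `<=` V -> (ediam U <= ediam V)%E.
Proof.
move=> UV; rewrite {1}/ediam ge_max ediam_ge0 /=.
apply: ge_ereal_sup => _ [x Ux [y Uy <-]].
by apply: ediam_ub; exact: UV.
Qed.

Lemma ediam_fin U : 0 < diam U -> ediam U = (diam U)%:E.
Proof. by rewrite /diam; case: (ediam U) => //= [|] //; rewrite ltxx. Qed.

Lemma ediam_fin_le U (r : R) : (ediam U <= r%:E)%E -> ediam U = (diam U)%:E.
Proof. by rewrite /diam; have := ediam_ge0 U; case: (ediam U). Qed.

Lemma diam_ub U x y : ediam U = (diam U)%:E -> U x -> U y -> eucl_norm (x - y) <= diam U.
Proof. by move=> e Ux Uy; rewrite -lee_fin -e; exact: ediam_ub. Qed.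

Lemma diamS U V : U `<=` V -> 0 < diam V -> diam U <= diam V.
Proof.
move=> UV V0; have h := ediamS UV; rewrite (ediam_fin V0) in h.
by rewrite -lee_fin -(ediam_fin_le h).
Qed.

Lemma diam_gt0_nonempty U : 0 < diam U -> U !=set0.
Proof.
move=> U0; apply/set0P/eqP => U0'.
suff : ediam U = 0%E by move=> e; move: U0; rewrite /diam e ltxx.
apply/eqP; rewrite eq_le ediam_ge0 andbT U0' /ediam ge_max lexx /=.
by apply: ge_ereal_sup => _ [x []].
Qed.

Lemma eucl_eq0 x : eucl_norm x <= 0 -> x = 0.
Proof.
move=> h; apply/rowP => k; rewrite mxE; apply/eqP.
rewrite -normr_le0; exact: le_trans (coord_le_eucl x k) h.
Qed.

End euclid.

(** * The nested compact sets *)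

Section nested.
Context {R : realType} {d : nat} {disp : measure_display} {T : measurableType disp}.
Hypothesis hd : (0 < d)%N.
Variable m : nat -> nat.
Variables (blo bhi : R).
Hypothesis hblo : 0 < blo.
Hypothesis hbeta : blo <= bhi.
Hypothesis hbhi : bhi < 1.
Variable J : seq nat -> T -> set 'rV[R]_d.
Hypothesis hJcompact : forall u w, words m 0 u -> compact (J u w).
Hypothesis hJdiam : forall u w, words m 0 u -> 0 < diam (J u w).
Hypothesis hJsub : forall u w k, words m 0 u -> (1 <= k <= m (size u))%N ->
       J (rcons u k) w `<=` J u w.
Hypothesis hJdisj : forall u w k k', words m 0 u ->
       (1 <= k <= m (size u))%N -> (1 <= k' <= m (size u))%N -> k != k' ->
       (J (rcons u k) w)° `&` (J (rcons u k') w)° = set0.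
Variable kappa : R.
Hypothesis kappa0 : 0 < kappa.
Hypothesis hJvol : forall u w, words m 0 u ->
         ((kappa * diam (J u w) ^+ d)%:E <= lebesgue_vol ((J u w)°))%E.

Lemma parent_rcons u a : parent (rcons u a) = u.
Proof. by rewrite /parent size_rcons /= -cats1 take_size_cat. Qed.

Lemma words_rcons_le u a : words m 0 (rcons u a) -> words m 0 u /\ (1 <= a <= m (size u))%N.
Proof. by move=> /words_rcons_inv[wu [k km ->]]. Qed.

Lemma J_cat u v w : words m 0 (u ++ v) -> J (u ++ v) w `<=` J u w.
Proof.
elim/last_ind: v => [|v a IH]; first by rewrite cats0 => _ x.
rewrite -rcons_cat => wv; have [wuv ha] := words_rcons_le wv.
apply: subset_trans (IH wuv); exact: hJsub.
Qed.

Lemma ratio_pos_le1 u w : words_star m 0 u -> 0 < ratio J u w <= 1.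
Proof.
move=> /words_starE[y [k [wy km ->]]]; rewrite /ratio parent_rcons.
have wk := @words_rcons m y k wy km.
rewrite divr_gt0 ?hJdiam //= ler_pdivrMr ?hJdiam // mul1r.
by apply: diamS; [exact: hJsub|exact: hJdiam].
Qed.

Lemma diam_child u k w : words m 0 u -> (k < m (size u))%N ->
  diam (J (rcons u k.+1) w) = ratio J (rcons u k.+1) w * diam (J u w).
Proof.
by move=> wu km; rewrite /ratio parent_rcons divfK // gt_eqF // hJdiam.
Qed.

Lemma J_interior_disjoint u v w : words m 0 u -> words m 0 v ->
  ~~ prefix u v -> ~~ prefix v u -> (J u w)° `&` (J v w)° = set0.
Proof.
move=> wu wv uv vu.
have [p [a [b [u' [v' [ab uE vE]]]]]] : exists p a b u' v',
    [/\ a != b, u = p ++ a :: u' & v = p ++ b :: v'].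
  elim: u v {wu wv} uv vu => [|a u IH] [|b v] //=.
  case: (eqVneq a b) => [->|ab].
    move=> uv vu; have [p [a' [b' [u' [v' [h1 -> ->]]]]]] := IH v uv vu.
    by exists (b :: p), a', b', u', v'.
  by move=> _ _; exists [::], a, b, u, v.
move: wu wv; rewrite uE vE -!cat_rcons => wu wv.
have [wpa _] := @words_cat_inv m _ _ wu; have [wpb _] := @words_cat_inv m _ _ wv.
have [wp ha] := words_rcons_le wpa; have [_ hb] := words_rcons_le wpb.
apply/seteqP; split => // x [xu xv].
have := hJdisj w wp ha hb ab; move/seteqP => [/(_ x) + _]; apply; split.
  by apply: interiorS xu; exact: J_cat.
by apply: interiorS xv; exact: J_cat.
Qed.

(** The interiors are disjoint open subsets of one cube, each of volume at least
    [kappa * (c * rho) ^+ d]. *)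
Lemma packing_count w (x0 : 'rV[R]_d) (c rho : R) (r : seq (seq nat)) : uniq r -> 0 < c -> 0 < rho ->
  (forall u, u \in r -> words m 0 u) ->
  (forall u v, u \in r -> v \in r -> u != v -> ~~ prefix u v) ->
  (forall u, u \in r -> J u w `<=` box (\row_k (x0 ord0 k - rho)) (\row_k (x0 ord0 k + rho))) ->
  (forall u, u \in r -> c * rho <= diam (J u w)) ->
  (size r)%:R <= 2 * 2 ^+ d / (kappa * c ^+ d).
Proof.
move=> ur c0 rho0 wr pr br dr.
have k0 : 0 < kappa * c ^+ d by rewrite mulr_gt0 // exprn_gt0.
have rd : 0 < rho ^+ d by rewrite exprn_gt0.
have := @packing R d hd x0 rho rho0 _ (fun u => (J u w)°) r (kappa * (c * rho) ^+ d) ur.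
have e0 : 0 < kappa * (c * rho) ^+ d by rewrite mulr_gt0 // exprn_gt0 // mulr_gt0.
move=> /(_ e0) H; rewrite ler_pdivlMr //.
have : (size r)%:R * (kappa * (c * rho) ^+ d) <= 2 * (2 * rho) ^+ d.
  apply: H.
  - by move=> u _; exact: open_interior.
  - by move=> u ur'; apply: subset_trans (br u ur'); exact: interior_subset.
  - move=> u v uu vv uv; apply: J_interior_disjoint; [exact: wr|exact: wr|exact: pr|].
    by apply: pr => //; rewrite eq_sym.
  - move=> u uu; apply: le_trans (hJvol w (wr u uu)); rewrite lee_fin.
    rewrite ler_wpM2l ?(ltW kappa0) // lerXn2r ?nnegrE ?dr //.
      by rewrite mulr_ge0 // ltW.
    exact: diam_ge0.
rewrite !exprMn !mulrA => h.
by rewrite -(ler_pM2r rd) -!mulrA; move: h; rewrite -!mulrA.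
Qed.

Lemma prefix_same_size (u v : seq nat) : size u = size v -> prefix u v -> u = v.
Proof.
move=> uv /prefixP[y yE]; rewrite yE; suff -> : y = [::] by rewrite cats0.
apply/size0nil; move/(congr1 size) : yE; rewrite size_cat -uv => /eqP.
by rewrite -[X in X == _]addn0 eqn_add2l eq_sym => /eqP.
Qed.

Lemma box_of_diam U (x0 : 'rV[R]_d) (rho : R) :
  (forall y, U y -> eucl_norm (y - x0) <= rho) ->
  U `<=` box (\row_k (x0 ord0 k - rho)) (\row_k (x0 ord0 k + rho)).
Proof.
move=> h y Uy k; have := le_trans (coord_le_eucl _ k) (h y Uy).
by rewrite !mxE ler_norml => /andP[h1 h2]; apply/andP; split; lra.
Qed.

(** The children of one word, here [j] times the letter 1, have diameters
    comparable with that of their parent, in which they are packed. *)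
Lemma branching_bounded w : (forall j, (2 <= m j)%N) ->
  (forall u, words_star m 0 u -> blo <= ratio J u w) ->
  forall j, (m j)%:R <= 2 * 2 ^+ d / (kappa * blo ^+ d).
Proof.
move=> hm hL j.
pose v := nseq j 1%N.
have vj : size v = j by rewrite size_nseq.
have wv : words m 0 v.
  by move=> i; rewrite size_nseq => ij; rewrite nth_nseq ij /= (leq_trans _ (hm _)).
have [x0 Jx0] := diam_gt0_nonempty (hJdiam w wv).
pose r := [seq rcons v k.+1 | k <- iota 0 (m j)].
have rP u : u \in r -> exists2 k, (k < m (size v))%N & u = rcons v k.+1.
  by move=> /mapP[k]; rewrite mem_iota add0n => /andP[_ km] ->; exists k => //; rewrite vj.
have -> : (m j)%:R = (size r)%:R :> R by rewrite size_map size_iota.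
apply: (@packing_count w x0 blo (diam (J v w)) r) => //.
- rewrite map_inj_uniq ?iota_uniq // => a b /(congr1 (last 0%N)).
  by rewrite !last_rcons => -[].
- exact: hJdiam.
- by move=> u /rP[k km ->]; exact: words_rcons.
- move=> u u' /rP[k km uE] /rP[k' km' u'E]; apply: contra => h.
  by apply/eqP; apply: prefix_same_size h; rewrite uE u'E !size_rcons.
- move=> u /rP[k km ->]; apply: box_of_diam => y Jy.
  apply: diam_ub => //; first by apply: ediam_fin; exact: hJdiam.
  exact: (hJsub wv _ Jy).
- move=> u /rP[k km ->]; rewrite diam_child // ler_wpM2r ?diam_ge0 //.
  by apply: hL; exact: words_star_rcons.
Qed.

Section fixed_outcome.
Variable X : seq nat -> T -> bool.
Variable w : T.
Hypothesis hL : forall u, words_star m 0 u -> blo <= ratio J u w <= bhi.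

Local Notation ch v k := (rcons v k.+1).
Local Notation dia v := (diam (J v w)).

(** * Positive content prevents cheap covers *)

Section frostman.
Variable s : R.
Hypothesis s0 : 0 < s.
Local Notation content := (content m (ratio J) X s).

Section cost.
Variables (V : nat -> set 'rV[R]_d) (r : nat -> R).
Hypothesis r0 : forall k, 0 < r k.
Hypothesis rV : forall k x y, V k x -> V k y -> eucl_norm (x - y) <= r k.

(** The pieces that meet the covering set [V k] and whose diameter has just
    dropped below [r k]: they replace [V k] by a bounded number of words. *)
Definition hit k x := [/\ words m 0 x, dia x <= r k, r k < dia (parent x) & J x w `&` V k !=set0].

Definition wt k : R := if V k == set0 then 0 else r k `^ s.

Definition Cpack : R := 2 * 2 ^+ d / (kappa * (blo / 2) ^+ d).

Lemma hit_star k x : hit k x -> words_star m 0 x.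
Proof.
move=> [wx h1 h2 _]; split => // x0; move: h1 h2; rewrite x0 /parent /=.
by move=> h1 /(le_lt_trans h1); rewrite ltxx.
Qed.

Lemma hit_lo k x : hit k x -> blo * r k <= dia x.
Proof.
move=> hx; have [wx h1 h2 _] := hx.
have [y [l [wy lm xE]]] := @words_starE m x (hit_star hx).
move: h2; rewrite xE parent_rcons diam_child // => h2.
apply: (@le_trans _ _ (blo * dia y)); first by rewrite ler_wpM2l ?(ltW h2) // ltW.
rewrite ler_wpM2r ?diam_ge0 //.
by have /andP[] := hL (words_star_rcons wy lm).
Qed.

Lemma dia_prefix u v : words m 0 v -> prefix u v -> dia v <= dia u.
Proof.
move=> wv /prefixP[y vE]; rewrite vE in wv *.
have [wu _] := @words_cat_inv m u y wv.
by apply: diamS; [exact: J_cat|exact: hJdiam].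
Qed.

Lemma hit_antichain k u v : hit k u -> hit k v -> u != v -> ~~ prefix u v.
Proof.
move=> hu hv uv; apply/negP => puv.
have [y [l [wy lm vE]]] := @words_starE m v (hit_star hv).
have [_ du _ _] := hu; have [_ _ dv _] := hv.
have puy : prefix u y.
  move: puv uv; rewrite vE => /prefixP[z zE]; case/lastP: z zE => [|z a].
    by rewrite cats0 => ->; rewrite eqxx.
  rewrite -rcons_cat => /rcons_inj[-> _] _; exact: prefix_prefix.
move: dv; rewrite vE parent_rcons => /lt_le_trans /(_ (dia_prefix wy puy)).
by rewrite ltNge du.
Qed.

(** Two such words are never comparable, and their pieces have diameter at least
    [blo * r k] inside a cube of half-side [2 * r k]. *)
Lemma hit_count k (l : seq (seq nat)) : uniq l -> (forall x, x \in l -> hit k x) ->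
  (size l)%:R <= (if V k == set0 then 0 else Cpack).
Proof.
move=> ul hl; case: eqP => [V0|/eqP/set0P[x0 Vx0]].
  case: l ul hl => // x l _ /(_ x (mem_head _ _))[_ _ _ [y []]].
  by rewrite V0.
have blo2 : 0 < blo / 2 by rewrite divr_gt0.
apply: (@packing_count w x0 (blo / 2) (2 * r k) l) => //.
- by rewrite mulr_gt0.
- by move=> u /hl[].
- by move=> u v /hl hu /hl hv; exact: hit_antichain hu hv.
- move=> u /hl [wu du _ [z [Jz Vz]]] y Jy i.
  have h1 : `|(y - z) ord0 i| <= r k.
    apply: le_trans (coord_le_eucl _ _) _; apply: le_trans du.
    by apply: diam_ub => //; apply: ediam_fin; exact: hJdiam.
  have h2 : `|(z - x0) ord0 i| <= r k.
    by apply: le_trans (coord_le_eucl _ _) _; exact: rV.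
  move: h1 h2; rewrite !mxE !ler_norml => /andP[a1 a2] /andP[a3 a4].
  by apply/andP; split; lra.
- move=> u /hl /hit_lo; rewrite mulrA (_ : blo / 2 * 2 = blo) //.
  by field.
Qed.

Lemma Cpack_ge0 : 0 <= Cpack.
Proof.
by rewrite divr_ge0 ?mulr_ge0 ?exprn_ge0 ?(ltW kappa0) ?divr_ge0 ?(ltW hblo).
Qed.

Definition price k x : \bar R := if `[< hit k x >] then (dia x `^ s)%:E else 0%E.

Lemma price_ge0 k x : (0 <= price k x)%E.
Proof. by rewrite /price; case: ifP; rewrite ?lee_fin ?powR_ge0. Qed.

(** The words hit at or below [v], priced by the power [s] of their diameters.
    Words are indexed together with the covering set that they meet, so that a
    word is counted once for each such set. *)
Definition cost v : \bar R :=
  (\esum_(p in [set: nat * seq nat]) if prefix v p.2 then price p.1 p.2 else 0)%E.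

Lemma cost_term_ge0 v (p : nat * seq nat) : (0 <= if prefix v p.2 then price p.1 p.2 else 0)%E.
Proof. by case: ifP => // _; exact: price_ge0. Qed.

Lemma price_sum k : (\esum_(x in [set: seq nat]) price k x <= (Cpack * wt k)%:E)%E.
Proof.
apply: ge_ereal_sup => _ [/= A [finA _] <-].
rewrite fsbig_finite //=.
set l := [seq x <- finmap.enum_fset (fset_set A) | `[< hit k x >]].
have ul : uniq l by apply: filter_uniq; exact: finmap.fset_uniq.
have hl x : x \in l -> hit k x by rewrite mem_filter => /andP[/asboolP].
apply: (@le_trans _ _ (\sum_(x <- l) (dia x `^ s)%:E)%E).
  by rewrite /l big_filter [leRHS]big_mkcond /=.
rewrite sumEFin lee_fin /wt.
apply: (@le_trans _ _ (\sum_(x <- l) r k `^ s)).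
  rewrite big_seq [leRHS]big_seq; apply: ler_sum => x /hl [_ dx _ _].
  by rewrite ge0_ler_powR ?nnegrE ?diam_ge0 // ltW.
rewrite big_const_seq count_predT iter_addr_0 -mulr_natl.
have := hit_count ul hl; case: ifP => _ h.
  by rewrite mulr0 mulr_le0_ge0 ?powR_ge0.
by rewrite ler_wpM2r ?powR_ge0.
Qed.

Lemma cost_total v : (cost v <= \sum_(0 <= k <oo) (Cpack * wt k)%:E)%E.
Proof.
apply: (@le_trans _ _ (\esum_(p in [set: nat * seq nat]) price p.1 p.2)%E).
  by apply: le_esum => p _; case: ifP => _; rewrite ?lexx ?price_ge0.
have -> : (\esum_(p in [set: nat * seq nat]) price p.1 p.2 =
   \esum_(k in [set: nat]) \esum_(x in [set: seq nat]) price k x)%E.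
  rewrite esum_esum; last by move=> *; exact: price_ge0.
  by congr esum; apply/seteqP; split.
rewrite nneseries_esumT; last first.
  move=> k; rewrite lee_fin mulr_ge0 ?Cpack_ge0 // /wt; case: ifP => // _; exact: powR_ge0.
by apply: le_esum => k _; exact: price_sum.
Qed.

Lemma cost_children v : (\sum_(k < m (size v)) cost (ch v k) <= cost v)%E.
Proof.
rewrite /cost -esum_sum; last by move=> p k _ _; exact: cost_term_ge0.
apply: le_esum => p _; case: ifPn => pv; last first.
  rewrite big1 // => k _; case: ifPn => // /prefix_rcons_inv[h _].
  by rewrite h in pv.
case: (pselect (exists k : 'I_(m (size v)), prefix (ch v k) p.2)) => [[k hk]|nk].
  rewrite (bigD1 k) //= hk big1 ?adde0 // => l lk; case: ifPn => // hl.
  have [/ord_inj lk'] := @prefix_rcons_inj _ _ _ _ hl hk.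
  by rewrite lk' eqxx in lk.
rewrite big1 ?price_ge0 // => k _; case: ifPn => // hk.
by case: nk; exists k.
Qed.

(** The hit words are too cheap to separate [v] from the boundary of the
    surviving tree below it. *)
Definition uncut v := forall N, (cost v < (content N v w * dia v `^ s)%:E)%E.

Lemma uncut_not_hit v k : uncut v -> ~ hit k v.
Proof.
move=> bv hv; have := bv 0%N; rewrite /= mul1r ltNge => /negP; apply.
apply: esum_ge; exists [set (k, v)]; first by split; [exact: finite_set1|].
by rewrite fsbig_set1 /= prefix_refl /price asboolT.
Qed.

Lemma content_antitone N N' v : (N <= N')%N -> content N' v w <= content N v w.
Proof.
elim: N' => [|N' IH]; first by rewrite leqn0 => /eqP ->.
rewrite leq_eqVlt => /orP[/eqP->//|]; rewrite ltnS => /IH; apply: le_trans.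
exact: content_decr.
Qed.

(** Otherwise each surviving child has a depth at which its content is paid by
    the cost of the hit words below it; the costs of the children add up to at
    most the cost of [v], and the largest of these depths, plus one, contradicts
    the choice of [v]. *)
Lemma uncut_child v : words m 0 v -> uncut v ->
  exists k, [/\ (k < m (size v))%N, X (ch v k) w & uncut (ch v k)].
Proof.
move=> wv bv; apply: contrapT => H.
have h (k : 'I_(m (size v))) : exists N, X (ch v k) w ->
    ((content N (ch v k) w * dia (ch v k) `^ s)%:E <= cost (ch v k))%E.
  case: (boolP (X (ch v k) w)) => Xk; last by exists 0%N.
  have : ~ uncut (ch v k) by move=> bk; apply: H; exists k.
  by move=> /existsNP[N /negP]; rewrite -leNgt => hN; exists N.
have [Nf hN] := choice h.
pose N := (\max_(k < m (size v)) Nf k)%N.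
have := bv N.+1; rewrite ltNge => /negP; apply.
apply: le_trans (cost_children v).
apply: (@le_trans _ _ (\sum_(k < m (size v)) (weight (ratio J) X s v k w * content N (ch v k) w * dia v `^ s)%:E)%E).
  rewrite sumEFin lee_fin -mulr_suml ler_wpM2r ?powR_ge0 //=.
  by rewrite ge_min lexx orbT.
apply: lee_sum => k _.
rewrite /weight; case: (boolP (X (ch v k) w)) => Xk; last first.
  by rewrite mul0r !mul0r; apply: esum_ge0 => p _; exact: cost_term_ge0.
rewrite mul1r; apply: le_trans (hN k Xk).
rewrite lee_fin mulrAC -powRM; last 2 first.
- by have /andP[+ _] := ratio_pos_le1 w (words_star_rcons wv (ltn_ord k)); exact: ltW.
- exact: diam_ge0.
rewrite -diam_child // mulrC ler_wpM2r ?powR_ge0 //.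
by apply: content_antitone; exact: leq_bigmax.
Qed.

(** Repeating the choice of a child. *)
Lemma uncut_path u : words m 0 u -> X u w -> uncut u ->
  exists zeta : nat -> nat, boundary_tau m X u w zeta /\
    forall n, uncut (mkseq zeta (size u + n)).
Proof.
move=> wu Xu bu.
pose Q v := [/\ words m 0 v, X v w & uncut v].
have next v : exists v', Q v -> Q v' /\ exists a, v' = rcons v a.
  case: (pselect (Q v)) => [[wv Xv bv]|nQ]; last by exists v.
  have [k [km Xk bk]] := uncut_child wv bv.
  exists (ch v k) => _; split; last by exists k.+1.
  by split => //; exact: (@words_rcons m v k).
have [f hf] := choice next.
(* The words [p n] extend each other; [zeta] reads their letters. *)
pose p n := iter n f u.
have Qp n : Q (p n).
  elim: n => [|n IH]; first exact: (And3 wu Xu bu).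
  by have [] := hf _ IH.
have pS n : exists a, p n.+1 = rcons (p n) a by have [] := hf _ (Qp n).
have sp n : size (p n) = (size u + n)%N.
  elim: n => [|n IH]; first by rewrite addn0.
  by have [a ->] := pS n; rewrite size_rcons IH addnS.
have nthS n n' i : (n <= n')%N -> (i < size u + n)%N -> nth 0%N (p n') i = nth 0%N (p n) i.
  elim: n' => [|n' IH]; first by rewrite leqn0 => /eqP ->.
  rewrite leq_eqVlt => /orP[/eqP->//|]; rewrite ltnS => nn' iu.
  have [a ->] := pS n'; rewrite nth_rcons sp (leq_trans iu) ?leq_add2l //.
  exact: IH.
pose zeta i := nth 0%N (p i.+1) i.
have mk n : mkseq zeta (size u + n) = p n.
  apply: (@eq_from_nth _ 0%N); first by rewrite size_mkseq sp.
  move=> i; rewrite size_mkseq => iu; rewrite nth_mkseq // /zeta.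
  case: (leqP n i.+1) => ni.
    by apply: nthS.
  apply/esym/nthS; first exact: ltnW.
  by rewrite addnS ltnS leq_addl.
exists zeta; split => [j uj|n]; last by rewrite mk; case: (Qp n).
have jE : j = (size u + (j - size u))%N by rewrite subnKC.
have pre n : exists y, p n = u ++ y.
  elim: n => [|n [y IH]]; first by exists [::]; rewrite cats0.
  by have [a ->] := pS n; exists (rcons y a); rewrite IH rcons_cat.
rewrite jE mk; set n := (j - size u)%N.
split.
  have [y yE] := pre n; exists y; last by rewrite yE.
  by have [] := Qp n; rewrite yE => /(@words_cat_inv m u y)[].
move=> i /andP[ui]; rewrite sp => iun.
have iE : i = (size u + (i - size u))%N by rewrite subnKC.
have -> : take i (p n) = p (i - size u)%N.
  apply: (@eq_from_nth _ 0%N).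
    by rewrite size_takel ?sp // -iE.
  move=> l; rewrite size_takel ?sp // => li.
  rewrite nth_take //; apply: nthS; last by rewrite -iE.
  by rewrite leq_subLR.
by case: (Qp (i - size u)%N).
Qed.
End cost.
End frostman.

Lemma dia_decay u y : words m 0 (u ++ y) -> dia (u ++ y) <= bhi ^+ size y * dia u.
Proof.
elim/last_ind: y => [|y a IH]; first by rewrite cats0 expr0 mul1r.
rewrite -rcons_cat => /words_rcons_inv[wuy [k km ->]].
rewrite diam_child // size_rcons exprS -mulrA.
have /andP[h1 h2] := hL (words_star_rcons wuy km).
apply: ler_pM => //; first by rewrite (le_trans _ h1) // ltW.
  exact: diam_ge0.
exact: IH.
Qed.

Lemma bhi_pow_small (c eta : R) : 0 < eta -> exists n, bhi ^+ n * c < eta.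
Proof.
move=> eta0; have b0 : 0 < bhi := lt_le_trans hblo hbeta.
have /cvgrPdist_lt /(_ (eta / (`|c| + 1))) : (fun n => bhi ^+ n) n @[n --> \oo] --> (0 : R).
  by apply: cvg_expr; rewrite ger0_norm // ltW.
have c0 : 0 < `|c| + 1 by rewrite ltr_wpDl.
move=> /(_ (divr_gt0 eta0 c0))[n _ /(_ n (leqnn n))].
rewrite /= sub0r normrN ger0_norm ?exprn_ge0 ?(ltW b0) // ltr_pdivlMr // => h.
exists n; apply: le_lt_trans h; rewrite ler_wpM2l ?exprn_ge0 ?(ltW b0) //.
by rewrite (le_trans (ler_norm c)) // lerDl.
Qed.

Lemma words_mkseq zeta j : (forall i, (j <= i)%N -> words m 0 (mkseq zeta i)) ->
  forall i, words m 0 (mkseq zeta i).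
Proof.
move=> h i; case: (leqP j i) => [|/ltnW ij]; first exact: h.
have := h j (leqnn j); rewrite (_ : mkseq zeta j = mkseq zeta i ++ drop i (mkseq zeta j)).
  by move=> /(@words_cat_inv m _ _)[].
rewrite -[LHS](cat_take_drop i); congr (_ ++ _).
by rewrite /mkseq -map_take take_iota; congr (map _ (iota _ _)); apply/minn_idPl.
Qed.

Lemma J_mkseq_anti zeta i j : (forall i, words m 0 (mkseq zeta i)) -> (i <= j)%N ->
  J (mkseq zeta j) w `<=` J (mkseq zeta i) w.
Proof.
move=> wz ij; rewrite (_ : mkseq zeta j = mkseq zeta i ++ drop i (mkseq zeta j)); last first.
  rewrite -[LHS](cat_take_drop i); congr (_ ++ _).
  by rewrite /mkseq -map_take take_iota; congr (map _ (iota _ _)); apply/minn_idPl.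
apply: J_cat; rewrite (_ : mkseq zeta i ++ _ = mkseq zeta j) //.
rewrite -[RHS](cat_take_drop i); congr (_ ++ _).
by rewrite /mkseq -map_take take_iota; congr (map _ (iota _ _)); apply/esym/minn_idPl.
Qed.

(** Compactness gives a point, and the geometric decay of the diameters makes it
    unique. *)
Lemma nested_limit_point zeta : (forall i, words m 0 (mkseq zeta i)) ->
  exists x, nested_limit J zeta w = [set x].
Proof.
move=> wz.
have [x hx] : nested_limit J zeta w !=set0.
  have c0 := @hJcompact _ w (wz 0%N); rewrite compact_In0 in c0.
  apply: (c0 nat [set j | (1 <= j)%N] (fun j => J (mkseq zeta j) w)).
    exists (fun j => J (mkseq zeta j) w) => j _.
      by apply: compact_closed; [exact: norm_hausdorff|exact: hJcompact].
    by rewrite setIidr //; exact: J_mkseq_anti.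
  move=> D' _; pose n := (\max_(j <- finmap.enum_fset D') j)%N.
  have [x Jx] := diam_gt0_nonempty (hJdiam w (wz n)).
  exists x => j /= jD; apply: J_mkseq_anti Jx => //.
  by apply: leq_bigmax_seq.
exists x; apply/seteqP; split => [y hy|y -> //].
rewrite /= -[LHS](subrK x) (_ : y - x = 0) ?add0r //.
apply: eucl_eq0; rewrite leNgt; apply/negP => e0.
have [n hn] := bhi_pow_small (dia [::]) e0.
have := @dia_decay [::] (mkseq zeta n.+1) (wz n.+1); rewrite cat0s size_mkseq => hd'.
have h1 : eucl_norm (y - x) <= dia (mkseq zeta n.+1).
  by apply: diam_ub; [apply: ediam_fin; exact: hJdiam|exact: hy|exact: hx].
have b0 : 0 <= bhi := ltW (lt_le_trans hblo hbeta).
have h2 : bhi ^+ n.+1 * dia [::] <= bhi ^+ n * dia [::].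
  by rewrite ler_wpM2r ?diam_ge0 // exprS ler_piMl ?exprn_ge0 // ltW.
by have := le_lt_trans (le_trans h1 (le_trans hd' h2)) hn; rewrite ltxx.
Qed.

Lemma nested_limit_mem zeta x : (forall i, words m 0 (mkseq zeta i)) ->
  nested_limit J zeta w = [set x] -> forall i, J (mkseq zeta i) w x.
Proof.
move=> wz hx i.
have x1 : nested_limit J zeta w x by rewrite hx.
by apply: (@J_mkseq_anti zeta i i.+1) => //; exact: x1.
Qed.

Lemma boundary_words u zeta : words m 0 u -> boundary_tau m X u w zeta ->
  forall i, words m 0 (mkseq zeta i).
Proof.
move=> wu hz; apply: (@words_mkseq zeta (size u)) => i ui.
by have [[y wy <-] _] := hz i ui; exact: (@words_cat m u y).
Qed.

(** If the measure vanished, there would be covers [V] of arbitrarily small total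
    gauge. The total cost of the words that they hit is then small ([cost_total]),
    whereas the content of [u] is bounded below; so some surviving path
    avoids all hit words. Its limit point lies in a covering set [V k], and the
    first piece of the path whose diameter is at most [r k] is then hit: a
    contradiction. *)
Lemma frostman_lower (s t : R) u E : 0 < s -> 0 <= t <= s -> words m 0 u -> X u w ->
  charged m (ratio J) X s u w -> K m J X u w `<=` E ->
  hausdorff_measure t E <> 0%E.
Proof.
move=> s0 /andP[t0 ts] wu Xu [i0 hc] KE H0.
have du0 : 0 < dia u := hJdiam w wu.
(* A diameter at most 1 makes the gauge of exponent [s] smaller than that of
   exponent [t]; one at most [dia u / 2] places the hit words strictly below [u]. *)
pose Delta : R := Num.min 1 (dia u / 2).
have D0 : 0 < Delta by rewrite lt_min ltr01 divr_gt0.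
have pre0 : hausdorff_premeasure t Delta E = 0%E.
  apply/eqP; rewrite eq_le; apply/andP; split.
    by rewrite -H0; apply: ereal_sup_ubound; exists Delta.
  apply: le_ereal_inf_tmp => _ [V _ <-]; apply: nneseries_ge0 => k _ _.
  by rewrite lee_fin /gauge; case: ifP => // _; exact: powR_ge0.
pose eta : R := i0.+1%:R^-1 * dia u `^ s / (2 * (Cpack + 1)) / 2.
have Cp1 : 0 < Cpack + 1 by rewrite ltr_wpDl // Cpack_ge0.
have c0 : 0 < i0.+1%:R^-1 * dia u `^ s by rewrite mulr_gt0 ?powR_gt0 // invr_gt0.
have eta0 : 0 < eta by rewrite /eta !divr_gt0 // mulr_gt0.
have [_ [V [EV dV] <-] hV] : exists2 y, [set (\sum_(0 <= k <oo) (gauge t (V k))%:E)%E |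
    V in [set V : nat -> set 'rV[R]_d |
            E `<=` \bigcup_k V k /\ forall k, (ediam (V k) <= Delta%:E)%E]] y & (y < eta%:E)%E.
  by apply: ereal_inf_lt; rewrite -/(hausdorff_premeasure t Delta E) pre0 lte_fin.
pose th : R := Num.min eta (Delta `^ s).
have th0 : 0 < th by rewrite lt_min eta0 powR_gt0.
(* The diameters of the covering sets may vanish; enlarged to at least [eps k],
   they become admissible scales at a total extra cost of at most [eta]. *)
pose eps k : R := (th / (2 ^ k.+1)%:R) `^ (s^-1).
have epss k : eps k `^ s = th / (2 ^ k.+1)%:R.
  rewrite /eps -powRrM mulVf ?gt_eqF // powRr1 // divr_ge0 // ltW //.
have eps0 k : 0 < eps k by rewrite powR_gt0 // divr_gt0 // ltr0n expn_gt0.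
have epsD k : eps k <= Delta.
  have : (eps k `^ s) `^ s^-1 <= (Delta `^ s) `^ s^-1.
    rewrite ge0_ler_powR ?invr_ge0 ?(ltW s0) ?nnegrE ?powR_ge0 // epss.
    rewrite ler_pdivrMr ?ltr0n ?expn_gt0 //.
    apply: (@le_trans _ _ (Delta `^ s)); first by rewrite /th ge_min lexx orbT.
    by rewrite ler_peMr ?powR_ge0 // ler1n expn_gt0.
  by rewrite -(powRrM (eps k)) -(powRrM Delta) divff ?gt_eqF // (powRr1 (ltW D0)) (powRr1 (ltW (eps0 k))).
pose r k : R := Num.max (diam (V k)) (eps k).
have r0 k : 0 < r k by rewrite /r lt_max eps0 orbT.
have eV k : ediam (V k) = (diam (V k))%:E by apply: ediam_fin_le; exact: dV.
have dVD k : diam (V k) <= Delta by rewrite -lee_fin -eV.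
have rD k : r k <= Delta by rewrite ge_max dVD epsD.
have rV k x y : V k x -> V k y -> eucl_norm (x - y) <= r k.
  by move=> Vx Vy; rewrite le_max (diam_ub (eV k) Vx Vy).
have wtle k : wt s V r k <= gauge t (V k) + eps k `^ s.
  rewrite /wt /gauge; case: ifP => _; first by rewrite add0r powR_ge0.
  rewrite /r; case: (leP (diam (V k)) (eps k)) => h.
    by rewrite lerDr powR_ge0.
  rewrite -[leLHS]addr0; apply: lerD; last exact: powR_ge0.
  apply: ger_powR => //; rewrite (lt_trans (eps0 k) h) /=.
  by apply: le_trans (dVD k) _; rewrite ge_min lexx.
have Cg : (\sum_(0 <= k <oo) (Cpack * wt s V r k)%:E <= (Cpack * (2 * eta))%:E)%E.
  have wt0 k : 0 <= wt s V r k by rewrite /wt; case: ifP => // _; exact: powR_ge0.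
  under eq_eseriesr do rewrite EFinM.
  rewrite nneseriesZl; last by move=> k _; rewrite lee_fin.
  rewrite (EFinM Cpack (2 * eta)); apply: lee_wpmul2l; first by rewrite lee_fin Cpack_ge0.
  apply: (@le_trans _ _ (\sum_(0 <= k <oo) ((gauge t (V k))%:E + (eta / (2 ^ k.+1)%:R)%:E))%E).
    apply: lee_nneseries => k _; first by rewrite lee_fin.
    rewrite -EFinD lee_fin; apply: le_trans (wtle k) _; rewrite lerD2l epss.
    by rewrite ler_wpM2r ?invr_ge0 // /th ge_min lexx.
  apply: (le_trans (epsilon_trick xpredT _ (ltW eta0))).
    by move=> k; rewrite lee_fin /gauge; case: ifP => // _; exact: powR_ge0.
  rewrite (_ : 2 * eta = eta + eta); last by ring.
  by rewrite EFinD leeD2r // ltW.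
have bu : uncut s V r u.
  move=> N; apply: (le_lt_trans (le_trans (cost_total s0 r0 rV u) Cg)); rewrite lte_fin.
  apply: (@lt_le_trans _ _ (i0.+1%:R^-1 * dia u `^ s)); last by rewrite ler_wpM2r ?powR_ge0.
  rewrite /eta; set z := _ * dia u `^ s in c0 *.
  rewrite (_ : Cpack * _ = z / 2 * (Cpack / (Cpack + 1))); last by field; rewrite gt_eqF.
  have : Cpack / (Cpack + 1) <= 1 by rewrite ler_pdivrMr // mul1r lerDl.
  move=> /(ler_wpM2l (ltW (divr_gt0 c0 (ltr0Sn _ 1)))); rewrite mulr1 => h.
  apply: le_lt_trans h _; lra.
have [zeta [hz bz]] := uncut_path wu Xu bu.
have wz := boundary_words wu hz.
have [x hx] := nested_limit_point wz.
have xJ := nested_limit_mem wz hx.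
have Kx : K m J X u w x by exists zeta.
have [k _ Vx] := EV x (KE x Kx).
have exn : exists n, dia (mkseq zeta (size u + n)) <= r k.
  have [n hn] := bhi_pow_small (dia u) (r0 k).
  exists n; have wn := wz (size u + n)%N.
  have [[y wy yE] _] := hz (size u + n)%N (leq_addr _ _).
  rewrite -yE; apply: ltW; apply: le_lt_trans hn.
  have := @dia_decay u y; rewrite yE => /(_ wn).
  suff -> : size y = n by [].
  have := congr1 size yE; rewrite size_cat size_mkseq => /eqP.
  by rewrite eqn_add2l => /eqP.
(* The first piece of the path at scale [r k]. *)
case: (ex_minnP exn) => -[|n] hn nmin.
  move: hn; rewrite addn0.
  have -> : mkseq zeta (size u) = u.
    have [[y wy yE] _] := hz (size u) (leqnn _).
    have y0 : y = [::].
      apply/size0nil; have := congr1 size yE; rewrite size_cat size_mkseq => /eqP.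
      by rewrite -[X in _ == X]addn0 eqn_add2l => /eqP.
    by rewrite -yE y0 cats0.
  move=> h; have := le_trans h (le_trans (rD k) _) => /(_ (dia u / 2)).
  by rewrite ge_min lexx orbT => /(_ isT); lra.
apply: (uncut_not_hit (bz n.+1) (k := k)); split => //.
- have -> : parent (mkseq zeta (size u + n.+1)) = mkseq zeta (size u + n).
    by rewrite addnS /mkseq -addn1 iotaD map_cat /= cats1 parent_rcons.
  by rewrite ltNge; apply/negP => h; have := nmin n h; rewrite ltnn.
- by exists x.
Qed.

(** * Covering by the surviving pieces *)

Fixpoint survivors N v : seq (seq nat) := if N is N'.+1 then
  flatten [seq (if X (ch v k) w then survivors N' (ch v k) else [::]) | k <- iota 0 (m (size v))]
  else [:: v].

Local Notation umass s := (mass m (ratio J) X s (fun=> 1)).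

(** The diameter of a descendant is that of [v] times the ratios along the path. *)
Lemma mass_survivors (s : R) N v : words m 0 v ->
  \sum_(x <- survivors N v) dia x `^ s = dia v `^ s * umass s N v w.
Proof.
elim: N v => [|N IH] v wv /=; first by rewrite big_seq1 mulr1.
rewrite big_flatten big_map mul1r mulr_sumr -{1}(subn0 (m (size v))) big_mkord.
apply: eq_bigr => k _; rewrite /weight.
have wk := words_star_rcons wv (ltn_ord k).
case: (X (ch v k) w); last by rewrite big_nil !mul0r mulr0.
rewrite mul1r IH; last by case: wk.
have r0 : 0 <= ratio J (ch v k) w by have /andP[/ltW] := ratio_pos_le1 w wk.
by rewrite (diam_child w wv (ltn_ord k)) (powRM _ r0 (diam_ge0 _)) mulrCA mulrA.
Qed.

Lemma survivors_words N v x : words m 0 v -> x \in survivors N v -> words m 0 x.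
Proof.
elim: N v => [|N IH] v wv /=; first by rewrite inE => /eqP ->.
move=> /flatten_mapP[k]; rewrite mem_iota add0n => /andP[_ km].
by case: ifP => // _; apply: IH; case: (words_star_rcons wv km).
Qed.

Lemma mem_survivors v y : words m 0 (v ++ y) ->
  (forall j, (size v < j <= size (v ++ y))%N -> X (take j (v ++ y)) w) ->
  v ++ y \in survivors (size y) v.
Proof.
elim: y v => [|a y IH] v; first by rewrite cats0 mem_head.
rewrite -cat_rcons => wvy hX /=.
have [wva _] := @words_cat_inv m _ _ wvy.
have [wv [k km aE]] := @words_rcons_inv m v a wva.
apply/flatten_mapP; exists k; first by rewrite mem_iota add0n.
rewrite -aE; have -> : X (rcons v a) w.
  have := hX (size v).+1; rewrite -(size_rcons v a) take_size_cat //; apply.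
  by rewrite size_cat size_rcons leqnn leq_addr.
apply: IH => // j /andP[hj1 hj2]; apply: hX; rewrite hj2 andbT.
by rewrite size_rcons in hj1; exact: ltnW.
Qed.

Lemma boundary_survivors u zeta N : words m 0 u -> boundary_tau m X u w zeta ->
  mkseq zeta (size u + N) \in survivors N u.
Proof.
move=> wu hz.
have [[y wy yE] hX] := hz (size u + N)%N (leq_addr _ _).
have sy : size y = N.
  by have := congr1 size yE; rewrite size_cat size_mkseq => /eqP; rewrite eqn_add2l => /eqP.
rewrite -yE -sy; apply: mem_survivors.
  by rewrite yE; apply: (boundary_words wu hz).
move=> j /andP[j1 j2]; rewrite yE; apply: hX; rewrite (ltnW j1) /=.
by rewrite -yE.
Qed.

Lemma boundary_X u zeta : boundary_tau m X u w zeta -> X u w.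
Proof.
move=> hz; have [[y wy yE] hX] := hz (size u) (leqnn _).
have := hX (size u); rewrite leqnn size_mkseq leqnn => /(_ isT).
by rewrite -yE take_size_cat.
Qed.

Lemma K_nonempty u : words m 0 u -> K m J X u w !=set0 -> X u w /\
  forall N, survivors N u <> [::].
Proof.
move=> wu [x [zeta hz _]]; split; first exact: boundary_X hz.
by move=> N lN; have := boundary_survivors N wu hz; rewrite lN.
Qed.

(** With exponent 0 the mass is the number of survivors. *)
Lemma K_empty u N : words m 0 u -> umass 0 N u w < 1 -> K m J X u w = set0.
Proof.
move=> wu h; apply/eqP; rewrite -[_ == _]negbK; apply/negP => /set0P /(K_nonempty wu)[_ /(_ N) nl].
have := mass_survivors 0 N wu; rewrite powRr0 mul1r => e; move: h; rewrite -e.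
rewrite (eq_bigr (fun=> 1)); last by move=> x _; rewrite powRr0.
rewrite big_const_seq count_predT iter_addr_0.
case: (survivors N u) nl => // x l _ /=.
by rewrite ltrn1.
Qed.

(** The surviving pieces of one generation cover the set; a small total also makes
    each of them small, because the exponent is positive. *)
Lemma K_cover (s : R) u (delta eta : R) : 0 < s -> words m 0 u ->
  (X u w -> forall eta, 0 < eta -> exists N, umass s N u w < eta) ->
  0 < delta -> 0 < eta ->
  exists l : seq (set 'rV[R]_d), [/\ K m J X u w `<=` [set x | exists2 V, List.In V l & V x],
    (forall V, List.In V l -> (ediam V <= delta%:E)%E) &
    \sum_(V <- l) gauge s V <= eta].
Proof.
move=> s0 wu hm d0 e0.
case: (pselect (K m J X u w !=set0)) => [Kn|nK]; last first.
  exists [::]; split => //; last by rewrite big_nil ltW.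
  by move=> x Kx; case: nK; exists x.
have [Xu _] := K_nonempty wu Kn.
pose eta' := Num.min eta (delta `^ s) / (dia u `^ s).
have du : 0 < dia u `^ s by rewrite powR_gt0 // hJdiam.
have [|N hN] := hm Xu eta'.
  by rewrite divr_gt0 // lt_min e0 powR_gt0.
have lE := mass_survivors s N wu.
have lt_l : \sum_(x <- survivors N u) dia x `^ s < Num.min eta (delta `^ s).
  by rewrite lE mulrC -ltr_pdivlMr.
exists [seq J x w | x <- survivors N u]; split.
- move=> x [zeta hz hx].
  have wz := boundary_words wu hz.
  exists (J (mkseq zeta (size u + N)) w); last exact: nested_limit_mem wz hx _.
  have := boundary_survivors N wu hz.
  elim: (survivors N u) => // y l IH; rewrite inE => /orP[/eqP->|/IH]; by [left|right].
- move=> V VI.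
  have [x xl ->] : exists2 x, x \in survivors N u & V = J x w.
    move: VI; elim: (survivors N u) => //= y l IH [<-|/IH[x xl ->]].
      by exists y => //; rewrite mem_head.
    by exists x => //; rewrite inE xl orbT.
  have wx := survivors_words wu xl.
  rewrite ediam_fin ?hJdiam // lee_fin.
  have : dia x `^ s <= delta `^ s.
    apply: (@le_trans _ _ (\sum_(x <- survivors N u) dia x `^ s)).
      rewrite (big_rem x xl) /= lerDl; apply: sumr_ge0 => y _; exact: powR_ge0.
    by apply: (le_trans (ltW lt_l)); rewrite ge_min lexx orbT.
  move=> h; rewrite leNgt; apply/negP => h'.
  have := @gt0_ltr_powR R s s0 delta (dia x); rewrite !nnegrE diam_ge0 (ltW d0) => /(_ isT isT h').
  by rewrite ltNge h.
- rewrite big_map; apply: (@le_trans _ _ (\sum_(x <- survivors N u) dia x `^ s)).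
    by apply: ler_sum => x _; rewrite /gauge; case: (J x w == set0); [exact: powR_ge0|exact: lexx].
  by apply: (le_trans (ltW lt_l)); rewrite ge_min lexx.
Qed.

(** The sets of the countable union are covered with errors in geometric
    progression. *)
Lemma Theta_null (s : R) : 0 < s ->
  (forall u, words m 0 u -> X u w -> forall eta, 0 < eta -> exists N, umass s N u w < eta) ->
  hausdorff_measure s (Theta m J X w) = 0%E.
Proof.
move=> s0 hm.
have g0 V : 0 <= gauge s V :> R by rewrite /gauge; case: ifP => // _; exact: powR_ge0.
have pre_ge0 delta : (0 <= hausdorff_premeasure s delta (Theta m J X w))%E.
  apply: le_ereal_inf_tmp => _ [V _ <-]; apply: nneseries_ge0 => k _ _.
  by rewrite lee_fin.
apply/eqP; rewrite eq_le; apply/andP; split; last first.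
  apply: (@le_trans _ _ (hausdorff_premeasure s 1 (Theta m J X w))) => //.
  by apply: ereal_sup_ubound; exists 1 => //=; exact: ltr01.
apply: ge_ereal_sup => _ [delta /= d0 <-].
apply/lee_addgt0Pr => eta e0; rewrite add0e.
have H i : exists l : seq (set 'rV[R]_d),
   [/\ (forall u, pickle_inv i = Some u -> words m 0 u ->
          K m J X u w `<=` [set x | exists2 V, List.In V l & V x]),
    (forall V, List.In V l -> (ediam V <= delta%:E)%E) &
    \sum_(V <- l) gauge s V <= eta / (2 ^ i.+1)%:R].
  have ei : 0 < eta / (2 ^ i.+1)%:R by rewrite divr_gt0 // ltr0n expn_gt0.
  have nil : \sum_(V <- ([::] : seq (set 'rV[R]_d))) gauge s V <= eta / (2 ^ i.+1)%:R :> R.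
    by rewrite big_nil ltW.
  case E : (pickle_inv i) => [u|]; last by exists [::]; split.
  case: (pselect (words m 0 u)) => wu; last first.
    by exists [::]; split => // u' [<-].
  have [l [l1 l2 l3]] := K_cover s0 wu (hm u wu) d0 ei.
  by exists l; split => // u' [<-].
have [l hl] := choice H.
pose V k := oapp (fun p : nat * nat => nth set0 (l p.1) p.2) set0 (pickle_inv k).
have gs0 : gauge s (set0 : set 'rV[R]_d) = 0 by rewrite /gauge eqxx.
apply: ge_ereal_inf; exists (\sum_(0 <= k <oo) (gauge s (V k))%:E)%E.
  exists V => //; split.
    move=> x [u wu Kx].
    have [h1 _ _] := hl (pickle u).
    have [V' V'l V'x] := h1 u (pickleK_inv u) wu x Kx.
    have nthIn (A : Type) (a0 a : A) l' : List.In a l' -> exists j, nth a0 l' j = a.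
      elim: l' => //= y l' IH [->|/IH[j hj]]; first by exists 0%N.
      by exists j.+1.
    have [j hj] := nthIn _ set0 V' _ V'l.
    exists (pickle (pickle u, j)); first exact: I.
    by rewrite /V pickleK_inv /oapp -[(_, _).1]/(pickle u) -[(_, _).2]/j hj.
  have s0d : (ediam (set0 : set 'rV[R]_d) <= delta%:E)%E.
    by rewrite /ediam ge_max lee_fin (ltW d0) /=; apply: ge_ereal_sup => _ [x []].
  move=> k; rewrite /V; case: (pickle_inv k) => [[i j]|] //=.
  have [_ h2 _] := hl i.
  case: (ltnP j (size (l i))) => ji; last by rewrite nth_default.
  apply: h2; elim: (l i) j ji => // y l' IH [|j] ji /=; first by left.
  by right; apply: IH.
rewrite (eq_eseriesr (g := fun k => oapp (fun p : nat * nat => (gauge s (nth set0 (l p.1) p.2))%:E) 0%E (pickle_inv k))); last first.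
  by move=> k _; rewrite /V; case: (pickle_inv k) => //=; rewrite gs0.
rewrite (@nneseries_pair _ (fun i j => (gauge s (nth set0 (l i) j))%:E)); last first.
  by move=> i j; rewrite lee_fin.
apply: (@le_trans _ _ (\sum_(0 <= i <oo) (eta / (2 ^ i.+1)%:R)%:E)%E); last first.
  exact: epsilon_trick0 (ltW e0).
apply: lee_nneseries => i _.
  by move=> _; apply: nneseries_ge0 => j _ _; rewrite lee_fin.
rewrite (@nneseries_nth _ _ set0 (l i) (fun V => (gauge s V)%:E)); last 2 first.
- by rewrite gs0.
- by move=> V'; rewrite lee_fin.
by rewrite sumEFin lee_fin; have [_ _] := hl i.
Qed.

End fixed_outcome.
End nested.

(** * Almost sure statements *)

Section almost_sure.
Context {R : realType} {disp : measure_display} {T : measurableType disp}.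
Variable P : probability T R.

Lemma ae_countable (I : countType) (Q : I -> T -> Prop) :
  (forall i, {ae P, forall w, Q i w}) -> {ae P, forall w, forall i, Q i w}.
Proof.
move=> h.
have : {ae P, forall w, forall n, if pickle_inv n is Some i then Q i w else True}.
  by apply: ae_foralln => n; case: (pickle_inv n) => [i|]; [exact: h|exact: aeW].
apply: filterS => w hw i; have := hw (pickle i); by rewrite pickleK_inv.
Qed.

Lemma ae_exists (Q : T -> Prop) : {ae P, forall w, Q w} -> exists w, Q w.
Proof.
move=> [A [mA A0 QA]]; apply: contrapT => /forallNP h.
have AT : A = setT by apply/seteqP; split => // w _; exact/QA/h.
have PT : P [set: T] = 1%E by exact: probability_setT.
have : P [set: T] = 0%E by rewrite -AT.
by rewrite PT => /eqP; rewrite onee_eq0.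
Qed.

Variable m : nat -> nat.
Variables (blo bhi : R).
Variable mu : forall j, probability ((m j).-tuple R) R.
Hypothesis hmu : forall j, mu j (cube blo bhi) = 1%E.
Variable L : seq nat -> T -> R.
Hypothesis hLmeas : forall u, words_star m 0 u -> measurable_fun setT (L u).
Hypothesis hLlaw : forall u, words m 0 u ->
       has_law P (children m L u) (mu (size u)).

Lemma cube_compl j : mu j (~` cube blo bhi) = 0%E.
Proof.
by rewrite probability_setC ?hmu ?subee //; exact: measurable_cube.
Qed.

Lemma ae_ratio_bounds :
  {ae P, forall w, forall u, words_star m 0 u -> blo <= L u w <= bhi}.
Proof.
have h v : {ae P, forall w, words m 0 v -> children m L v w \in cube blo bhi}.
  case: (pselect (words m 0 v)) => wv; last by apply: aeW.
  have mv := @measurable_childrenL _ _ _ m L hLmeas v wv.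
  exists (children m L v @^-1` (~` cube blo bhi)); split.
  - rewrite -[X in measurable X]setTI; apply: mv => //.
    by apply: measurableC; exact: measurable_cube.
  - by rewrite hLlaw; [exact: cube_compl|exact: wv|apply: measurableC; exact: measurable_cube].
  - by move=> w /= nh hc; apply: nh => _; rewrite inE.
have := ae_countable h; apply: filterS => w hw u wu.
have [y [k [wy km ->]]] := @words_starE m u wu.
have := hw y wy; rewrite inE => /(_ (Ordinal km)).
by rewrite (tnth_nth 0) nth_children.
Qed.

(** Change of variables, the ratios lying in the cube almost surely. *)
Lemma law_moment (s : R) v k (km : (k < m (size v))%N) : words m 0 v ->
  expect P (fun w => L (rcons v k.+1) w `^ s) = emom blo bhi mu s (Ordinal km).
Proof.
move=> wv; set j := size v in km *.
have mphi := @measurable_childrenL _ _ _ m L hLmeas v wv.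
pose f (l : (m j).-tuple R) : \bar R := (tnth l (Ordinal km) `^ s)%:E.
have mf : measurable_fun setT f by apply/measurable_EFinP; exact: measurable_tnth_powR.
have f0 l : (0 <= f l)%E by rewrite lee_fin powR_ge0.
transitivity (\int[P]_w (f \o children m L v) w)%E.
  by apply: eq_integral => w _; rewrite /f /= (tnth_nth 0) nth_children.
have := @ge0_integral_pushforward _ _ _ _ _ _ mphi P setT f measurableT mf (fun y _ => f0 y).
rewrite preimage_setT => <-.
rewrite (@eq_measure_integral _ _ _ _ (mu j)); last first.
  by move=> A mA _; rewrite /pushforward; exact: hLlaw.
rewrite /emom (@ge0_negligible_integral _ _ _ (mu j) setT (~` cube blo bhi)) //.
- by rewrite setTD setCK.
- by apply: measurableC; exact: measurable_cube.
- exact: cube_compl.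
Qed.

End almost_sure.

(** * The dichotomy *)

Section main.
Context (R : realType) (disp : measure_display) (T : measurableType disp).
Variables (P : probability T R) (d : nat).
Hypothesis hd : (1 <= d)%N.
Variable m : nat -> nat.
Hypothesis hm : forall j, (2 <= m j)%N.
Variables (blo bhi : R).
Hypotheses (hblo : 0 < blo) (hbeta : blo <= bhi) (hbhi : bhi < 1).
Variable mu : forall j, probability ((m j).-tuple R) R.
Hypothesis hmu : forall j, mu j (cube blo bhi) = 1%E.
Variable nu : bool -> forall j, probability ((m j).-tuple bool) R.
Variable J : seq nat -> T -> set 'rV[R]_d.
Hypothesis hJcompact : forall u w, words m 0 u -> compact (J u w).
Hypothesis hJdiam : forall u w, words m 0 u -> 0 < diam (J u w).
Hypothesis hJsub : forall u w k, words m 0 u -> (1 <= k <= m (size u))%N ->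
       J (rcons u k) w `<=` J u w.
Hypothesis hJdisj : forall u w k k', words m 0 u ->
       (1 <= k <= m (size u))%N -> (1 <= k' <= m (size u))%N -> k != k' ->
       (J (rcons u k) w)° `&` (J (rcons u k') w)° = set0.
Variable kappa : R.
Hypothesis kappa0 : 0 < kappa.
Hypothesis hJvol : forall u w, words m 0 u ->
         ((kappa * diam (J u w) ^+ d)%:E <= lebesgue_vol ((J u w)°))%E.
Hypothesis hLmeas : forall u, words_star m 0 u -> measurable_fun setT (ratio J u).
Hypothesis hLlaw : forall u, words m 0 u ->
       has_law P (children m (ratio J) u) (mu (size u)).
Hypothesis hLindep : mutually_independent P (words m 0) (fun u =>
       preimage_set_system setT (children m (ratio J) u) measurable).
Variable X : seq nat -> T -> bool.
Hypothesis hXmeas : forall u, words m 0 u -> measurable_fun setT (X u).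
Hypothesis hXL : independent2 P (sigma_of (words m 0) X)
                          (sigma_of (words_star m 0) (ratio J)).
Hypothesis hXmarkov : forall u (A : set ((m (size u)).-tuple bool)), words m 0 u ->
       is_cond_prob P (children m X u @^-1` A)
         (sigma_of (words m 0 `\` subtree_star m u) X)
         (fun w => nu (X u w) (size u) A).

Local Notation L := (ratio J).
Local Notation ralpha := (ralpha blo bhi mu nu).
Local Notation dstar := (dstar blo bhi mu nu).

Let hL01 u w : words_star m 0 u -> 0 < L u w <= 1.
Proof. exact: ratio_pos_le1. Qed.

(** The conditional mean, given the past and that [v] has state 1, of the weight
    of its child of index [k]. *)
Definition kap (s : R) (v : seq nat) (k : nat) : R :=
  coef nu (size v) k * fine (expect P (fun w => L (rcons v k.+1) w `^ s)).

Lemma kap_ge0 s v k : 0 <= kap s v k.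
Proof.
rewrite /kap mulr_ge0 ?coef_ge0 // fine_ge0 // expect_ge0 // => w; exact: powR_ge0.
Qed.

Lemma kap_sum s v : words m 0 v -> \sum_(k < m (size v)) kap s v k = ralpha s (size v).
Proof.
move=> wv; apply: eq_bigr => k _; rewrite /kap; congr (_ * _).
rewrite (@law_moment _ _ _ P m blo bhi mu hmu L hLmeas hLlaw s v k (ltn_ord k) wv).
by rewrite /mom; congr (fine (emom _ _ _ _ _)); exact/val_inj.
Qed.

Lemma kap_step s v k g : 0 <= s -> words m 0 v -> (k < m (size v))%N ->
  adapted m L X (avoid m v) g -> (forall w, 0 <= g w) ->
  expect P (fun w => g w * ((X v w)%:R * weight L X s v k w)) =
  ((kap s v k)%:E * expect P (fun w => g w * (X v w)%:R)%R)%E.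
Proof.
move=> s0 wv km ag g0.
have := @one_step _ _ _ P m mu nu L X hLmeas hLlaw hLindep hXmeas hXL hXmarkov v k
  (fun r => r `^ s) g wv km (@measurable_powR R s) (fun r => powR_ge0 r s).
have L1 w : L (rcons v k.+1) w `^ s <= 1.
  exact: (@L_powR_le1 _ _ _ m L hL01 s s0 v k w wv km).
move=> /(_ L1 ag g0) H.
transitivity (\int[P]_w (g w * ((X v w)%:R * (X (rcons v k.+1) w)%:R * L (rcons v k.+1) w `^ s))%:E)%E.
  by apply: eq_expect => w; rewrite /weight !mulrA.
have mA : measurable [set x : (m (size v)).-tuple bool | nth false x k].
  rewrite (_ : [set x | _] = (fun x => tnth x (Ordinal km)) @^-1` [set true]).
    by rewrite -[X in measurable X]setTI; apply: measurable_tnth => //; exact: measurable_set1.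
  by apply/seteqP; split => x /=; rewrite (tnth_nth false).
rewrite H /kap EFinM; congr (_ * _ * _)%E.
  by rewrite /coef fineK //; apply: fin_num_measure; exact: mA.
rewrite -/(expect P (fun w => L (rcons v k.+1) w `^ s)).
by rewrite (@law_moment _ _ _ P m blo bhi mu hmu L hLmeas hLlaw s v k km wv) fineK // emom_fin.
Qed.

(** A deterministic fact, read on a single outcome where all ratios are within
    their bounds. *)
Lemma m_bounded : exists M : nat, forall j, (m j <= M)%N.
Proof.
have [w hw] := ae_exists (ae_ratio_bounds hmu hLmeas hLlaw).
have h := @branching_bounded _ _ _ _ hd m blo hblo J hJdiam hJsub hJdisj kappa kappa0 hJvol w hm
  (fun u wu => proj1 (andP (hw u wu))).
exists (Num.truncn (2 * 2 ^+ d / (kappa * blo ^+ d))).+1 => j.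
rewrite -(ler_nat R); apply: (le_trans (h j)); apply: ltW.
by rewrite real_truncnS_gt // num_real.
Qed.

(** The levels of [growth_below], with normalization by the mean weights and
    [q = expR (- c)]. *)
Lemma good_levels (s : R) : 0 <= s -> (s%:E < dstar)%E ->
  exists2 b : R, 0 < b <= 1 & forall n0, exists2 n, (n0 <= n)%N & good_level P m L X s b n.
Proof.
move=> s0 sd.
have [c c0 hc] := @growth_below R m blo bhi hblo hbhi mu hmu nu hbeta s sd.
have [M hM] := m_bounded.
pose q := expR (- c).
have q01 : 0 < q < 1 by rewrite expR_gt0 expR_lt1 oppr_lt0.
exists (uniform_bound M q)^-1.
  have D1 := @uniform_bound_ge1 R M q q01; have D0 := lt_le_trans ltr01 D1.
  by rewrite invr_gt0 D0 invf_le1.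
move=> n0; have [n n0n [alp hg]] := hc n0.
exists n => // v N g vn wv ag g01.
apply: (@expect_content_ge _ _ _ P m L X hLmeas hXmeas hL01 s (ralpha s) (fun j => (ralpha s j)^-1) s0 _
   (kap s) _ _ _ n M _ hM q (fun k => \prod_(n <= j < k) ralpha s j)) => //.
- by move=> j; rewrite invr_ge0 ralpha_ge0.
- by move=> v' k; exact: kap_ge0.
- by move=> v' wv'; exact: kap_sum.
- by move=> v' k g' wv' km ag' g'0; exact: kap_step.
- by move=> j nj; rewrite mulVf // gt_eqF // alp.
- by rewrite big_geq.
- by move=> k nk; rewrite big_nat_recr.
- move=> k nk; rewrite /q -expRM_natr; apply: (@le_trans _ _ (expR (c * (k - n)%:R) * expR (- c * (k - n)%:R))).
    by rewrite -expRD mulNr subrr expR0.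
  by rewrite ler_wpM2r ?expR_ge0 // hg.
Qed.

(** Survival for [N] generations is all that is used of an infinite path when the
    zero-one law is applied. *)
Lemma boundary_alive u zeta w N : words m 0 u -> boundary_tau m X u w zeta -> alive m X N u w.
Proof.
move=> wu hz.
have gen : forall N v, (exists i, (size u <= i)%N /\ v = mkseq zeta i) -> alive m X N v w.
  elim=> [|N' IH] v [i [ui vE]]; have [_ hX] := hz i ui.
    rewrite /= /Xset /= vE; have := hX i; rewrite ui size_mkseq leqnn => /(_ isT).
    by rewrite take_oversize // size_mkseq.
  split.
    rewrite /Xset /= vE; have := hX i; rewrite ui size_mkseq leqnn => /(_ isT).
    by rewrite take_oversize // size_mkseq.
  have [[y wy yE] _] := hz i.+1 (leqW ui).
  have := @words_cat m u y wu wy; rewrite yE.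
  have mk : mkseq zeta i.+1 = rcons v (zeta i).
    by rewrite vE /mkseq -addn1 iotaD map_cat /= cats1.
  rewrite mk => /words_rcons_inv[wv [k km zk]].
  rewrite -bigcup_seq; exists (Ordinal km); first by rewrite /= mem_index_enum.
  apply: IH; exists i.+1; split; first exact: leqW.
  by rewrite mk zk.
apply: gen; exists (size u); split => //.
have [[y wy yE] _] := hz (size u) (leqnn _).
have y0 : y = [::].
  apply/size0nil; have := congr1 size yE; rewrite size_cat size_mkseq => /eqP.
  by rewrite -[X in _ == X]addn0 eqn_add2l => /eqP.
by rewrite -yE y0 cats0.
Qed.

Lemma ae_charged (s : R) : 0 <= s -> (s%:E < dstar)%E ->
  {ae P, forall w, forall u, words m 0 u -> K m J X u w !=set0 -> charged m L X s u w}.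
Proof.
move=> s0 sd; apply: ae_countable => u.
case: (pselect (words m 0 u)) => wu; last by apply: aeW.
have [b b01 hg] := good_levels s0 sd.
have := @zero_one _ _ _ P m L X hLmeas hXmeas hL01 s s0 b b01 hg u wu.
move=> h0; exists ((\bigcap_N alive m X N u) `\` charged m L X s u); split => //.
  apply: measurableD; last exact: measurable_charged.
  by apply: bigcapT_measurable => N; exact: (@measurable_alive _ _ _ m L X hLmeas hXmeas).
move=> w /= nh; split.
  move=> N _; apply: contrapT => nL; apply: nh => _ [x [zeta hz _]].
  by case: nL; exact: boundary_alive hz.
by move=> hc; apply: nh.
Qed.

Lemma ae_light (s : R) : 0 <= s -> (dstar < s%:E)%E ->
  {ae P, forall w, forall u, words m 0 u -> ~ heavy m L X s (fun=> 1) u w}.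
Proof.
move=> s0 sd; apply: ae_countable => u.
case: (pselect (words m 0 u)) => wu; last by apply: aeW.
have := @heavy_negligible _ _ _ P m L X hLmeas hXmeas s (ralpha s) (fun=> 1) _ _ (kap s) _ _ _ u wu _.
have sm : forall eta : R, 0 < eta -> exists N, \prod_(size u <= j < size u + N) (1 * ralpha s j) < eta.
  move=> eta e0; have [N hN] := @small_above R m blo bhi hblo hbhi mu hmu nu hbeta s sd (size u) eta e0.
  by exists N; under eq_bigr do rewrite mul1r.
move=> H; have : P.-negligible (heavy m L X s (fun=> 1) u).
  apply: H => //.
  - by move=> j; exact: ralpha_ge0.
  - by move=> v' k; exact: kap_ge0.
  - by move=> v' wv'; exact: kap_sum.
  - by move=> v' k g' wv' km ag' g'0; exact: kap_step.
apply: negligibleS => w /= nh.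
by apply: contrapT => nhv; apply: nh => _ hv; exact: nhv.
Qed.

Lemma light_small (s : R) u w : X u w -> ~ heavy m L X s (fun=> 1) u w ->
  forall eta : R, 0 < eta -> exists N, mass m L X s (fun=> 1) N u w < eta.
Proof.
move=> Xu nh eta e0; apply: contrapT => /forallNP h; apply: nh; split => //.
have [i hi] := @exists_natSinv_le R eta e0.
by exists i => N; apply: le_trans hi _; rewrite leNgt; exact/negP/h.
Qed.

Lemma rat_between (x y : \bar R) : (x < y)%E -> (0 <= x)%E ->
  exists q : rat, (x < (ratr q)%:E)%E /\ ((ratr q)%:E < y)%E.
Proof.
move=> xy x0.
have [z xz zy] : exists2 z : R, (x < z%:E)%E & (z%:E <= y)%E.
  move: xy x0; case: x => [x||] //; case: y => [y||] //= xy x0.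
    by exists y.
  by exists (x + 1); [rewrite lte_fin ltrDl|rewrite leey].
case: x xy x0 xz => [x||] // xy x0; rewrite lte_fin => /rat_in_itvoo[q].
rewrite in_itv /= => /andP[q1 q2]; exists q; split; first by rewrite lte_fin.
by apply: lt_le_trans zy; rewrite lte_fin.
Qed.

(** Comparing with rational exponents only leaves countably many exceptional
    events. A rational exponent above the threshold has null Hausdorff measure,
    or kills every tree if it can be taken equal to 0; a rational exponent below
    it bounds the dimension from below as soon as one [K u] is nonempty. *)
Theorem dichotomy :
  {ae P, forall w,
     ((dstar < 0)%E -> hausdorff_dim (Theta m J X w) = -oo%E) /\
     ((0 <= dstar)%E ->
        hausdorff_dim (Theta m J X w) = -oo%E \/
        hausdorff_dim (Theta m J X w) = dstar)}.
Proof.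
have E1 := ae_ratio_bounds hmu hLmeas hLlaw.
have E2 : {ae P, forall w, forall q : rat, 0 <= ratr q :> R -> ((ratr q)%:E < dstar)%E ->
   forall u, words m 0 u -> K m J X u w !=set0 -> charged m L X (ratr q) u w}.
  apply: ae_countable => q; case: (pselect (0 <= ratr q :> R /\ ((ratr q)%:E < dstar)%E)) => [[h1 h2]|n].
    by have := ae_charged h1 h2; apply: filterS => w h _ _; exact: h.
  by apply: aeW => w h1 h2; case: n.
have E3 : {ae P, forall w, forall q : rat, 0 <= ratr q :> R -> (dstar < (ratr q)%:E)%E ->
   forall u, words m 0 u -> ~ heavy m L X (ratr q) (fun=> 1) u w}.
  apply: ae_countable => q; case: (pselect (0 <= ratr q :> R /\ (dstar < (ratr q)%:E)%E)) => [[h1 h2]|n].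
    by have := ae_light h1 h2; apply: filterS => w h _ _; exact: h.
  by apply: aeW => w h1 h2; case: n.
apply: filterS (filterI E1 (filterI E2 E3)) => w [h1 [h2 h3]].
have lift u : words m 0 u -> forall q : rat, 0 <= ratr q :> R -> (dstar < (ratr q)%:E)%E -> X u w ->
    forall eta, 0 < eta -> exists N, mass m L X (ratr q) (fun=> 1) N u w < eta.
  by move=> wu q q0 qd Xu; apply: light_small => //; exact: h3.
split => [d0|d0].
  have K0 u : words m 0 u -> K m J X u w = set0.
    move=> wu; apply/eqP; rewrite -[_ == _]negbK; apply/negP => /set0P Kn.
    have [Xu _] := K_nonempty wu Kn.
    have r0 : ratr 0 = 0 :> R by exact: rmorph0.
    have r0' : 0 <= ratr 0 :> R by rewrite r0.
    have r0d : (dstar < (ratr 0)%:E)%E by rewrite r0.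
    have [N] := lift u wu 0 r0' r0d Xu 1 ltr01; rewrite r0 => hN.
    by have := K_empty hJdiam hJsub wu hN => K0; case: Kn => x; rewrite K0.
  rewrite /hausdorff_dim (_ : Theta m J X w = set0) ?eqxx //.
  by apply/seteqP; split => // x [u wu]; rewrite K0.
rewrite /hausdorff_dim; case: eqP => [_|/eqP/set0P[x0 [u0 wu0 Kx0]]]; [by left|right].
apply/eqP; rewrite eq_le; apply/andP; split.
  rewrite leNgt; apply/negP => /rat_between /(_ d0)[q [q1 q2]].
  have q0 : 0 < ratr q :> R by rewrite -lte_fin; exact: le_lt_trans q1.
  have H0 : hausdorff_measure (ratr q) (Theta m J X w) = 0%E.
    apply: Theta_null => // u wu Xu; apply: lift => //; exact: ltW.
  have : (ereal_inf [set s%:E | s in [set s | (0 <= s)%R /\ hausdorff_measure s (Theta m J X w) = 0%E]]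
     <= (ratr q)%:E)%E.
    by apply: ereal_inf_lbound; exists (ratr q) => //; split => //; exact: ltW.
  by move=> /(lt_le_trans q2); rewrite ltxx.
apply: le_ereal_inf_tmp => _ [t [t0 Ht] <-].
rewrite leNgt; apply/negP => td.
have [q [q1 q2]] := rat_between td (t0 : (0 <= t%:E)%E).
rewrite lte_fin in q1.
have q0 : 0 < ratr q :> R := le_lt_trans t0 q1.
have Kn : K m J X u0 w !=set0 by exists x0.
have [Xu0 _] := K_nonempty wu0 Kn.
have hc := h2 q (ltW q0) q2 u0 wu0 Kn.
apply: (@frostman_lower _ _ _ _ hd m blo bhi hblo hbeta hbhi J hJcompact hJdiam hJsub hJdisj
  kappa kappa0 hJvol X w h1 (ratr q) t u0 (Theta m J X w)) => //.
  by rewrite t0 ltW.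
by move=> x Kx; exists u0.
Qed.

End main.

Theorem theorem1 (R : realType) (disp : measure_display)
    (T : measurableType disp) (P : probability T R)
    (d : nat) (hd : (1 <= d)%N)
    (m : nat -> nat) (hm : forall j, (2 <= m j)%N)
    (blo bhi : R) (hblo : 0 < blo) (hbeta : blo <= bhi) (hbhi : bhi < 1)
    (mu : forall j, probability ((m j).-tuple R) R)
    (hmu : forall j, mu j (cube blo bhi) = 1%E)
    (nu : bool -> forall j, probability ((m j).-tuple bool) R)
    (J : seq nat -> T -> set 'rV[R]_d)
    (hJcompact : forall u w, words m 0 u -> compact (J u w))
    (hJdiam : forall u w, words m 0 u -> 0 < diam (J u w))
    (* (A) *)
    (hJsub : forall u w k, words m 0 u -> (1 <= k <= m (size u))%N ->
       J (rcons u k) w `<=` J u w)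
    (hJdisj : forall u w k k', words m 0 u ->
       (1 <= k <= m (size u))%N -> (1 <= k' <= m (size u))%N -> k != k' ->
       (J (rcons u k) w)° `&` (J (rcons u k') w)° = set0)
    (* (B) *)
    (hJvol : exists2 kappa : R, 0 < kappa &
       forall u w, words m 0 u ->
         ((kappa * diam (J u w) ^+ d)%:E <= lebesgue_vol ((J u w)°))%E)
    (* (C) *)
    (hLmeas : forall u, words_star m 0 u -> measurable_fun setT (ratio J u))
    (hLlaw : forall u, words m 0 u ->
       has_law P (children m (ratio J) u) (mu (size u)))
    (hLindep : mutually_independent P (words m 0) (fun u =>
       preimage_set_system setT (children m (ratio J) u) measurable))
    (X : seq nat -> T -> bool)
    (hXmeas : forall u, words m 0 u -> measurable_fun setT (X u))
    (hXL : independent2 P (sigma_of (words m 0) X)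
                          (sigma_of (words_star m 0) (ratio J)))
    (hXmarkov : forall u (A : set ((m (size u)).-tuple bool)), words m 0 u ->
       is_cond_prob P (children m X u @^-1` A)
         (sigma_of (words m 0 `\` subtree_star m u) X)
         (fun w => nu (X u w) (size u) A)) :
  {ae P, forall w,
     ((dstar blo bhi mu nu < 0)%E -> hausdorff_dim (Theta m J X w) = -oo%E) /\
     ((0 <= dstar blo bhi mu nu)%E ->
        hausdorff_dim (Theta m J X w) = -oo%E \/
        hausdorff_dim (Theta m J X w) = dstar blo bhi mu nu)}.
Proof.
have [kappa kappa0 hvol] := hJvol.
exact: (@dichotomy R disp T P d hd m hm blo bhi hblo hbeta hbhi mu hmu nu J
  hJcompact hJdiam hJsub hJdisj kappa kappa0 hvol hLmeas hLlaw hLindep X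
  hXmeas hXL hXmarkov).
Qed.
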